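(* Let $k\geq 1$ be a fixed integer. Given a sequence $(m_n)_{n\geq 1}$ of positive integers, for each $n\ge 1$ let $X_1^n,X_2^n,\ldots,X_{m_n}^n$ be i.i.d. random vectors distributed uniformly on $[0,1]^k$, for $i\in\{1,\ldots,m_n\}$ let $Z_{ni}$ be the indicator of the event that $X_i^n$ is a maximum of $\{X_1^n,\ldots,X_{m_n}^n\}$, and let $$U_{ni}=\frac{Z_{ni}-p_{m_n}}{\sqrt{p_{m_n}(1-p_{m_n})}},$$ where $p_m$ denotes the probability that the first of $m$ i.i.d. uniform vectors on $[0,1]^k$ is a maximum of these $m$ vectors. 1. If $m_n=n$ for every $n\geq 1$, then for every $k\geq 1$, $$\frac{1}{np_n}\sum_{i=1}^n Z_{ni}\to 1\quad\text{as } n\to\infty\ \text{ in } L^2(P).$$ 2. If $k>1$ and $(m_n)_{n\ge1}$ is a sequence of positive integers such that $\lim_{n\to\infty} n/m_n=\gamma\in(0,1)$, then $$\sqrt{n}\left(\frac1n\sum_{i=1}^n U_{ni}-\frac{1}{m_n}\sum_{i=1}^{m_n}U_{ni}\right)\xrightarrow{d}\mathcal{N}(0,1-\gamma)\quad\text{as } n\to\infty.$$ 3. For any $k>1$ there exists a sequence $(m_n)_{n\geq1}$ of positive integers such that $$n\ll m_n\ll n\log^k n$$ and $$\frac{1}{\sqrt n}\sum_{i=1}^n U_{ni}\xrightarrow{d}\mathcal{N}(0,1)\quad\text{as } n\to\infty.$$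
   Context: $\prec$ is the product order on $\mathbb{R}^k$: $x\prec y$ if and only if $x_i\leq y_i$ for all $i\in\{1,\ldots,k\}$. In a finite family of vectors, a vector is a maximum if it is not $\prec$-dominated by any other vector of the family, i.e. $X_i$ is a maximum of $\{X_1,\ldots,X_m\}$ if $X_i\not\prec X_j$ for all $j\neq i$. Thus $p_m=P(X_1\not\prec X_j\ \forall\, 2\le j\le m)$ for $X_1,\ldots,X_m$ i.i.d. uniform on $[0,1]^k$. $\log^k n=(\log n)^k$; $a_n\ll b_n$ means $a_n/b_n\to0$ as $n\to\infty$; $\xrightarrow{d}$ is convergence in distribution and $\mathcal{N}(\mu,\sigma^2)$ is the normal law with mean $\mu$ and variance $\sigma^2$. In parts 2 and 3 one has $2\le n\leq m_n$ for all sufficiently large $n$, so the quantities are well defined for all sufficiently large $n$, which is all that matters for the limits. *)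

(* Defs.v *)
From HB Require Import structures.
From mathcomp Require Import all_boot all_order all_algebra.
From mathcomp Require Import all_classical all_reals all_analysis.

Set Implicit Arguments.
Unset Strict Implicit.
Unset Printing Implicit Defensive.

Import Order.TTheory GRing.Theory Num.Theory.
Import numFieldNormedType.Exports.

Local Open Scope classical_set_scope.
Local Open Scope ring_scope.

(* Families are indexed from 0 throughout: X_1, ..., X_m is X 0, ..., X m.-1. *)

Section maxima.
Context {R : realType} {k : nat}.

Definition dominated (x y : k.-tuple R) : Prop :=
  forall l : 'I_k, tnth x l <= tnth y l.

Definition is_maximum (m : nat) (x : nat -> k.-tuple R) (i : nat) : Prop :=
  forall j : nat, (j < m)%N -> j != i -> ~ dominated (x i) (x j).

End maxima.

Section power_probability.
Context d (T : measurableType d) (R : realType).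

Definition cons_pair (n : nat) (x : T * n.-tuple T) : n.+1.-tuple T :=
  [tuple of x.1 :: x.2].

Lemma measurable_cons_pair (n : nat) :
  measurable_fun [set: T * n.-tuple T] (@cons_pair n).
Proof. exact: measurable_cons. Qed.

HB.instance Definition _ (n : nat) :=
  isMeasurableFun.Build _ _ _ _ (@cons_pair n) (@measurable_cons_pair n).

Fixpoint power_prob (mu : probability T R) (n : nat) :
    probability (n.-tuple T) R :=
  match n with
  | 0%N => \d_([tuple] : 0.-tuple T)
  | n'.+1 => distribution (mu \x power_prob mu n')%E
               (@cons_pair n' : {mfun (T * n'.-tuple T)%type >-> n'.+1.-tuple T})
  end.

Lemma power_prob_box (mu : probability T R) (n : nat) (B : 'I_n -> set T) :
  (forall i, measurable (B i)) ->
  power_prob mu n [set t | forall i, B i (tnth t i)] =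
  (\prod_(i < n) mu (B i))%E.
Proof.
elim: n B => [|n IH] B mB.
  rewrite big_ord0 /= diracE mem_set//= => -[].
  by [].
rewrite big_ord_recl -IH//= /distribution/= /pushforward/=.
rewrite (_ : _ @^-1` _ = B ord0 `*`
    [set t | forall i, B (lift ord0 i) (tnth t i)]).
  rewrite product_measure1E//.
  rewrite (_ : [set t | _] = \bigcap_(i in [set: 'I_n])
      ((fun t : n.-tuple T => tnth t i) @^-1` B (lift ord0 i))).
    apply: fin_bigcap_measurable => // i _.
    by rewrite -[X in measurable X]setTI; exact: measurable_tnth.
  by apply/seteqP; split => t /= h i; [move=> _|]; exact: h.
apply/seteqP; split => -[a t] /=.
  move=> h; split; first exact: (h ord0).
  by move=> i; have := h (lift ord0 i); rewrite tnthS.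
move=> [h0 h] i; case: (unliftP ord0 i) => [j|] ->; last exact: h0.
by rewrite tnthS; exact: h.
Qed.

End power_probability.

Section uniform_cube.
Context (R : realType).

(* uniform_prob lives on measurableTypeR R, which has the same sigma-algebra as
   R but a different display. *)
Definition uniform01 : set R -> \bar R := uniform_prob (@ltr01 R).

HB.instance Definition _ := isMeasure.Build _ R R uniform01
  (measure0 (uniform_prob (@ltr01 R))) (measure_ge0 (uniform_prob (@ltr01 R)))
  (@measure_semi_sigma_additive _ _ _ (uniform_prob (@ltr01 R))).

HB.instance Definition _ := Measure_isProbability.Build _ R R uniform01
  (probability_setT (uniform_prob (@ltr01 R))).

Definition uniform_cube (k : nat) : probability (k.-tuple R) R :=
  power_prob uniform01 k.

(* The probability p_m, computed on the canonical space of m independent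
   uniform vectors; the default value of nth is never read when 0 < m. *)
Definition p_max (k m : nat) : R :=
  fine (power_prob (uniform_cube k) m
    [set t : m.-tuple (k.-tuple R) | is_maximum m (nth [tuple of nseq k 0] t) 0]).

End uniform_cube.

Section random_vectors.
Context d (T : measurableType d) (R : realType) (P : probability T R).

Definition has_law d' (T' : measurableType d') (X : {RV P >-> T'})
    (mu : probability T' R) : Prop :=
  forall A : set T', measurable A -> distribution P X A = mu A.

Definition independent_family d' (T' : measurableType d') (m : nat)
    (X : nat -> {RV P >-> T'}) : Prop :=
  forall (J : {set 'I_m}) (B : 'I_m -> set T'), (forall i, measurable (B i)) ->
    P (\bigcap_(i in [set` J]) (X i @^-1` B i)) =
    (\prod_(i in J) P (X i @^-1` B i))%E.

(* Nothing is assumed on the joint law of different rows, nor on the entries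
   X n i with i >= m n. *)
Definition iid_uniform_array (k : nat) (m : nat -> nat)
    (X : nat -> nat -> {RV P >-> k.-tuple R}) : Prop :=
  forall n : nat, (0 < n)%N ->
    (forall i, (i < m n)%N -> has_law (X n i) (uniform_cube R k)) /\
    independent_family (m n) (X n).

Section maxima_array.
Context (k : nat) (m : nat -> nat) (X : nat -> nat -> {RV P >-> k.-tuple R}).

Definition Z (n i : nat) : T -> R :=
  \1_[set w | is_maximum (m n) (fun j => X n j w) i].

Definition U (n i : nat) (w : T) : R :=
  (Z n i w - p_max R k (m n)) /
  Num.sqrt (p_max R k (m n) * (1 - p_max R k (m n))).

End maxima_array.

Definition cvg_in_L2 (Y : nat -> T -> R) (Y0 : T -> R) : Prop :=
  ('N[P]_2%:E[(fun w => (Y n w - Y0 w)%:E)] @[n --> \oo] --> 0)%E.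

Definition cvg_in_distribution (Y : nat -> T -> R) (mu : probability (measurableTypeR R) R) : Prop :=
  forall x : R, {for x, continuous (fun y : R => fine (mu `]-oo, y]%classic))} ->
    P [set w | Y n w <= x] @[n --> \oo] --> mu `]-oo, x]%classic.

End random_vectors.

(* Main.v *)
(* The indicators Z_1, ..., Z_m of the maxima are exchangeable.  Exchanging an
   index i <= n with an index j > n gives, for S = Z_1 + ... + Z_n and
   M = Z_1 + ... + Z_m, the exact Stein identity
     E[(n - S)(M - S)(g(S + 1, M) - g(S, M))] = E[(m S - n M) g(S, M)].
   As soon as M / (m p_m) tends to 1 in mean square and n p_m tends to infinity,
   W = (m S - n M) / (m sqrt(n p_m (1 - p_m))) therefore satisfies asymptotically
   the Stein equation of N(0, 1 - n / m).  Solving that equation for compactly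
   supported Lipschitz test functions, together with the tightness given by
   E[W^2] <= 1 / (1 - p_m), yields convergence in distribution.  This is part 2;
   in part 3, W differs from the normalized sum by
   (n / m)(M - m p_m) / sqrt(n p_m (1 - p_m)), which is negligible when m / n is
   of order strictly between log^(k-2) n and log^(k-1) n.

   Part 1 and the hypothesis on M reduce to an upper bound on P(Z_1 = Z_2 = 1).
   For a point x let vol x be the volume of the set of points dominating it.  Let
   g(t) be the mean of (1 - t vol x)^(m-2) over the (k-1)-cube.  Given that the
   first coordinates of X_1 and X_2 leave fractions s <= t of [0, 1] above them,
   both are maxima with probability at most g(s) g(t) + 6 g(t)^2.  Since t g(t)
   is nondecreasing, integrating over s and t bounds P(Z_1 = Z_2 = 1) by
   q_k^2 + 12 q_(k-1) q_k, where q_k is p_(m-1) in dimension k; and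
   q_(k-1) / q_k = O(1 / log m), because m p_m is of order log^(k-1) m. *)

From HB Require Import structures.
Require Import Defs.
From mathcomp Require Import all_boot all_order all_algebra fingroup perm.
From mathcomp Require Import all_classical all_reals all_analysis.
From mathcomp Require Import measurable_realfun.
From mathcomp Require Import ring lra.

Set Implicit Arguments.
Unset Strict Implicit.
Unset Printing Implicit Defensive.

Import Order.TTheory GRing.Theory Num.Theory.
Import numFieldNormedType.Exports.

Local Open Scope classical_set_scope.
Local Open Scope ring_scope.

(** * Laws on tuples and exchangeability *)

(** Rows are never compared with one another, so everything about row n is read off a probability on
    the finite set of patterns [{ffun 'I_m -> bool}]. The Stein argument uses exchangeability, the
    mean p and the L1 error of the total.

    An exchange keeps M fixed and moves S by one, hence W by 1 / sqrt(n p (1 - p)). The number (n -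
    S)(M - S) of available exchanges becomes, after normalization, a random variance; it is close to
    1 - n / m because M is close to m p, while S / n has mean p, which tends to 0.

    Test functions are taken with zero Gaussian mean: the Stein solution then has compact support
    too, and all its bounds follow from compactness instead of tail estimates. The price is that
    neither constants nor indicators are admissible; only ratios of expectations of two test
    functions are obtained, and tightness fixes the normalization.

    In the pair bound the obstacle is the overlap of the two dominating regions, which couples the
    points. It is absorbed into the two separate volumes, so that the bound factorizes. *)

Section tuple_laws.
Context d (T : measurableType d) (R : realType).

Definition box n (B : 'I_n -> set T) : set (n.-tuple T) :=
  [set t | forall i, B i (tnth t i)].

Lemma boxE n (B : 'I_n -> set T) :
  box B = \bigcap_(i in [set: 'I_n]) ((fun t : n.-tuple T => tnth t i) @^-1` B i).
Proof. by apply/seteqP; split=> t /= h i; [move=> _|]; exact: h. Qed.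

Lemma measurable_box n (B : 'I_n -> set T) :
  (forall i, measurable (B i)) -> measurable (box B).
Proof.
move=> mB; rewrite boxE; apply: fin_bigcap_measurable => // i _.
by rewrite -[X in measurable X]setTI; exact: measurable_tnth.
Qed.

(** Boxes are stable under intersection, and each generator of the sigma-algebra of tuples, a
    preimage under one coordinate, is a box whose other sides are full. *)
Lemma tuple_measure_unique n (mu1 mu2 : probability (n.-tuple T) R) :
  (forall B : 'I_n -> set T, (forall i, measurable (B i)) ->
    mu1 (box B) = mu2 (box B)) ->
  forall A, measurable A -> mu1 A = mu2 A.
Proof.
move=> mu12 A mA.
pose G : set (set (n.-tuple T)) :=
  [set C | exists2 B : 'I_n -> set T, (forall i, measurable (B i)) & C = box B].
have Gm : G `<=` measurable by move=> _ [B mB ->]; exact: measurable_box.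
have GT : G setT.
  by exists (fun=> setT) => //; apply/seteqP; split.
apply: (g_sigma_algebra_measure_unique G Gm (fun=> setT)) => //.
- by apply/seteqP; split => // x _; exists 0%N.
- move=> _ _ [B mB ->] [C mC ->]; exists (fun i => B i `&` C i).
    by move=> i; exact: measurableI.
  apply/seteqP; split => t /=.
    by move=> [tB tC] i; split; [exact: tB|exact: tC].
  by move=> tBC; split=> i; have [] := tBC i.
- by move=> _ [B mB ->]; exact: mu12.
- by move=> _; apply: (le_lt_trans (probability_le1 mu1 measurableT)); rewrite ltry.
- move: A mA; apply: smallest_sub; first exact: smallest_sigma_algebra.
  move=> C; rewrite -bigcup_seq => -[/= i _ [B mB <-]].
  apply: sub_sigma_algebra.
  exists (fun j => if j == i then B else setT); first by move=> j; case: ifP.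
  rewrite setTI; apply/seteqP; split => t /=.
    by move=> tB j; case: eqP => [->|].
  by move=> /(_ i); rewrite eqxx.
Qed.

End tuple_laws.

Section row_law.
Context d (T : measurableType d) (R : realType) (P : probability T R).
Context d' (T' : measurableType d') (m : nat) (X : nat -> {RV P >-> T'}).

Definition row_tuple (w : T) : m.-tuple T' := [tuple X i w | i < m].

Lemma measurable_row_tuple : measurable_fun [set: T] row_tuple.
Proof.
apply/measurable_fun_tnthP => i.
rewrite (_ : _ \o _ = X i); first exact: measurable_funPT.
by apply/funext => w /=; rewrite tnth_mktuple.
Qed.

HB.instance Definition _ :=
  isMeasurableFun.Build _ _ _ _ row_tuple measurable_row_tuple.

Lemma row_tuple_law (mu : probability T' R) :
  (forall i, (i < m)%N -> has_law (X i) mu) -> independent_family m X ->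
  forall A, measurable A -> P (row_tuple @^-1` A) = power_prob mu m A.
Proof.
move=> Xmu indX.
apply: (tuple_measure_unique
  (mu1 := distribution P (row_tuple : {mfun T >-> m.-tuple T'}))) => B mB.
rewrite power_prob_box//.
transitivity (\prod_(i in [set: 'I_m]%SET) P (X i @^-1` B i))%E; last first.
  apply: eq_big => [i|i _]; first by rewrite finset.in_setT.
  by rewrite -(Xmu i)//.
rewrite -(indX [set: 'I_m]%SET B mB) /distribution/= /pushforward/=.
congr (P _); apply/seteqP; split => w /=.
  by move=> h i _; have := h i; rewrite tnth_mktuple.
by move=> h i; rewrite tnth_mktuple; apply: (h i); rewrite /= finset.in_setT.
Qed.

End row_law.

Section exchangeability.
Context d (T : measurableType d) (R : realType) (mu : probability T R) (n : nat).

Definition perm_tuple (s : {perm 'I_n}) (t : n.-tuple T) : n.-tuple T :=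
  [tuple tnth t (s i) | i < n].

Lemma measurable_perm_tuple s : measurable_fun [set: n.-tuple T] (perm_tuple s).
Proof.
apply/measurable_fun_tnthP => i.
rewrite (_ : _ \o _ = fun t => tnth t (s i)); first exact: measurable_tnth.
by apply/funext => w /=; rewrite tnth_mktuple.
Qed.

HB.instance Definition _ s :=
  isMeasurableFun.Build _ _ _ _ (perm_tuple s) (@measurable_perm_tuple s).

(** Permuting the coordinates of a box permutes its sides, which leaves the product of their
    measures unchanged; boxes determine the law. *)
Lemma power_prob_perm s A : measurable A ->
  power_prob mu n (perm_tuple s @^-1` A) = power_prob mu n A.
Proof.
move: A; apply: (tuple_measure_unique (mu1 := distribution (power_prob mu n)
  (perm_tuple s : {mfun n.-tuple T >-> n.-tuple T}))) => B mB.
rewrite /distribution/= /pushforward/=.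
transitivity (power_prob mu n (box (fun i => B ((s^-1)%g i)))).
  congr (power_prob mu n _); apply/seteqP; split => t /=.
    by move=> h i; have := h ((s^-1)%g i); rewrite tnth_mktuple permKV.
  by move=> h i; have := h (s i); rewrite tnth_mktuple permK.
rewrite !power_prob_box//.
rewrite [RHS](reindex_inj (@perm_inj _ (s^-1)%g))/=.
by [].
Qed.

End exchangeability.

Section finite_valued.
Context d (T : measurableType d) (R : realType) (P : probability T R).
Context (J : finType) (V : T -> J).
Hypothesis mV : forall z, measurable [set w | V w = z].

(** This turns expectations over the abstract space [T] into finite sums over patterns of maxima. *)
Lemma integral_finite_valued (F : J -> R) : (forall z, 0 <= F z) ->
  (\int[P]_w (F (V w))%:E = (\sum_z fine (P [set w | V w = z]) * F z)%:E)%E.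
Proof.
move=> F0.
transitivity (\int[P]_w (\sum_z (F z * \1_[set w | V w = z] w)%:E))%E.
  apply: eq_integral => w _; rewrite sumEFin; congr EFin.
  rewrite (bigD1 (V w))//= indicE mem_set//= mulr1 big1 ?addr0// => z zV.
  by rewrite indicE memNset ?mulr0// => /= /esym/eqP; rewrite (negbTE zV).
rewrite ge0_integral_sum//.
- rewrite -sumEFin; apply: eq_bigr => z _.
  under eq_integral do rewrite EFinM.
  rewrite ge0_integralZl//; last 2 first.
  + exact/measurable_EFinP.
  + by rewrite lee_fin.
  rewrite integral_indic; [rewrite setIT [RHS]EFinM fineK ?fin_num_measure//; exact: muleC
  |exact: measurableT|exact: mV].
- by move=> z; apply/measurable_EFinP; exact: measurable_funM.
- by move=> z w _; rewrite lee_fin mulr_ge0.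
Qed.

Lemma probability_finite_valued (Q : pred J) :
  P [set w | Q (V w)] = (\sum_z fine (P [set w | V w = z]) * (Q z)%:R)%:E.
Proof.
rewrite -(integral_finite_valued (F := fun z => (Q z)%:R))// -(setIT [set _ | _]).
rewrite -integral_indic//.
  apply: eq_integral => w _; rewrite indicE.
  by congr ((nat_of_bool _)%:R%:E); apply/idP/idP; rewrite inE.
rewrite (_ : [set _ | _] = \bigcup_(z in [set z | Q z]) [set w | V w = z]).
  by apply: fin_bigcup_measurable.
apply/seteqP; split => w /=; first by move=> QV; exists (V w).
by move=> [z Qz ->].
Qed.

Lemma sum_finite_valued : \sum_z fine (P [set w | V w = z]) = 1.
Proof.
have := probability_finite_valued xpredT.
rewrite (_ : [set _ | _] = setT); last by apply/seteqP; split.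
rewrite probability_setT => -[->].
by apply: eq_bigr => z _; rewrite mulr1.
Qed.

End finite_valued.

(** * The exchangeable law of the pattern of maxima *)

Section maxima_law.
Context (R : realType) (k m : nat).
Local Notation point := (k.-tuple R).

(** The pattern is a value in a finite type, so that its law is a finite family of weights. *)
Definition maxima (t : m.-tuple point) : {ffun 'I_m -> bool} :=
  [ffun i => `[< forall j, j != i -> ~ dominated (tnth t i) (tnth t j) >]].

Lemma measurable_dominated_tnth (i j : 'I_m) :
  measurable [set t : m.-tuple point | dominated (tnth t i) (tnth t j)].
Proof.
rewrite (_ : [set _ | _] = \bigcap_(l in [set: 'I_k])
  [set t : m.-tuple point | tnth (tnth t i) l <= tnth (tnth t j) l]); last first.
  by apply/seteqP; split => t h l; [move=> _|]; exact: h.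
have mc (h : 'I_m) (l : 'I_k) :
    measurable_fun [set: m.-tuple point] (fun t => tnth (tnth t h) l : R).
  apply: (@measurableT_comp _ _ _ _ _ _ (fun x : point => tnth x l)) => //.
    exact: measurable_tnth.
  exact: measurable_tnth.
apply: fin_bigcap_measurable => // l _.
rewrite -[X in measurable X]setTI.
by apply: measurable_fun_le.
Qed.

Lemma measurable_maxima z : measurable [set t | maxima t = z].
Proof.
rewrite (_ : [set _ | _] = \bigcap_(i in [set: 'I_m])
  (if z i then [set t | maxima t i] else ~` [set t | maxima t i])); last first.
  apply/seteqP; split => t /= h.
    by move=> i _; case: ifP; rewrite -h//= => ->.
  by apply/ffunP => i; have := h i I; case: ifP => _ //= /negP/negbTE.
have mi i : measurable [set t | maxima t i].
  rewrite (_ : [set _ | _] = \bigcap_(j in [set j | j != i])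
    ~` [set t : m.-tuple point | dominated (tnth t i) (tnth t j)]).
    apply: fin_bigcap_measurable => [|j _]; first exact: finite_finset.
    by apply: measurableC; exact: measurable_dominated_tnth.
  apply/seteqP; split => t /=; rewrite ffunE.
    by move=> /asboolP h j /=; exact: h.
  by move=> h; apply/asboolP => j; exact: h.
by apply: fin_bigcap_measurable => // i _; case: ifP => _ //; exact: measurableC.
Qed.

Definition maxima_prob (z : {ffun 'I_m -> bool}) : R :=
  fine (power_prob (uniform_cube R k) m [set t | maxima t = z]).

Lemma maxima_prob_ge0 z : 0 <= maxima_prob z.
Proof. exact: fine_ge0. Qed.

Lemma sum_maxima_prob : \sum_z maxima_prob z = 1.
Proof. exact: sum_finite_valued measurable_maxima. Qed.

Definition perm_ffun (s : {perm 'I_m}) (z : {ffun 'I_m -> bool}) :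
  {ffun 'I_m -> bool} := [ffun i => z (s i)].

Lemma perm_ffunK s : cancel (perm_ffun s) (perm_ffun s^-1%g).
Proof. by move=> z; apply/ffunP => i; rewrite !ffunE permKV. Qed.

Lemma maxima_perm s t : maxima (perm_tuple s t) = perm_ffun s (maxima t).
Proof.
apply/ffunP => i; rewrite !ffunE; apply/idP/idP => /asboolP h; apply/asboolP.
  move=> j ji; have := h ((s^-1)%g j); rewrite !tnth_mktuple permKV; apply.
  by apply: contraNneq ji => <-; rewrite permKV.
by move=> j ji; rewrite !tnth_mktuple; apply: h; rewrite (inj_eq perm_inj).
Qed.

Lemma maxima_prob_perm s z : maxima_prob (perm_ffun s z) = maxima_prob z.
Proof.
rewrite /maxima_prob -(power_prob_perm _ s); last exact: measurable_maxima.
congr (fine (power_prob _ _ _)); apply/seteqP; split => t /=; rewrite maxima_perm.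
  exact: (can_inj (perm_ffunK s)).
by move=> ->.
Qed.

(** Exchangeability as a rule for means: the maxima of permuted points are the permuted maxima, and
    the points are i.i.d. *)
Lemma maxima_prob_reindex s (F : {ffun 'I_m -> bool} -> R) :
  \sum_z maxima_prob z * F z = \sum_z maxima_prob z * F (perm_ffun s z).
Proof.
rewrite (reindex_inj (can_inj (perm_ffunK s)))/=.
by under eq_bigr do rewrite maxima_prob_perm.
Qed.

End maxima_law.

(** * Probabilities of maxima as integrals *)

Section dominance_volume.
Context (R : realType).

(** The probability that a uniform variable on [0, 1] is at least [a]; clamped because [a] ranges
    over all of [R]. *)
Definition survival (a : R) : R := Num.min 1 (Num.max 0 (1 - a)).

Lemma survival_ge0 a : 0 <= survival a.
Proof. by rewrite le_min ler01 le_max lexx. Qed.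

Lemma survival_le1 a : survival a <= 1.
Proof. by rewrite ge_min lexx. Qed.

Lemma uniform01_survival a : uniform01 `[a, +oo[%classic = (survival a)%:E.
Proof.
rewrite /uniform01 /uniform_prob integral_uniform_pdf.
rewrite (_ : _ `&` _ = `[Num.max 0 a, 1]%classic); last first.
  apply/seteqP; split => x /=; rewrite !in_itv/= ge_max.
    by move=> [/andP[-> _] /andP[-> ->]].
  by move=> /andP[/andP[-> ->] ->].
rewrite (eq_integral (fun=> 1%E)); last first.
  move=> x; rewrite inE/= in_itv/= ge_max => /andP[/andP[x0 ax] x1].
  by rewrite /uniform_pdf x0 x1 subr0 invr1.
rewrite integral_cst//= mul1e lebesgue_measure_itv/= lte_fin gt_max ltr01/=.
rewrite /survival; case: (ltP a 1) => a1; last first.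
  by congr EFin; rewrite max_l ?subr_le0// min_r.
rewrite EFinN -EFinB; congr EFin.
case: (leP 0 a) => a0.
  by rewrite max_r ?subr_ge0 ?ltW// min_r// gerBl.
by rewrite subr0 max_r ?subr_ge0 ?ltW// min_l// lerBrDr gerDl ltW.
Qed.

Lemma survival_min a b :
  survival (Num.max a b) = Num.min (survival a) (survival b).
Proof.
rewrite /survival; case: (leP a b) => ab; rewrite [RHS]minC.
  by rewrite [RHS]min_l// le_min2// le_max2// lerB.
by rewrite [RHS]min_r// le_min2// le_max2// lerB// ltW.
Qed.

Lemma measurable_survival : measurable_fun [set: R] survival.
Proof.
apply: measurable_minr => //; apply: measurable_maxr => //.
exact: measurable_funB.
Qed.

Context (k : nat).
Implicit Types x y : k.-tuple R.

Definition vol x : R := \prod_(l < k) survival (tnth x l).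

(** The mass of the points dominating both [x] and [y], that is, of the orthant above their
    coordinatewise maximum. *)
Definition vol2 x y : R :=
  \prod_(l < k) Num.min (survival (tnth x l)) (survival (tnth y l)).

Lemma uniform_cube_dominated2 x y :
  uniform_cube R k [set z | dominated x z /\ dominated y z] = (vol2 x y)%:E.
Proof.
rewrite (_ : [set _ | _] =
    box (fun l => `[Num.max (tnth x l) (tnth y l), +oo[%classic)).
  rewrite /uniform_cube power_prob_box//.
  rewrite -prodEFin; apply: eq_bigr => l _.
  by rewrite -survival_min -uniform01_survival.
apply/seteqP; split => z /=.
  by move=> [xz yz] l; rewrite /= in_itv/= andbT ge_max xz yz.
by move=> h; split=> l; have := h l; rewrite /= in_itv/= andbT ge_max => /andP[].
Qed.

Lemma measurable_dominating x : measurable [set z | dominated x z].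
Proof.
rewrite (_ : [set _ | _] = box (fun l => `[tnth x l, +oo[%classic)).
  exact: measurable_box.
by apply/seteqP; split => z /= h l; have := h l; rewrite /= ?in_itv/= ?andbT.
Qed.

Lemma uniform_cube_dominated x :
  uniform_cube R k [set z | dominated x z] = (vol x)%:E.
Proof.
transitivity (vol2 x x)%:E; last by congr EFin; apply: eq_bigr => l _; rewrite minxx.
rewrite -uniform_cube_dominated2; congr (uniform_cube R k _).
by apply/seteqP; split => z //= [].
Qed.

Lemma uniform_cube_undominated x :
  uniform_cube R k [set z | ~ dominated x z] = (1 - vol x)%:E.
Proof.
rewrite -[X in uniform_cube R k X]/(~` [set z | dominated x z]).
rewrite probability_setC; last exact: measurable_dominating.
by rewrite EFinB; congr (_ - _)%E; exact: uniform_cube_dominated.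
Qed.

Lemma uniform_cube_undominated2 x y :
  uniform_cube R k [set z | ~ dominated x z /\ ~ dominated y z] =
  (1 - vol x - vol y + vol2 x y)%:E.
Proof.
rewrite (_ : [set _ | _] =
    ~` ([set z | dominated x z] `|` [set z | dominated y z])); last first.
  by rewrite setCU.
have mx := measurable_dominating x; have my := measurable_dominating y.
rewrite probability_setC; last exact: measurableU.
rewrite measureUfinr//; last first.
  by rewrite (le_lt_trans (probability_le1 _ my)) ?ltry.
rewrite (_ : [set z | dominated x z] `&` _ =
  [set z | dominated x z /\ dominated y z]) //.
have Ex := uniform_cube_dominated x; have Ey := uniform_cube_dominated y.
have Exy := uniform_cube_dominated2 x y.
set a := (X in (1 - X)%E); have -> : a = (vol x + vol y - vol2 x y)%:E.
  by rewrite /a EFinB EFinD; congr (_ + _ - _)%E.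
by rewrite -EFinB; congr EFin; ring.
Qed.

Lemma vol_ge0 x : 0 <= vol x.
Proof. by apply: prodr_ge0 => l _; exact: survival_ge0. Qed.

Lemma vol_le1 x : vol x <= 1.
Proof.
by rewrite -lee_fin -uniform_cube_dominated probability_le1//;
  exact: measurable_dominating.
Qed.

Lemma vol2C x y : vol2 x y = vol2 y x.
Proof. by apply: eq_bigr => l _; rewrite minC. Qed.

Lemma vol2_le x y : vol2 x y <= vol x.
Proof.
apply: ler_prod => l _; rewrite le_min !survival_ge0/=.
by rewrite ge_min lexx.
Qed.

(** Since a b <= min(a, b) on [0, 1], the orthants above two points are positively correlated. *)
Lemma vol2_ge x y : vol x * vol y <= vol2 x y.
Proof.
rewrite /vol -big_split; apply: ler_prod => l _/=.
by rewrite mulr_ge0 ?survival_ge0//= le_min ler_piMr ?ler_piMl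
  ?survival_ge0 ?survival_le1.
Qed.

Lemma measurable_vol : measurable_fun [set: k.-tuple R] vol.
Proof.
apply: measurable_prod => l _.
by apply: measurableT_comp; [exact: measurable_survival|exact: measurable_tnth].
Qed.

Lemma measurable_vol2 :
  measurable_fun [set: k.-tuple R * k.-tuple R] (fun p => vol2 p.1 p.2).
Proof.
apply: measurable_prod => l _.
apply: measurable_minr; apply: measurableT_comp; try exact: measurable_survival.
  by apply: (@measurableT_comp _ _ _ _ _ _ (fun x : k.-tuple R => tnth x l));
    [exact: measurable_tnth|exact: measurable_fst].
by apply: (@measurableT_comp _ _ _ _ _ _ (fun x : k.-tuple R => tnth x l));
  [exact: measurable_tnth|exact: measurable_snd].
Qed.

End dominance_volume.

Lemma vol_cons (R : realType) k (a : R) (x : k.-tuple R) :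
  vol [tuple of a :: x] = survival a * vol x.
Proof.
rewrite /vol big_ord_recl; congr (survival _ * _).
by apply: eq_bigr => l _; rewrite tnthS.
Qed.

Lemma vol2_cons (R : realType) k (a b : R) (x y : k.-tuple R) :
  vol2 [tuple of a :: x] [tuple of b :: y] =
  Num.min (survival a) (survival b) * vol2 x y.
Proof.
rewrite /vol2 big_ord_recl; congr (Num.min (survival _) (survival _) * _).
by apply: eq_bigr => l _; rewrite !tnthS.
Qed.

Section maxima_integrals.
Context (R : realType) (k : nat).
Local Notation mu := (uniform_cube R k).
Local Notation point := (k.-tuple R).

Lemma power_prob_cons d (T : measurableType d) (P : probability T R) n
    (A : set (n.+1.-tuple T)) : measurable A ->
  power_prob P n.+1 A =
  (\int[P]_x power_prob P n [set t : n.-tuple T | A [tuple of x :: t]])%E.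
Proof.
move=> mA; apply: eq_integral => x _ /=; congr (power_prob P n _).
by apply/seteqP; split => t; rewrite xsectionE.
Qed.

Lemma measurable_power_prob_cons d (T : measurableType d) (P : probability T R)
    n (A : set (n.+1.-tuple T)) : measurable A ->
  measurable_fun setT
    (fun x => power_prob P n [set t : n.-tuple T | A [tuple of x :: t]]).
Proof.
move=> mA.
have mA' : measurable ((@cons_pair _ T n) @^-1` A).
  by rewrite -[X in measurable X]setTI; exact: measurable_cons_pair.
have := measurable_fun_xsection (power_prob P n) mA'.
apply: eq_measurable_fun => x _ /=; congr (power_prob P n _).
by apply/seteqP; split => t; rewrite xsectionE.
Qed.

Lemma measurable_maximum m i :
  measurable [set t : m.-tuple point | maxima t i].
Proof.
rewrite (_ : [set _ | _] = \bigcup_(z in [set z : {ffun 'I_m -> bool} | z i])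
    [set t : m.-tuple point | maxima t = z]).
  by apply: fin_bigcup_measurable => [|z _];
    [exact: finite_finset|exact: measurable_maxima].
by apply/seteqP; split => [t ti|t [z zi /= ->//]]; exists (maxima t).
Qed.

Definition undominated2 (x y : point) : R := 1 - vol x - vol y + vol2 x y.

Lemma undominated2_ge0 x y : 0 <= undominated2 x y.
Proof.
rewrite -lee_fin -uniform_cube_undominated2; exact: measure_ge0.
Qed.

Lemma measurable_undominated2X m : measurable_fun [set: point * point]
  (fun p => (undominated2 p.1 p.2 ^+ m)%:E).
Proof.
apply/measurable_EFinP; apply: measurable_funX.
apply: measurable_funD; last exact: measurable_vol2.
apply: measurable_funB; last first.
  by apply: measurableT_comp; [exact: measurable_vol|exact: measurable_snd].
apply: measurable_funB => //.
by apply: measurableT_comp; [exact: measurable_vol|exact: measurable_fst].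
Qed.

(** Given the first point x, each of the other [m] points independently fails to dominate it with
    probability 1 - vol x. *)
Lemma maximum_probability m :
  power_prob mu m.+1 [set t | maxima t ord0] =
  (\int[mu]_x ((1 - vol x) ^+ m)%:E)%E.
Proof.
rewrite power_prob_cons; last exact: measurable_maximum.
apply: eq_integral => x _.
rewrite (_ : [set t | _] = box (fun=> [set z | ~ dominated x z])); last first.
  apply/seteqP; split => t /=; rewrite ffunE.
    by move=> /asboolP h i; have := h (lift ord0 i); rewrite tnthS; apply.
  move=> h; apply/asboolP => j j0; case: (unliftP ord0 j) j0 => [i ->|->].
    by move=> _; rewrite tnthS; exact: h.
  by rewrite eqxx.
have mB : measurable [set z | ~ dominated x z].
  by apply: measurableC; exact: measurable_dominating.
rewrite power_prob_box// (eq_bigr (fun=> (1 - vol x)%:E)).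
  by rewrite prodEFin prodr_const card_ord.
by move=> i _; exact: uniform_cube_undominated.
Qed.

(** Only an inequality: the event is enlarged by forgetting how the two points x and y compare with
    each other, so that only the [m] other points are constrained. *)
Lemma maxima_pair_probability m :
  (power_prob mu m.+2
    [set t | maxima t ord0 && maxima t (lift ord0 ord0)] <=
  \int[mu]_x \int[mu]_y (undominated2 x y ^+ m)%:E)%E.
Proof.
set A := [set t | _].
have mA : measurable A.
  rewrite (_ : A = [set t | maxima t ord0] `&` [set t | maxima t (lift ord0 ord0)]).
    by apply: measurableI; exact: measurable_maximum.
  by apply/seteqP; split => t /=; [move=> /andP[]|move=> [? ?]; apply/andP].
rewrite power_prob_cons//.
have mf := measurable_undominated2X m.
have f0 p : (0 <= (undominated2 p.1 p.2 ^+ m)%:E)%E.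
  by rewrite lee_fin exprn_ge0// undominated2_ge0.
apply: ge0_le_integral => //.
- exact: measurable_power_prob_cons.
- exact: (measurable_fun_fubini_tonelli_F (m2 := mu) _ mf f0).
move=> x _.
have mAx : measurable [set t : m.+1.-tuple point | A [tuple of x :: t]].
  have := @measurable_cons_pair _ point m.+1 measurableT A mA.
  rewrite setTI => /(measurable_xsection x); congr measurable.
  by apply/seteqP; split => t; rewrite xsectionE.
rewrite power_prob_cons//.
apply: ge0_le_integral => //.
- exact: measurable_power_prob_cons.
- exact: (measurableT_comp mf (measurable_pair1 x)).
move=> y _.
have mB : measurable [set z | ~ dominated x z /\ ~ dominated y z].
  by apply: measurableI; apply: measurableC; exact: measurable_dominating.
have <- : power_prob mu m
    (box (fun=> [set z | ~ dominated x z /\ ~ dominated y z])) =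
    (undominated2 x y ^+ m)%:E.
  rewrite power_prob_box// (eq_bigr (fun=> (undominated2 x y)%:E)).
    by rewrite prodEFin prodr_const card_ord.
  by move=> i _; exact: uniform_cube_undominated2.
apply: le_measure; rewrite ?inE; last 1 first.
- move=> t /andP[]; rewrite !ffunE => /asboolP h0 /asboolP h1 i; split.
    have := h0 (lift ord0 (lift ord0 i)); rewrite !tnthS; apply.
    by rewrite eq_sym eq_liftF.
  have := h1 (lift ord0 (lift ord0 i)); rewrite !tnthS; apply.
  by rewrite (inj_eq lift_inj).
- have := @measurable_cons_pair _ point m measurableT _ mAx.
  rewrite setTI => /(measurable_xsection y); congr measurable.
  by apply/seteqP; split => t; rewrite xsectionE.
- exact: measurable_box.
Qed.

End maxima_integrals.

(** * Moments of the dominating volume, by recursion on the dimension *)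

Section calculus.
Context (R : realType).

Lemma FTC2_is_derive (f F : R -> R) (a b : R) : a < b -> continuous f ->
  (forall x, is_derive x (1 : R) F (f x)) ->
  (\int[lebesgue_measure]_(x in `[a, b]) (f x)%:E = (F b - F a)%:E)%E.
Proof.
move=> ab cf dF.
have dF' x : derivable F x 1 by case: (dF x).
have cF : continuous F by move=> x; exact/differentiable_continuous/derivable1_diffP.
rewrite EFinB; apply: continuous_FTC2 => //.
- exact: continuous_subspaceT.
- split=> //.
  + exact/cvg_at_right_filter/cF.
  + exact/cvg_at_left_filter/cF.
- by move=> x _; rewrite derive1E; case: (dF x).
Qed.

End calculus.

Section moments.
Context (R : realType).

(* The mean of [(1 - t * vol x) ^+ N] over the [k]-cube (see [integral_moment]);
   the recursion integrates out one coordinate. *)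
Fixpoint moment (k N : nat) (t : R) : R :=
  if k is k'.+1 then N.+1%:R^-1 * \sum_(i < N.+1) moment k' i t
  else (1 - t) ^+ N.

Lemma integral_power_prob_cons d (T : measurableType d) (P : probability T R) n
    (f : n.+1.-tuple T -> \bar R) :
  measurable_fun setT f -> (forall t, 0 <= f t)%E ->
  (\int[power_prob P n.+1]_t f t =
   \int[P]_x \int[power_prob P n]_t f [tuple of x :: t])%E.
Proof.
move=> mf f0.
rewrite ge0_integral_pushforward//.
rewrite preimage_setT (fubini_tonelli1 (m1 := P) (m2 := power_prob P n))//.
  by apply: measurableT_comp => //; exact: measurable_cons_pair.
by move=> x; exact: f0.
Qed.

Lemma integral_uniform01 (f : R -> R) :
  measurable_fun setT f -> (forall x, 0 <= f x) ->
  (\int[@uniform01 R]_x (f x)%:E =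
   \int[lebesgue_measure]_(x in `[0%R, 1%R]) (f x)%:E)%E.
Proof.
move=> mf f0.
(* [uniform_prob] lives on [measurableTypeR R]; the push-forward along the identity changes the
   display and keeps the measure. *)
have mid : measurable_fun [set: measurableTypeR R] (id : measurableTypeR R -> R).
  by move=> _ A mA; rewrite setTI.
transitivity (\int[pushforward (uniform_prob (@ltr01 R))
    (id : measurableTypeR R -> R)]_x (f x)%:E)%E.
  by apply: eq_measure_integral => A mA _.
rewrite ge0_integral_pushforward//; last 2 first.
- exact/measurable_EFinP.
- by move=> x _; rewrite lee_fin.
rewrite preimage_setT (integral_uniform (@ltr01 R)); last 2 first.
- apply/measurable_EFinP; exact: (measurableT_comp mf mid).
- by move=> x; rewrite lee_fin.
by rewrite subr0 invr1 mul1e.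
Qed.

(** The integral is (1 - (1 - z)^(N+1)) / ((N + 1) z). As a geometric sum it is an average of lower
    powers, which is the source of the recursion defining [moment]. *)
Lemma integral_uniform01_pow N (z : R) : 0 <= z <= 1 ->
  (\int[@uniform01 R]_a ((1 - z * survival a) ^+ N)%:E =
   (N.+1%:R^-1 * \sum_(i < N.+1) (1 - z) ^+ i)%:E)%E.
Proof.
move=> /andP[z0 z1].
rewrite integral_uniform01; last 2 first.
- apply: measurable_funX; apply: measurable_funB => //.
  by apply: measurable_funM => //; exact: measurable_survival.
- move=> a; rewrite exprn_ge0// subr_ge0 mulr_ile1// ?survival_ge0//.
  exact: survival_le1.
transitivity (\int[lebesgue_measure]_(a in `[0%R, 1%R])
    ((1 - z + z * a) ^+ N)%:E)%E.
  apply: eq_integral => a; rewrite inE/= in_itv/= => /andP[a0 a1]; congr (_ ^+ _)%:E.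
  by rewrite /survival max_r ?subr_ge0// min_r ?gerBl//; ring.
(* The antiderivative below divides by z. *)
have [->|zn0] := eqVneq z 0.
  under eq_integral do rewrite mul0r addr0 subr0 expr1n.
  rewrite integral_cst//= lebesgue_measure_itv/= lte_fin ltr01 mul1e subr0.
  under eq_bigr do rewrite expr1n.
  by rewrite sumr_const card_ord oppr0 adde0 mulVf.
pose F a := (z * N.+1%:R)^-1 * (1 - z + z * a) ^+ N.+1.
have dF x : is_derive x (1 : R) F ((1 - z + z * x) ^+ N).
  have -> : F = ((z * N.+1%:R)^-1 \*: ((cst (1 - z) + z \*: id) ^+ N.+1) : R -> R).
    by apply/funext => a; rewrite /F !fctE.
  apply: is_derive_eq.
  rewrite !fctE/= /GRing.scale/= add0r mulr1.
  by field; rewrite zn0/= addrC natr1 pnatr_eq0.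
rewrite (FTC2_is_derive _ _ dF)//.
- congr EFin; rewrite /F mulr1 mulr0 addr0 subrK expr1n mulr1.
  have := subrX1 (1 - z) N.+1; set S := \sum_(i < _) _ => h.
  have -> : S = (1 - (1 - z) ^+ N.+1) / z.
    apply: (canRL (mulfK zn0)); rewrite -opprB h; ring.
  by field; rewrite zn0/= addrC natr1 pnatr_eq0.
- move=> x; apply: (continuous_comp (f := fun y : R => 1 - z + z * y)
    (g := fun y : R => y ^+ N)); last exact: exprn_continuous.
  apply: continuousD; first exact: cvg_cst.
  by apply: continuousM; [exact: cvg_cst|exact: cvg_id].
Qed.

End moments.

Section moment_theory.
Context (R : realType).
Implicit Types (k N : nat) (s t : R).

Lemma momentS k N t :
  moment k.+1 N t = N.+1%:R^-1 * \sum_(i < N.+1) moment k i t.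
Proof. by []. Qed.

Lemma moment_ge0 k N t : 0 <= t <= 1 -> 0 <= moment k N t.
Proof.
move=> /andP[t0 t1]; elim: k N => [|k IH] N /=.
  by rewrite exprn_ge0// subr_ge0.
by rewrite mulr_ge0 ?invr_ge0// sumr_ge0.
Qed.

(** In dimension 1, t times the moment is (1 - (1 - t)^(N+1)) / (N + 1), and averaging preserves
    monotonicity. Dimension 0 is excluded: t (1 - t)^N is not monotone in general. *)
Lemma mul_moment_ndecr k N s t : 0 <= s -> s <= t -> t <= 1 ->
  s * moment k.+1 N s <= t * moment k.+1 N t.
Proof.
move=> s0 st t1; elim: k N => [|k IH] N; last first.
  rewrite !(momentS k.+1).
  rewrite !(mulrCA _ N.+1%:R^-1) ler_wpM2l ?invr_ge0// !mulr_sumr.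
  by apply: ler_sum => i _; exact: IH.
have E (u : R) : u * moment 1 N u = N.+1%:R^-1 * (1 - (1 - u) ^+ N.+1).
  rewrite /= mulrCA; congr (_ * _).
  by have := subrX1 (1 - u) N.+1; set S := \sum_(i < _) _ => h;
    rewrite -opprB h; ring.
rewrite !E ler_wpM2l ?invr_ge0// lerB// lerXn2r ?nnegrE ?subr_ge0//.
  exact: le_trans t1.
exact: lerB.
Qed.

Lemma measurable_moment k N : measurable_fun [set: R] (moment k N).
Proof.
elim: k N => [|k IH] N /=.
  by apply: measurable_funX; exact: measurable_funB.
by apply: measurable_funM => //; apply: measurable_sum => i.
Qed.

Lemma measurable_volX k N t :
  measurable_fun [set: k.-tuple R] (fun x => ((1 - t * vol x) ^+ N)%:E).
Proof.
apply/measurable_EFinP; apply: measurable_funX; apply: measurable_funB => //.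
by apply: measurable_funM => //; exact: measurable_vol.
Qed.

Lemma volX_ge0 k N t (x : k.-tuple R) : 0 <= t <= 1 ->
  (0 <= ((1 - t * vol x) ^+ N)%:E)%E.
Proof.
move=> /andP[t0 t1]; rewrite lee_fin exprn_ge0// subr_ge0.
by rewrite mulr_ile1// ?vol_ge0// vol_le1.
Qed.

(** For fixed remaining coordinates x, integrating out the first one replaces the N-th power by the
    average of the powers 0, ..., N of 1 - t vol x. *)
Lemma integral_moment k N t : 0 <= t <= 1 ->
  (\int[uniform_cube R k]_x ((1 - t * vol x) ^+ N)%:E = (moment k N t)%:E)%E.
Proof.
move=> t01; elim: k N => [|k IH] N.
  rewrite integral_dirac//; last exact: measurable_volX.
  rewrite diracE mem_set// mul1e.
  by rewrite /vol big_ord0 mulr1.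
rewrite integral_power_prob_cons; last 2 first.
- exact: measurable_volX.
- by move=> x; exact: volX_ge0.
pose f (p : R * k.-tuple R) := ((1 - t * (survival p.1 * vol p.2)) ^+ N)%:E.
have f0 p : (0 <= f p)%E.
  case/andP: t01 => t0 t1; rewrite lee_fin exprn_ge0// subr_ge0.
  rewrite mulr_ile1// ?mulr_ge0 ?mulr_ile1 ?vol_ge0 ?vol_le1//.
  - exact: survival_ge0.
  - exact: survival_ge0.
  - exact: survival_le1.
have mf : measurable_fun setT f.
  apply/measurable_EFinP; apply: measurable_funX; apply: measurable_funB => //.
  apply: measurable_funM => //; apply: measurable_funM.
    by apply: measurableT_comp; [exact: measurable_survival|exact: measurable_fst].
  by apply: measurableT_comp; [exact: measurable_vol|exact: measurable_snd].
transitivity (\int[@uniform01 R]_a \int[uniform_cube R k]_x f (a, x))%E.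
  apply: eq_integral => a _; apply: eq_integral => x _.
  by rewrite /f/= vol_cons.
(* The first coordinate has to become the inner variable. *)
rewrite (fubini_tonelli (m1 := @uniform01 R) (m2 := uniform_cube R k) _ mf f0).
transitivity (\int[uniform_cube R k]_x
    (N.+1%:R^-1%:E * \sum_(i < N.+1) ((1 - t * vol x) ^+ i)%:E))%E.
  apply: eq_integral => x _.
  rewrite sumEFin -EFinM -integral_uniform01_pow.
    by apply: eq_integral => a _; rewrite /f/= (mulrC (survival a)) mulrA.
  case/andP: t01 => t0 t1.
  by rewrite mulr_ge0 ?vol_ge0//= mulr_ile1// ?vol_ge0// vol_le1.
rewrite ge0_integralZl//; last 2 first.
- by apply: emeasurable_sum => i; exact: measurable_volX.
- by move=> x _; apply: sume_ge0 => i _; exact: volX_ge0.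
rewrite ge0_integral_sum//; last 2 first.
- by move=> i; exact: measurable_volX.
- by move=> i x _; exact: volX_ge0.
by under eq_bigr do rewrite IH; rewrite sumEFin.
Qed.

(** Here the first coordinate is kept outermost: it scales the volume by [survival a], so the other
    [k] coordinates integrate to a moment at that argument. *)
Lemma integral_moment_survival k N :
  (\int[@uniform01 R]_a (moment k N (survival a))%:E = (moment k.+1 N 1)%:E)%E.
Proof.
rewrite -integral_moment ?ler01 ?lexx// integral_power_prob_cons; last 2 first.
- exact: measurable_volX.
- by move=> x; apply: volX_ge0; rewrite ler01 lexx.
apply: eq_integral => a _; rewrite -integral_moment; last first.
  by rewrite survival_ge0 survival_le1.
by apply: eq_integral => x _; rewrite vol_cons mul1r.
Qed.

End moment_theory.

(** * The probability that two given points are both maxima *)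

Section pair_bound.
Context (R : realType) (k N : nat).
Local Notation mu := (uniform_cube R k.+1).
Local Notation point := (k.+1.-tuple R).
Local Notation g := (moment k.+1 N).
Implicit Types (s t u v : R) (x y : point).

(* The probability that a uniform point dominates neither of two points whose
   first coordinates have survival [s], [t] and whose other ones are [x], [y]. *)
Definition cross s t x y : R :=
  1 - s * vol x - t * vol y + Num.min s t * vol2 x y.

Lemma crossC s t x y : cross s t x y = cross t s y x.
Proof. by rewrite /cross minC vol2C; ring. Qed.

(** By positive correlation, [cross] is at least (1 - s vol x)(1 - t vol y). *)
Lemma cross_ge0 s t x y : 0 <= s <= 1 -> 0 <= t <= 1 -> 0 <= cross s t x y.
Proof.
move=> /andP[s0 s1] /andP[t0 t1].
have le_st : s * t <= Num.min s t by rewrite le_min ler_piMr ?ler_piMl.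
have h : s * t * (vol x * vol y) <= Num.min s t * vol2 x y.
  by rewrite ler_pM ?mulr_ge0 ?vol_ge0 ?vol2_ge.
have sx : s * vol x <= 1 by rewrite mulr_ile1 ?vol_ge0 ?vol_le1.
have ty : t * vol y <= 1 by rewrite mulr_ile1 ?vol_ge0 ?vol_le1.
have : 0 <= (1 - s * vol x) * (1 - t * vol y) by rewrite mulr_ge0 ?subr_ge0.
rewrite /cross; nra.
Qed.

Definition crossX s t x y : \bar R := (cross s t x y ^+ N)%:E.

Lemma measurable_crossX d (D : measurableType d) (sf tf : D -> R)
    (xf yf : D -> point) :
  measurable_fun setT sf -> measurable_fun setT tf ->
  measurable_fun setT xf -> measurable_fun setT yf ->
  measurable_fun setT (fun w => crossX (sf w) (tf w) (xf w) (yf w)).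
Proof.
move=> ms mt mx my.
have mvx := measurableT_comp (@measurable_vol R k.+1) mx.
have mvy := measurableT_comp (@measurable_vol R k.+1) my.
have mv2 : measurable_fun setT (fun w => vol2 (xf w) (yf w)).
  apply: (@measurableT_comp _ _ _ _ _ _ (fun q : point * point => vol2 q.1 q.2)
    _ (fun w => (xf w, yf w))); first exact: measurable_vol2.
  exact: measurable_fun_pair.
apply/measurable_EFinP; apply: measurable_funX; apply: measurable_funD.
  by apply: measurable_funB; [apply: measurable_funB => //|]; exact: measurable_funM.
by apply: measurable_funM => //; exact: measurable_minr.
Qed.

(** A pointwise product bound decouples the two points; each factor then integrates to a value of
    [g]. *)
Lemma integral_prod_le s t u v :
  0 <= s <= 1 -> 0 <= t <= 1 -> 0 <= u <= 1 -> 0 <= v <= 1 ->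
  (forall x y, cross s t x y <= (1 - u * vol x) * (1 - v * vol y)) ->
  (\int[mu]_x \int[mu]_y crossX s t x y <= (g u * g v)%:E)%E.
Proof.
move=> s01 t01 u01 v01 le_st.
have mst : measurable_fun setT (fun p : point * point => crossX s t p.1 p.2).
  by apply: measurable_crossX.
have pos w x : 0 <= w <= 1 -> 0 <= 1 - w * vol x.
  by move=> /andP[w0 w1]; rewrite subr_ge0 mulr_ile1 ?vol_ge0 ?vol_le1.
apply: (@le_trans _ _ (\int[mu]_x (((1 - u * vol x) ^+ N)%:E * (g v)%:E))%E).
  apply: ge0_le_integral => //.
  - by move=> x _; apply: integral_ge0 => y _;
      rewrite lee_fin exprn_ge0// cross_ge0.
  - apply: (measurable_fun_fubini_tonelli_F (m2 := mu) _ mst) => p.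
    by rewrite lee_fin exprn_ge0// cross_ge0.
  - by apply: emeasurable_funM => //; exact: measurable_volX.
  move=> x _; rewrite -integral_moment// -ge0_integralZl//; last 3 first.
  - exact: measurable_volX.
  - by move=> y _; exact: volX_ge0.
  - by rewrite lee_fin exprn_ge0// pos.
  apply: ge0_le_integral => //.
  - by move=> y _; rewrite lee_fin exprn_ge0// cross_ge0.
  - exact: (measurableT_comp mst (measurable_pair1 x)).
  - by apply: emeasurable_funM => //; exact: measurable_volX.
  move=> y _; rewrite -EFinM lee_fin -exprMn lerXn2r ?nnegrE ?cross_ge0//.
  by rewrite mulr_ge0// pos.
rewrite ge0_integralZr//; last 3 first.
- exact: measurable_volX.
- by move=> y _; exact: volX_ge0.
- by rewrite lee_fin moment_ge0.
by rewrite EFinM integral_moment.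
Qed.

Lemma crossX_ge0 s t x y : 0 <= s <= 1 -> 0 <= t <= 1 -> (0 <= crossX s t x y)%E.
Proof. by move=> s01 t01; rewrite lee_fin exprn_ge0// cross_ge0. Qed.

(* [cross] is bounded by a product of a function of [x] and one of [y], through
   [vol2 x y <= vol y] when [t] is at least [2 * s] and through
   [vol2 x y <= (vol x + vol y) / 2] otherwise; the loss in the factors is
   controlled because [t * g t] is nondecreasing. *)
Lemma integral_cross_le s t : 0 <= s -> s <= t -> t <= 1 ->
  (\int[mu]_x \int[mu]_y crossX s t x y <= (g s * g t + 6 * g t ^+ 2)%:E)%E.
Proof.
move=> s0 st t1.
have t0 := le_trans s0 st; have s1 := le_trans st t1.
have [gs0 gt0] : 0 <= g s /\ 0 <= g t by rewrite !moment_ge0 ?s0 ?t0.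
have sgs := mul_moment_ndecr k N s0 st t1.
have st2 u (u0 : 0 <= u) := u0.
have [s2t|t2s] := leP (2 * s) t.
  have ts0 : 0 <= t - s by lra.
  have ts1 : t - s <= 1 by lra.
  apply: le_trans (integral_prod_le (u := s) (v := t - s) _ _ _ _ _) _.
  - by rewrite s0.
  - by rewrite t0.
  - by rewrite s0.
  - by rewrite ts0.
  - move=> x y; rewrite /cross min_l//.
    have := vol2_le y x; rewrite vol2C.
    have := vol_ge0 x; have := vol_ge0 y => y0 x0 h.
    have : 0 <= s * (t - s) * (vol x * vol y) by rewrite !mulr_ge0.
    have : s * vol2 x y <= s * vol y by rewrite ler_wpM2l.
    by nra.
  rewrite lee_fin; have gts0 : 0 <= g (t - s) by rewrite moment_ge0// ts0.
  have [->|tn0] := eqVneq s 0; first by rewrite subr0 lerDl mulr_ge0// sqr_ge0.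
  have sp : 0 < s by rewrite lt_neqAle eq_sym tn0.
  have h1 : (t - s) * g (t - s) <= t * g t by apply: mul_moment_ndecr => //; lra.
  (* By h1, (t - s)(g(t - s) - g t) <= s g t, and s g s <= t g t. Since t - s >= t / 2, the excess
     over g s g t is at most 2 (g t)^2. *)
  have h2 : (t - s) * (g s * (g (t - s) - g t)) <= t * g t ^+ 2.
    apply: (@le_trans _ _ (s * g s * g t)); first by nra.
    by nra.
  rewrite -lerBlDl -mulrBr -(ler_pM2l (x := t - s)); last by lra.
  by apply: (le_trans h2); nra.
have sp : 0 < s by lra.
apply: le_trans (integral_prod_le (u := s / 2) (v := t / 2) _ _ _ _ _) _.
- by rewrite s0.
- by rewrite t0.
- by apply/andP; split; lra.
- by apply/andP; split; lra.
- move=> x y; rewrite /cross min_l//.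
  have := vol2_le y x; have := vol2_le x y; rewrite (vol2C y).
  have := vol_ge0 x; have := vol_ge0 y => y0 x0 h h'.
  have : 0 <= s * t * (vol x * vol y) by rewrite !mulr_ge0.
  have : s * vol2 x y <= s * vol y by rewrite ler_wpM2l.
  have : s * vol2 x y <= s * vol x by rewrite ler_wpM2l.
  have : s * vol y <= t * vol y by rewrite ler_wpM2r.
  by nra.
rewrite lee_fin.
have half u : 0 < u -> u <= 1 -> g (u / 2) <= 2 * g u.
  move=> u0 u1.
  have h : u / 2 * g (u / 2) <= u * g u by apply: mul_moment_ndecr; lra.
  by rewrite -(ler_pM2l u0); lra.
have hs := half s sp s1; have ht := half t (lt_le_trans sp st) t1.
have h4 : g (s / 2) * g (t / 2) <= 4 * (g s * g t).
  apply: le_trans (ler_pM _ _ hs ht) _; rewrite ?moment_ge0//.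
  - by apply/andP; split; lra.
  - by apply/andP; split; lra.
  - by lra.
have h2 : g s <= 2 * g t.
  by rewrite -(ler_pM2l sp); apply: (le_trans sgs); nra.
(* The constant 6 arises here: of 4 g s g t, the surplus 3 g s g t is at most 6 (g t)^2 because g s
   <= 2 g t. *)
apply: (le_trans h4); nra.
Qed.

Lemma integral_crossC s t : 0 <= s <= 1 -> 0 <= t <= 1 ->
  (\int[mu]_x \int[mu]_y crossX s t x y =
   \int[mu]_x \int[mu]_y crossX t s x y)%E.
Proof.
move=> s01 t01.
have mst : measurable_fun setT (fun p : point * point => crossX s t p.1 p.2).
  by apply: measurable_crossX.
rewrite (fubini_tonelli (m1 := mu) (m2 := mu) _ mst); last first.
  by move=> p; exact: crossX_ge0.
by apply: eq_integral => x _; apply: eq_integral => y _; rewrite /crossX crossC.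
Qed.

End pair_bound.

Section pair_bound_total.
Context (R : realType) (k N : nat).
Local Notation mu := (uniform_cube R k.+1).
Local Notation point := (k.+1.-tuple R).
Local Notation g := (moment k.+1 N).
Local Notation unif := (@uniform01 R).

Let surv01 (a : R) : 0 <= survival a <= 1.
Proof. by rewrite survival_ge0 survival_le1. Qed.

Lemma integral_undominated2X :
  (\int[uniform_cube R k.+2]_x \int[uniform_cube R k.+2]_y
     (undominated2 x y ^+ N)%:E =
   \int[unif]_a \int[unif]_b \int[mu]_x \int[mu]_y
     crossX N (survival a) (survival b) x y)%E.
Proof.
have mU := measurable_undominated2X (R := R) (k := k.+2) N.
have U0 (p : k.+2.-tuple R * k.+2.-tuple R) :
    (0 <= (undominated2 p.1 p.2 ^+ N)%:E)%E.
  by rewrite lee_fin exprn_ge0// undominated2_ge0.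
rewrite integral_power_prob_cons; last 2 first.
- exact: (measurable_fun_fubini_tonelli_F (m2 := uniform_cube R k.+2) _ mU U0).
- by move=> x; apply: integral_ge0 => y _; exact: (U0 (x, y)).
apply: eq_integral => a _.
pose f (p : point * R) : \bar R :=
  (\int[mu]_y crossX N (survival a) (survival p.2) p.1 y)%E.
have c0 (q : (point * R) * point) :
    (0 <= crossX N (survival a) (survival q.1.2) q.1.1 q.2)%E.
  exact: crossX_ge0.
have mf : measurable_fun setT f.
  apply: (measurable_fun_fubini_tonelli_F (m2 := mu) _ _ c0).
  apply: measurable_crossX => //; last 1 first.
  - by apply: measurableT_comp; [exact: measurable_fst|exact: measurable_fst].
  - apply: measurableT_comp; first exact: measurable_survival.
    by apply: measurableT_comp; [exact: measurable_snd|exact: measurable_fst].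
have f0 p : (0 <= f p)%E by apply: integral_ge0 => y _; exact: crossX_ge0.
(* Splitting the first coordinate off each point gives the order a, x, b, y; the right-hand side is
   brought to it. *)
rewrite -[RHS](fubini_tonelli (m1 := mu) (m2 := unif) f mf f0).
apply: eq_integral => x _; rewrite integral_power_prob_cons; last 2 first.
- exact: (measurableT_comp mU (measurable_pair1 _)).
- by move=> y; exact: (U0 (_, y)).
apply: eq_integral => b _; apply: eq_integral => y _.
by rewrite /undominated2 !vol_cons vol2_cons.
Qed.

(** The quadratic error of [integral_cross_le], carried by the pairs whose second survival is the
    larger. It is used in both orders; ties are then counted twice, which an upper bound
    tolerates. *)
Let excess (p : R * R) : \bar R :=
  (if survival p.1 <= survival p.2 then g (survival p.2) ^+ 2 else 0)%:E.

Let excess_ge0 p : (0 <= excess p)%E.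
Proof. by rewrite /excess lee_fin; case: ifP => // _; rewrite sqr_ge0. Qed.

Let measurable_excess d (D : measurableType d) (af bf : D -> R) :
  measurable_fun setT af -> measurable_fun setT bf ->
  measurable_fun setT (fun w => excess (af w, bf w)).
Proof.
move=> ma mb; apply/measurable_EFinP => /=.
have msa := measurableT_comp (measurable_survival (R := R)) ma.
have msb := measurableT_comp (measurable_survival (R := R)) mb.
apply: measurable_fun_if => //; first exact: measurable_fun_ler.
apply: measurable_funTS; apply: measurable_funX.
exact: (measurableT_comp (measurable_moment k.+1 N) msb).
Qed.

(** The event [survival a <= t] has probability at most t, so the integral is at most (t g t) g t,
    and t g t <= g 1 by monotonicity. *)
Let integral_excess b :
  (\int[unif]_a excess (a, b) <= (g 1 * g (survival b))%:E)%E.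
Proof.
set t := survival b; have /andP[t0 t1] : 0 <= t <= 1 by exact: surv01.
have gt0 : 0 <= g t by rewrite moment_ge0// t0.
pose A := [set a : R | survival a <= t].
have measA : (unif A <= t%:E)%E.
  (* When t = 1 the set [A] is the whole line, because survivals are clamped, and not a
     half-line. *)
  have [t_lt1|] := ltP t 1; last first.
    move=> t_ge1; have -> : t = 1 by apply/eqP; rewrite eq_le t1.
    apply: probability_le1; rewrite -[X in measurable X]setTI.
    by apply: measurable_fun_le => //; exact: measurable_survival.
  rewrite (_ : A = `[1 - t, +oo[%classic).
    by rewrite uniform01_survival lee_fin /survival subKr max_r// ge_min lexx orbT.
  apply/seteqP; split => a; rewrite /A /= in_itv/= andbT /survival.
    by rewrite ge_min leNgt t_lt1/= ge_max t0/= => ?; lra.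
  by move=> ?; rewrite ge_min ge_max t0/=; apply/orP; right; lra.
apply: (@le_trans _ _ (t%:E * (g t ^+ 2)%:E)%E); last first.
  rewrite -EFinM lee_fin expr2 mulrA ler_wpM2r//.
  by rewrite -[leRHS]mul1r; exact: (mul_moment_ndecr k N t0 t1 (lexx 1)).
rewrite (_ : (fun a => _) =
    (fun a => (g t ^+ 2)%:E * (\1_A a)%:E)%E); last first.
  apply/funext => a; rewrite /excess /= indicE.
  case: ifPn => h; first by rewrite mem_set// mule1.
  by rewrite memNset ?mule0//; exact/negP.
have mA : measurable A.
  rewrite -[X in measurable X]setTI.
  by apply: measurable_fun_le => //; exact: measurable_survival.
rewrite ge0_integralZl//; last 2 first.
- by apply/measurable_EFinP; exact: measurable_indic.
- by rewrite lee_fin sqr_ge0.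
rewrite integral_indic// setIT [leLHS]muleC; apply: lee_wpmul2r => //.
by rewrite lee_fin sqr_ge0.
Qed.

(** The product g(s) g(t) integrates to the square of the mean of [g]; the 12 is 6 for each order of
    the two survivals. *)
Lemma maxima_pair_le :
  (power_prob (uniform_cube R k.+2) N.+2
    [set t | maxima t ord0 && maxima t (lift ord0 ord0)] <=
  (moment k.+2 N 1 ^+ 2 + 12 * (moment k.+1 N 1 * moment k.+2 N 1))%:E)%E.
Proof.
apply: (le_trans (maxima_pair_probability _ _ _)).
rewrite integral_undominated2X.
have gs0 (a : R) : (0 <= (g (survival a))%:E)%E.
  by rewrite lee_fin; exact/moment_ge0/surv01.
have mg : measurable_fun setT (fun a : R => (g (survival a))%:E).
  apply/measurable_EFinP; apply: measurableT_comp; first exact: measurable_moment.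
  exact: measurable_survival.
have mprod (D : measurableType _) (af bf : D -> R) :
    measurable_fun setT af -> measurable_fun setT bf ->
    measurable_fun setT
      (fun w => (g (survival (af w)))%:E * (g (survival (bf w)))%:E)%E.
  move=> ma mb; apply: emeasurable_funM.
    exact: (measurableT_comp mg ma).
  exact: (measurableT_comp mg mb).
pose bnd (p : R * R) : \bar R :=
  ((g (survival p.1))%:E * (g (survival p.2))%:E +
   (6%:E * excess (p.1, p.2) + 6%:E * excess (p.2, p.1)))%E.
have mexc6 (D : measurableType _) (af bf : D -> R) :
    measurable_fun setT af -> measurable_fun setT bf ->
    measurable_fun setT (fun w => 6%:E * excess (af w, bf w))%E.
  by move=> ma mb; apply: emeasurable_funM => //; exact: measurable_excess.
have exc60 p : (0 <= 6%:E * excess p)%E by rewrite mule_ge0// lee_fin.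
have mbnd : measurable_fun setT bnd.
  by apply: emeasurable_funD; [exact: mprod|apply: emeasurable_funD; exact: mexc6].
have bnd0 p : (0 <= bnd p)%E by rewrite !adde_ge0// mule_ge0.
have mf4 : measurable_fun setT (fun w : ((R * R) * point) * point =>
    crossX N (survival w.1.1.1) (survival w.1.1.2) w.1.2 w.2).
  apply: measurable_crossX.
  - apply: measurableT_comp; first exact: measurable_survival.
    apply: measurableT_comp; first exact: measurable_fst.
    by apply: measurableT_comp; exact: measurable_fst.
  - apply: measurableT_comp; first exact: measurable_survival.
    apply: measurableT_comp; first exact: measurable_snd.
    by apply: measurableT_comp; exact: measurable_fst.
  - by apply: measurableT_comp; [exact: measurable_snd|exact: measurable_fst].
  - exact: measurable_snd.
have mf3 := measurable_fun_fubini_tonelli_F (m2 := mu) _ mf4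
  (fun w => crossX_ge0 _ _ _ (surv01 _) (surv01 _)).
have F3 w : (0 <= fubini_F mu (fun w : ((R * R) * point) * point =>
    crossX N (survival w.1.1.1) (survival w.1.1.2) w.1.2 w.2) w)%E.
  by apply: integral_ge0 => y _; exact: crossX_ge0.
have mf2 := measurable_fun_fubini_tonelli_F (m2 := mu) _ mf3 F3.
set J := fubini_F mu _ in mf2.
have J0 p : (0 <= J p)%E by apply: integral_ge0 => x _; exact: F3.
have Jbnd p : (J p <= bnd p)%E.
  case: p => a b; rewrite /J /fubini_F /bnd /=.
  have [ab|ba] := leP (survival a) (survival b).
    apply: (le_trans (integral_cross_le k N _ ab _)) => //.
    - exact: survival_ge0.
    - exact: survival_le1.
    rewrite EFinD EFinM leeD2l// /excess /= ab EFinM leeDl// mule_ge0 ?lee_fin//.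
    by case: ifP => // _; rewrite sqr_ge0.
  rewrite integral_crossC//.
  apply: (le_trans (integral_cross_le k N _ (ltW ba) _)) => //.
  - exact: survival_ge0.
  - exact: survival_le1.
  rewrite EFinD EFinM muleC leeD2l// /excess /= (ltW ba) EFinM leeDr//.
  by rewrite mule_ge0 ?lee_fin//; case: ifP => // _; rewrite sqr_ge0.
apply: (@le_trans _ _ (\int[unif]_a \int[unif]_b bnd (a, b))%E).
  apply: ge0_le_integral => //.
  - by move=> a _; apply: integral_ge0 => b _; exact: (J0 (a, b)).
  - exact: (measurable_fun_fubini_tonelli_F (m2 := unif) _ mf2 J0).
  - exact: (measurable_fun_fubini_tonelli_F (m2 := unif) _ mbnd bnd0).
  move=> a _; apply: ge0_le_integral.
  - exact: measurableT.
  - by move=> b _; exact: (J0 (a, b)).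
  - exact: (measurableT_comp mf2 (measurable_pair1 a)).
  - exact: (measurableT_comp mbnd (measurable_pair1 a)).
  by move=> b _; exact: (Jbnd (a, b)).
set G := moment k.+2 N 1.
have excE : (\int[unif]_b \int[unif]_a (6%:E * excess (a, b)) <=
    (6 * (g 1 * G))%:E)%E.
  apply: (@le_trans _ _ (\int[unif]_b ((6 * g 1)%:E * (g (survival b))%:E))%E).
    apply: ge0_le_integral => //.
    - by move=> b _; apply: integral_ge0 => a _; exact: exc60.
    - apply: (measurable_fun_fubini_tonelli_F (m2 := unif)
        (fun p : R * R => 6%:E * excess (p.2, p.1))%E) => //.
      exact: mexc6.
    - exact: emeasurable_funM.
    move=> b _; rewrite ge0_integralZl//; last 1 first.
    - exact: measurable_excess.
    by rewrite -EFinM -mulrA EFinM lee_wpmul2l ?lee_fin.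
  rewrite ge0_integralZl//; last first.
    by rewrite lee_fin mulr_ge0// moment_ge0// ler01 lexx.
  by rewrite integral_moment_survival -EFinM mulrA.
have -> : (G ^+ 2 + 12 * (g 1 * G))%:E =
    ((G * G)%:E + ((6 * (g 1 * G))%:E + (6 * (g 1 * G))%:E))%E.
  by rewrite -!EFinD; congr EFin; ring.
have m6 : measurable_fun setT (fun p : R * R => 6%:E * excess (p.1, p.2))%E.
  exact: mexc6.
have m6' : measurable_fun setT (fun p : R * R => 6%:E * excess (p.2, p.1))%E.
  exact: mexc6.
pose E1 a : \bar R := (\int[unif]_b (6%:E * excess (a, b)))%E.
pose E2 a : \bar R := (\int[unif]_b (6%:E * excess (b, a)))%E.
have mE1 : measurable_fun setT E1.
  exact: (measurable_fun_fubini_tonelli_F (m2 := unif) _ m6 (fun p => exc60 _)).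
have mE2 : measurable_fun setT E2.
  exact: (measurable_fun_fubini_tonelli_F (m2 := unif) _ m6' (fun p => exc60 _)).
have E10 a : (0 <= E1 a)%E by apply: integral_ge0 => b _; exact: exc60.
have E20 a : (0 <= E2 a)%E by apply: integral_ge0 => b _; exact: exc60.
have inner a : (\int[unif]_b bnd (a, b) =
    (g (survival a))%:E * G%:E + (E1 a + E2 a))%E.
  rewrite ge0_integralD; [|exact: measurableT|by move=> b _; rewrite mule_ge0
    |exact: (mprod _ _ (cst a) id)|by move=> b _; rewrite adde_ge0
    |by apply: emeasurable_funD;
      [exact: (mexc6 _ _ (cst a) id)|exact: (mexc6 _ _ id (cst a))]].
  congr (_ + _)%E.
    transitivity (\int[unif]_b ((g (survival a))%:E * (g (survival b))%:E))%E => //.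
    by rewrite ge0_integralZl// integral_moment_survival.
  by rewrite ge0_integralD; [|exact: measurableT|by move=> b _; exact: exc60
    |exact: (mexc6 _ _ (cst a) id)|by move=> b _; exact: exc60
    |exact: (mexc6 _ _ id (cst a))].
rewrite (eq_integral _ _ (fun a _ => inner a)).
have mgG : measurable_fun setT (fun a => (g (survival a))%:E * G%:E)%E.
  exact: emeasurable_funM.
have G0 : 0 <= G by rewrite moment_ge0// ler01 lexx.
rewrite ge0_integralD; [|exact: measurableT
  |by move=> a _; rewrite mule_ge0// lee_fin|exact: mgG
  |by move=> a _; rewrite adde_ge0|exact: emeasurable_funD].
rewrite ge0_integralD; [|exact: measurableT|by move=> a _; exact: E10|exact: mE1
  |by move=> a _; exact: E20|exact: mE2].
apply: leeD.
  by rewrite ge0_integralZr ?lee_fin// integral_moment_survival.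
apply: leeD; last exact: excE.
(* [E1] and [E2] differ only by the roles of the two variables. *)
rewrite (fubini_tonelli (m1 := unif) (m2 := unif) _ m6 (fun p => exc60 _)).
exact: excE.
Qed.

End pair_bound_total.

(** * Moments of the pattern of maxima and their transfer to the array *)

Section maxima_law_moments.
Context (R : realType) (k : nat).

Lemma maxima_probE m (Q : pred {ffun 'I_m -> bool}) :
  \sum_z maxima_prob R k z * (Q z)%:R =
  fine (power_prob (uniform_cube R k) m [set t | Q (maxima t)]).
Proof.
by rewrite (probability_finite_valued _ (@measurable_maxima R k m)).
Qed.

Lemma maxima_prob_maximum m (i : 'I_m.+1) :
  \sum_z maxima_prob R k z * (z i)%:R = moment k m (1 : R).
Proof.
rewrite (maxima_prob_reindex k (tperm i ord0)).
under eq_bigr do rewrite ffunE tpermL.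
rewrite (maxima_probE (fun z => z ord0)) maximum_probability.
under eq_integral do rewrite -[vol _]mul1r.
by rewrite integral_moment// ler01 lexx.
Qed.

(** The index of [moment] counts the competitors: [m] among [m.+1] points. *)
Lemma p_maxE m : p_max R k m.+1 = moment k m (1 : R).
Proof.
rewrite -(maxima_prob_maximum (@ord0 m)) maxima_probE; congr (fine (power_prob _ _ _)).
apply/seteqP; split => t /=; rewrite ffunE => h.
  apply/asboolP => j j0; rewrite !(tnth_nth [tuple of nseq k 0]).
  exact: (h j (ltn_ord j) j0).
move=> j jm j0; have /asboolP/(_ (Ordinal jm)) := h.
by rewrite !(tnth_nth [tuple of nseq k 0]) => /(_ j0).
Qed.

Lemma maxima_prob_pair m (i j : 'I_m.+2) : i != j ->
  \sum_z maxima_prob R k z * ((z i)%:R * (z j)%:R) =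
  fine (power_prob (uniform_cube R k) m.+2
    [set t | maxima t ord0 && maxima t (lift ord0 ord0)]).
Proof.
move=> ij.
(* The first transposition sends i to 0 and j to some index other than 0; the second moves that
   index to 1 and fixes 0. *)
pose s := (tperm i ord0 * tperm (tperm i ord0 j) (lift ord0 ord0))%g.
have si : s i = ord0.
  rewrite permM tpermL tpermD//.
  by rewrite -[X in _ != X](tpermL i ord0) (inj_eq perm_inj) eq_sym.
have sj : s j = lift ord0 ord0 by rewrite permM tpermL.
rewrite (maxima_prob_reindex k s).
rewrite -(maxima_probE (fun z => z ord0 && z (lift ord0 ord0))).
by apply: eq_bigr => z _; rewrite !ffunE si sj -natrM mulnb.
Qed.

Lemma maxima_prob_pair_le m (i j : 'I_m.+2) : (1 < k)%N -> i != j ->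
  \sum_z maxima_prob R k z * ((z i)%:R * (z j)%:R) <=
  moment k m 1 ^+ 2 + 12 * (moment k.-1 m 1 * moment k m 1).
Proof.
move=> k1 ij; rewrite maxima_prob_pair//.
case: k k1 => [|[|k']]// _.
rewrite -lee_fin fineK; first exact: maxima_pair_le.
apply: fin_num_measure.
rewrite (_ : [set _ | _] = [set t | maxima t ord0] `&`
    [set t | maxima t (lift ord0 ord0)]).
  by apply: measurableI; exact: measurable_maximum.
by apply/seteqP; split => t /=; [move=> /andP[]|move=> [? ?]; apply/andP].
Qed.

(** The order is total in dimension 1, so of two points one dominates the other. *)
Lemma maxima_prob_pair_dim1 m (i j : 'I_m.+2) : k = 1%N -> i != j ->
  \sum_z maxima_prob R k z * ((z i)%:R * (z j)%:R) = 0.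
Proof.
move=> k1 ij; rewrite maxima_prob_pair// (_ : [set t | _] = set0).
  by rewrite measure0.
apply/seteqP; split => t //= /andP[]; rewrite !ffunE => /asboolP h0 /asboolP h1.
have dim1 (x y : k.-tuple R) : dominated x y \/ dominated y x.
  rewrite /dominated; move: x y; rewrite k1 => x y.
  have [xy|/ltW yx] := leP (tnth x ord0) (tnth y ord0); [left|right] => l;
    by rewrite (ord1 l).
have [] := dim1 (tnth t ord0) (tnth t (lift ord0 ord0)); first exact: h0.
exact: h1.
Qed.

End maxima_law_moments.

Section maxima_of_array.
Context d (T : measurableType d) (R : realType) (P : probability T R).
Context (k : nat) (m : nat -> nat) (X : nat -> nat -> {RV P >-> k.-tuple R}).
Hypothesis iidX : iid_uniform_array m X.
Context (n : nat) (n0 : (0 < n)%N).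

Definition row_maxima (w : T) : {ffun 'I_(m n) -> bool} :=
  maxima (row_tuple (m n) (X n) w).

Lemma Z_row_maxima (i : 'I_(m n)) w : Z m X n i w = (row_maxima w i)%:R.
Proof.
rewrite /Z indicE; congr ((nat_of_bool _)%:R); rewrite ffunE.
apply/idP/asboolP; rewrite inE /= => h.
  by move=> j ji; rewrite !tnth_mktuple; apply: h.
move=> j jm ji; by have := h (Ordinal jm); rewrite !tnth_mktuple; apply.
Qed.

Lemma measurable_row_maxima z : measurable [set w | row_maxima w = z].
Proof.
rewrite -[X in measurable X]setTI.
have h := @measurable_maxima R k (m n) z.
exact: (measurable_row_tuple (m := m n) (X n) measurableT h).
Qed.

Lemma row_maxima_prob z :
  fine (P [set w | row_maxima w = z]) = maxima_prob R k z.
Proof.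
have [Xlaw Xind] := iidX n0.
by rewrite /maxima_prob -(row_tuple_law Xlaw Xind)//; exact: measurable_maxima.
Qed.

Lemma row_maxima_event (Q : pred {ffun 'I_(m n) -> bool}) :
  P [set w | Q (row_maxima w)] = (\sum_z maxima_prob R k z * (Q z)%:R)%:E.
Proof.
rewrite (probability_finite_valued _ measurable_row_maxima).
by under eq_bigr do rewrite row_maxima_prob.
Qed.

Lemma row_maxima_integral (F : {ffun 'I_(m n) -> bool} -> R) :
  (forall z, 0 <= F z) ->
  (\int[P]_w (F (row_maxima w))%:E = (\sum_z maxima_prob R k z * F z)%:E)%E.
Proof.
move=> F0; rewrite (integral_finite_valued P measurable_row_maxima F0).
by under eq_bigr do rewrite row_maxima_prob.
Qed.

End maxima_of_array.

(** * The Stein equation of the normal law *)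

Section lipschitz.
Context (R : realType).

Lemma is_derive_continuous (f f' : R -> R) :
  (forall x, is_derive x (1 : R) f (f' x)) -> continuous f.
Proof.
move=> df x; apply/differentiable_continuous/derivable1_diffP.
by case: (df x).
Qed.

Lemma is_derive_mean_value (f f' : R -> R) (x y : R) :
  (forall x, is_derive x (1 : R) f (f' x)) -> x <= y ->
  exists2 c, x <= c <= y & f y - f x = f' c * (y - x).
Proof.
move=> df xy.
have [c cxy ->] : exists2 c, c \in `[x, y] & f y - f x = f' c * (y - x).
  apply: MVT_segment => //.
  exact/continuous_subspaceT/(is_derive_continuous df).
by exists c => //; move: cxy; rewrite in_itv.
Qed.

Lemma is_derive_lipschitz (f f' : R -> R) (K x y : R) :
  (forall x, is_derive x (1 : R) f (f' x)) -> (forall x, `|f' x| <= K) ->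
  `|f x - f y| <= K * `|x - y|.
Proof.
move=> df f'K; wlog xy : x y / x <= y => [hwlog|].
  have [xy|/ltW yx] := leP x y; first exact: hwlog.
  by rewrite distrC (distrC x); exact: hwlog.
have [c _ fE] := is_derive_mean_value df xy.
by rewrite distrC fE normrM (distrC x) ler_wpM2r.
Qed.

Lemma lipschitz_continuous (f : R -> R) (K : R) :
  (forall x y, `|f x - f y| <= K * `|x - y|) -> continuous f.
Proof.
move=> fK x; apply/cvgrPdist_le => e e0.
have K0 : 0 < `|K| + 1 by rewrite ltr_pwDr.
near=> y; apply: (le_trans (fK _ _)).
apply: (@le_trans _ _ ((`|K| + 1) * `|x - y|)).
  by rewrite ler_wpM2r// (le_trans (ler_norm K))// lerDl.
rewrite -ler_pdivlMl// mulrC.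
near: y; apply: (cvgr_dist_le (id : R -> R) x); [exact: cvg_id|exact: divr_gt0].
Unshelve. all: by end_near. Qed.

Lemma compact_support_bounded (f : R -> R) (A : R) : continuous f ->
  (forall x, A <= `|x| -> f x = 0) ->
  exists2 K : R, 0 <= K & forall x, `|f x| <= K.
Proof.
move=> cf f0.
have [A0|A0] := leP A 0.
  by exists 0 => // x; rewrite f0 ?normr0// (le_trans A0).
have cnf : {within `[- A, A], continuous (fun x => `|f x|)}.
  by apply: continuous_subspaceT => x; apply: cvg_norm; exact: cf.
have AA : - A <= A by lra.
have [c _ cmax] := EVT_max AA cnf.
exists `|f c| => // x; have [xA|Ax] := leP `|x| A.
  by apply: cmax; rewrite in_itv/= -ler_norml.
by rewrite f0 ?normr0// ltW.
Qed.

End lipschitz.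

Section stein_equation.
Context (R : realType) (s : R).
Hypothesis s0 : 0 < s.
Local Notation mu := (@lebesgue_measure R).
Local Notation phi := (normal_pdf 0 s).

Lemma normal_pdf_gt0 x : 0 < phi x.
Proof.
rewrite normal_pdfE ?gt_eqF// mulr_gt0 ?normal_peak_gt0 ?gt_eqF//.
exact: expR_gt0.
Qed.

Lemma is_derive_normal_pdf x : is_derive x (1 : R) phi (- (x / s ^+ 2) * phi x).
Proof.
rewrite !normal_pdfE ?gt_eqF//.
rewrite (_ : (fun x => _) = (normal_peak s \*:
  (expR \o ((- (s ^+ 2 *+ 2)^-1) \*: ((id : R -> R) ^+ 2)))) ); last first.
  apply/funext => y; rewrite !fctE /normal_fun subr0.
  rewrite /GRing.scale/=; congr (_ * expR _).
  by rewrite /GRing.scale/= !mulNr mulrC.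
apply: is_derive_eq.
rewrite !fctE/= /GRing.scale/= /normal_fun subr0 expr1 mulr1.
set e := expR _; set e' := expR _; have -> : e = e'.
  by congr expR; rewrite !mulNr mulrC.
by field; rewrite gt_eqF.
Qed.


(** The solution is f = F / (s^2 phi), F being the primitive of h phi from minus infinity. It
    vanishes outside [-A, A], so f and f' are bounded by continuity on a compact interval, and f' is
    Lipschitz because h and x f are. *)
Lemma stein_solution (h : R -> R) (A L : R) :
  (forall x y, `|h x - h y| <= L * `|x - y|) ->
  (forall x, A <= `|x| -> h x = 0) ->
  (\int[mu]_x (h x * phi x) = 0)%R ->
  exists f f' : R -> R, exists K : R,
    [/\ forall x, is_derive x (1 : R) f (f' x),
        forall x, s ^+ 2 * f' x - x * f x = h x,
        forall x, `|f' x| <= K &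
        forall x y, `|f' x - f' y| <= K * `|x - y|].
Proof.
move=> hL h0 inth0.
have s2n0 : s ^+ 2 != 0 by rewrite expf_neq0// gt_eqF.
have ch := lipschitz_continuous hL.
have [Hb Hb0 hb] := compact_support_bounded ch h0.
have cphi : continuous phi by apply: continuous_normal_pdf; rewrite gt_eqF.
pose hphi x := h x * phi x.
have chphi : continuous hphi by move=> x; apply: continuousM; [exact: ch|exact: cphi].
have ihphi : mu.-integrable setT (EFin \o hphi).
  apply: (@le_integrable _ _ _ mu setT measurableT _ (fun x => (Hb * phi x)%:E)) => //.
  - by apply/measurable_EFinP; exact: continuous_measurable_fun.
  - move=> x _; rewrite lee_fin !normrM ler_pM//.
    by rewrite (le_trans (hb x))// ler_norm.
  - rewrite (_ : (fun x => _) = (fun x => Hb%:E * (phi x)%:E)%E).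
      by apply: integrableZl => //; exact: integrable_normal_pdf.
    by apply/funext => x; rewrite EFinM.
pose F x := (\int[mu]_(t in `]-oo, x]) hphi t)%R.
have dF x : is_derive x (1 : R) F (hphi x).
  have iu : mu.-integrable `]-oo, (x + 1)] (EFin \o hphi).
    exact: integrableS ihphi.
  have xx1 : x < x + 1 by rewrite ltrDl.
  have [dFx Fx] := continuous_FTC1 xx1 iu (ltNyr x) (chphi x).
  by rewrite derive1E in Fx; exact: (DeriveDef dFx Fx).
have FN x : x <= - A -> F x = 0.
  move=> xA; transitivity (\int[mu]_(t in `]-oo, x]) (0 : R))%R.
    apply: eq_Rintegral => t; rewrite inE/= in_itv/= => tx; rewrite /hphi h0 ?mul0r//.
    by rewrite ler_normr; apply/orP; right; lra.
  by rewrite Rintegral_cst// mul0r.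
(* To the right of A the primitive equals the full integral, which is 0: this is where the zero
   Gaussian mean enters. *)
have FP x : A <= x -> F x = 0.
  move=> Ax; rewrite -inth0 /F Rintegral_mkcond; apply: eq_Rintegral => t _.
  rewrite patchE; case: ifPn => //; rewrite notin_setE/= in_itv/= => /negP.
  rewrite -ltNge => xt; rewrite /hphi h0 ?mul0r//.
  by rewrite (le_trans Ax)// (le_trans (ltW xt))// ler_norm.
pose f x := F x / (s ^+ 2 * phi x).
pose f' x := (h x + x * f x) / s ^+ 2.
have phin0 x : phi x != 0 by rewrite gt_eqF// normal_pdf_gt0.
have df x : is_derive x (1 : R) f (f' x).
  rewrite (_ : f = F * (fun x => (s ^+ 2 * phi x)^-1)); last first.
    by apply/funext => y; rewrite !fctE.
  have dphi := is_derive_normal_pdf x.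
  have dsphi : is_derive x (1 : R) (fun y => s ^+ 2 * phi y)
      (s ^+ 2 * (- (x / s ^+ 2) * phi x)).
    exact: is_deriveZ.
  have dinv := @is_deriveV _ (fun y => s ^+ 2 * phi y) x _ _
    (mulf_neq0 s2n0 (phin0 x)) dsphi.
  apply: is_derive_eq.
  rewrite /f' /f /hphi /GRing.scale/=.
  by field; rewrite phin0 gt_eqF.
have fx0 x : A <= `|x| -> f x = 0.
  rewrite /f ler_normr => /orP[/FP->|xA]; first by rewrite mul0r.
  by rewrite FN ?mul0r//; lra.
have cf := is_derive_continuous df.
have [Fb Fb0 fb] := compact_support_bounded cf fx0.
have f'0 x : A <= `|x| -> f' x = 0.
  by move=> Ax; rewrite /f' h0// fx0// mulr0 addr0 mul0r.
have cf' : continuous f'.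
  move=> x; apply: cvgM; last exact: cvg_cst.
  apply: cvgD; first exact: ch.
  by apply: cvgM; [exact: cvg_id|exact: cf].
have [K1 K10 f'b] := compact_support_bounded cf' f'0.
have A0 : A <= `|A| by exact: ler_norm.
(* The derivative f + x f' is bounded: f' vanishes where |x| >= A. *)
have xfL x y : `|x * f x - y * f y| <= (Fb + `|A| * K1) * `|x - y|.
  apply: (@is_derive_lipschitz _ (fun x => x * f x) (fun x => f x + x * f' x)) => {x y} x.
    rewrite (_ : (fun x => _) = (id : R -> R) * f); last first.
      by apply/funext => y; rewrite !fctE.
    by apply: is_derive_eq; rewrite /GRing.scale/= mulr1 addrC.
  have [/f'0 ->|xA] := leP A `|x|.
    by rewrite mulr0 addr0 (le_trans (fb x))// lerDl mulr_ge0.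
  rewrite (le_trans (ler_normD _ _))// lerD// normrM ler_pM//.
  by rewrite (le_trans (ltW xA)).
pose K2 := (`|L| + (Fb + `|A| * K1)) / s ^+ 2.
exists f, f', (Num.max K1 K2); split => //.
- by move=> x; rewrite /f' mulrC divfK// addrK.
- by move=> x; rewrite le_max f'b.
- move=> x y; apply: (@le_trans _ _ (K2 * `|x - y|)); last first.
    by rewrite ler_wpM2r// le_max lexx orbT.
  rewrite /f' -mulrBl normrM /K2 mulrAC normfV (ger0_norm (sqr_ge0 s)).
  rewrite ler_wpM2r ?invr_ge0 ?sqr_ge0// mulrDl.
  rewrite opprD addrACA (le_trans (ler_normD _ _))// lerD//.
  by rewrite (le_trans (hL x y))// ler_wpM2r// ler_norm.
Qed.

End stein_equation.

(** * Convergence to the normal law from test functions *)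

Section trapezoid.
Context (R : realType).
Implicit Types a b c x y K : R.

(** Equal to 1 on [a, b], with sides of slope [K]. For b < a it remains Lipschitz with values in
    [0, 1], which allows any position of the end points. *)
Definition trapezoid a b K x : R :=
  Num.max 0 (Num.min 1 (Num.min (1 + K * (x - a)) (1 + K * (b - x)))).

Lemma trapezoid_ge0 a b K x : 0 <= trapezoid a b K x.
Proof. by rewrite le_max lexx. Qed.

Lemma trapezoid_le1 a b K x : trapezoid a b K x <= 1.
Proof. by rewrite ge_max ler01 ge_min lexx. Qed.

Lemma trapezoid_eq1 a b K x : 0 <= K -> a <= x <= b -> trapezoid a b K x = 1.
Proof.
move=> K0 /andP[ax xb].
have h1 : 0 <= K * (x - a) by rewrite mulr_ge0// subr_ge0.
have h2 : 0 <= K * (b - x) by rewrite mulr_ge0// subr_ge0.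
by rewrite /trapezoid [Num.min 1 _]min_l ?max_r// le_min !lerDl h1.
Qed.

Lemma trapezoid_eq0l a b K x : K * (a - x) >= 1 -> trapezoid a b K x = 0.
Proof.
move=> h; rewrite /trapezoid max_l// !ge_min; apply/orP; right; apply/orP; left.
lra.
Qed.

Lemma trapezoid_eq0r a b K x : K * (x - b) >= 1 -> trapezoid a b K x = 0.
Proof.
move=> h; rewrite /trapezoid max_l// !ge_min; apply/orP; right; apply/orP; right.
lra.
Qed.

Lemma dist_min_le a b c d (e : R) : `|a - c| <= e -> `|b - d| <= e ->
  `|Num.min a b - Num.min c d| <= e.
Proof.
rewrite !ler_norml => /andP[h1 h2] /andP[h3 h4]; apply/andP.
by case: (leP a b) => ab; case: (leP c d) => cd; split; lra.
Qed.

Lemma dist_max_le a b c d (e : R) : `|a - c| <= e -> `|b - d| <= e ->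
  `|Num.max a b - Num.max c d| <= e.
Proof.
rewrite !ler_norml => /andP[h1 h2] /andP[h3 h4]; apply/andP.
by case: (leP a b) => ab; case: (leP c d) => cd; split; lra.
Qed.

Lemma trapezoid_lipschitz a b K x y : 0 <= K ->
  `|trapezoid a b K x - trapezoid a b K y| <= K * `|x - y|.
Proof.
move=> K0; have e0 : 0 <= K * `|x - y| by rewrite mulr_ge0.
apply: dist_max_le; first by rewrite subrr normr0.
apply: dist_min_le; first by rewrite subrr normr0.
have h c d : c - d = x - y \/ c - d = y - x ->
    `|1 + K * c - (1 + K * d)| <= K * `|x - y|.
  move=> cd; rewrite opprD addrACA subrr add0r -mulrBr normrM (ger0_norm K0).
  by case: cd => ->//; rewrite distrC.
by apply: dist_min_le; apply: h; [left|right]; ring.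
Qed.

Lemma trapezoid_support a b K x : 0 < K ->
  `|a| + `|b| + K^-1 <= `|x| -> trapezoid a b K x = 0.
Proof.
move=> K0; have := ler_norm b; have := ler_norm (- a).
rewrite normrN => na nb; have a0 := normr_ge0 a; have b0 := normr_ge0 b.
have [x0|x0] := leP 0 x.
  rewrite (ger0_norm x0) => h; apply: trapezoid_eq0r.
  by rewrite -(mulfV (lt0r_neq0 K0)) ler_pM2l//; lra.
rewrite (ltr0_norm x0) => h; apply: trapezoid_eq0l.
by rewrite -(mulfV (lt0r_neq0 K0)) ler_pM2l//; lra.
Qed.

End trapezoid.

Section gaussian_integrals.
Context (R : realType) (s : R).
Hypothesis s0 : 0 < s.
Local Notation mu := (@lebesgue_measure R).
Local Notation phi := (normal_pdf 0 s).

(** The mean of [h] under the centered normal law of standard deviation [s]. *)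
Definition gauss_int (h : R -> R) : R := (\int[mu]_x (h x * phi x))%R.

Definition normal_mass (A : set R) : R := fine (normal_prob 0 s A).

Lemma integrable_mul_normal_pdf (h : R -> R) : continuous h ->
  (forall x, 0 <= h x <= 1) ->
  mu.-integrable setT (EFin \o (fun x => h x * phi x)).
Proof.
move=> ch h01.
apply: (@le_integrable _ _ _ mu setT measurableT _ (fun x => (phi x)%:E)) => //.
- apply/measurable_EFinP; apply: continuous_measurable_fun.
  move=> x; apply: continuousM; first exact: ch.
  by apply: continuous_normal_pdf; rewrite gt_eqF.
- move=> x _; have /andP[h0 h1] := h01 x; rewrite lee_fin normrM ler_piMl//.
  by rewrite ger0_norm.
- exact: integrable_normal_pdf.
Qed.

Lemma normal_massE (A : set (measurableTypeR R)) : measurable A ->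
  normal_mass A = (\int[mu]_x (\1_A x * phi x))%R.
Proof.
move=> mA; rewrite /normal_mass /normal_prob -/(Rintegral mu A phi).
rewrite Rintegral_mkcond; apply: eq_Rintegral => x _.
by rewrite patchE [\1_A x]indicE; case: ifP => _; rewrite ?mul1r ?mul0r.
Qed.

Lemma integrable_indic_normal_pdf (A : set (measurableTypeR R)) : measurable A ->
  mu.-integrable setT (EFin \o (fun x => \1_A x * phi x)).
Proof.
move=> mA.
apply: (@le_integrable _ _ _ mu setT measurableT _ (fun x => (phi x)%:E)) => //.
- apply/measurable_EFinP; apply: measurable_funM; first exact: measurable_indic.
  exact: measurable_normal_pdf.
- by move=> x _; rewrite lee_fin normrM ler_piMl// [\1_A x]indicE; case: (_ \in _);
    rewrite ?normr1 ?normr0.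
- exact: integrable_normal_pdf.
Qed.

Lemma gauss_int_ge (h : R -> R) (A : set (measurableTypeR R)) : continuous h ->
  (forall x, 0 <= h x <= 1) -> measurable A -> (forall x, A x -> h x = 1) ->
  normal_mass A <= gauss_int h.
Proof.
move=> ch h01 mA hA; rewrite normal_massE//; apply: le_Rintegral => //.
- exact: integrable_indic_normal_pdf.
- exact: integrable_mul_normal_pdf.
move=> x _; rewrite ler_wpM2r ?normal_pdf_ge0//.
rewrite [\1_A x]indicE; case: (boolP (x \in A)) => [|_].
  by rewrite inE => /hA ->.
by case/andP: (h01 x).
Qed.

Lemma gauss_int_le (h : R -> R) (A : set (measurableTypeR R)) : continuous h ->
  (forall x, 0 <= h x <= 1) -> measurable A -> (forall x, ~ A x -> h x = 0) ->
  gauss_int h <= normal_mass A.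
Proof.
move=> ch h01 mA hA; rewrite normal_massE//; apply: le_Rintegral => //.
- exact: integrable_mul_normal_pdf.
- exact: integrable_indic_normal_pdf.
move=> x _; rewrite ler_wpM2r ?normal_pdf_ge0//.
rewrite [\1_A x]indicE; case: (boolP (x \in A)) => [_|].
  by case/andP: (h01 x).
by rewrite notin_setE => /hA ->.
Qed.

Lemma normal_mass_le (A B : set (measurableTypeR R)) : measurable A -> measurable B ->
  A `<=` B -> normal_mass A <= normal_mass B.
Proof.
move=> mA mB AB; rewrite /normal_mass fine_le ?fin_num_measure//.
by apply: le_measure; rewrite ?inE.
Qed.

Lemma normal_mass_le1 (A : set (measurableTypeR R)) : measurable A ->
  normal_mass A <= 1.
Proof.
move=> mA; rewrite -lee_fin fineK ?fin_num_measure//.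
exact: (probability_le1 (normal_prob 0 s)).
Qed.

Lemma normal_mass_disjoint (A B : set (measurableTypeR R)) :
  measurable A -> measurable B -> A `&` B = set0 ->
  normal_mass A + normal_mass B <= 1.
Proof.
move=> mA mB AB0; rewrite -fineD ?fin_num_measure//.
rewrite -measureU//; apply: normal_mass_le1; exact: measurableU.
Qed.

Lemma normal_mass_cover (D A B : set (measurableTypeR R)) :
  measurable D -> measurable A -> measurable B -> D `<=` A `|` B ->
  normal_mass D <= normal_mass A + normal_mass B.
Proof.
move=> mD mA mB DAB.
rewrite -lee_fin EFinD !fineK ?(fin_num_measure (normal_prob 0 s))//.
apply: (@le_trans _ _ (normal_prob 0 s (A `|` B))); last exact: measureU2.
by apply: le_measure; rewrite ?inE//; exact: measurableU.
Qed.

(** Continuity from below along [-n, n]. The bound holds for every larger [B], so that the threshold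
    may later be raised to meet other constraints. *)
Lemma normal_mass_itv (e : R) : 0 < e ->
  exists2 A : R, 0 < A & forall B, A <= B -> 1 - e <= normal_mass `[- B, B].
Proof.
move=> e0.
pose F (n : nat) : set (measurableTypeR R) := `[- n%:R, n%:R]%classic.
have cF : normal_prob 0 s (F n) @[n --> \oo] --> normal_prob 0 s (\bigcup_n F n).
  apply: nondecreasing_cvg_mu => //.
  - by move=> n; exact: measurable_itv.
  - by apply: bigcupT_measurable => n; exact: measurable_itv.
  - move=> m n mn; apply/subsetPset => x; rewrite /F/= !in_itv/= => /andP[h1 h2].
    have mn' : m%:R <= n%:R :> R by rewrite ler_nat.
    by apply/andP; split; lra.
have FT : \bigcup_n F n = setT.
  apply/seteqP; split => // x _.
  exists (Num.truncn `|x|).+1 => //; rewrite /F/= in_itv/= -ler_norml.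
  exact/ltW/truncnS_gt.
have {}cF : normal_mass (F n) @[n --> \oo] --> (1 : R).
  apply/fine_cvg; rewrite FT probability_setT in cF; exact: cF.
have /cvgrPdist_le/(_ e e0)[N _ hN] := cF.
exists (N%:R + 1) => [|B NB]; first by rewrite ltr_wpDl.
have := hN N (leqnn N); rewrite /= ler_norml => /andP[_ h].
apply: (@le_trans _ _ (normal_mass (F N))); first by lra.
apply: normal_mass_le; rewrite /F; try exact: measurable_itv.
by move=> x /=; rewrite !in_itv/= => /andP[h1 h2]; apply/andP; split; lra.
Qed.

End gaussian_integrals.

(** * Expectations on a finite probability space *)

Section finite_mean.
Context (R : realType) (J : finType) (q : J -> R).
Hypothesis q0 : forall z, 0 <= q z.
Hypothesis q1 : \sum_z q z = 1.
Implicit Types (F G : J -> R).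

Definition fmean F : R := \sum_z q z * F z.

Lemma fmean_le F G : (forall z, F z <= G z) -> fmean F <= fmean G.
Proof. by move=> FG; apply: ler_sum => z _; rewrite ler_wpM2l. Qed.

Lemma eq_fmean F G : F =1 G -> fmean F = fmean G.
Proof. by move=> FG; apply: eq_bigr => z _; rewrite FG. Qed.

Lemma fmeanD F G : fmean (fun z => F z + G z) = fmean F + fmean G.
Proof. by rewrite /fmean -big_split; apply: eq_bigr => z _; rewrite mulrDr. Qed.

Lemma fmeanZ (c : R) F : fmean (fun z => c * F z) = c * fmean F.
Proof. by rewrite /fmean mulr_sumr; apply: eq_bigr => z _; rewrite mulrCA. Qed.

Lemma fmeanB F G : fmean (fun z => F z - G z) = fmean F - fmean G.
Proof.
by rewrite /fmean -sumrB; apply: eq_bigr => z _; rewrite mulrBr.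
Qed.

Lemma fmean_sum n (F : 'I_n -> J -> R) :
  fmean (fun z => \sum_i F i z) = \sum_i fmean (F i).
Proof. by rewrite /fmean exchange_big; apply: eq_bigr => z _; rewrite mulr_sumr. Qed.

Lemma fmean_cst (c : R) : fmean (fun=> c) = c.
Proof. by rewrite /fmean -mulr_suml q1 mul1r. Qed.

Lemma fmean_ge0 F : (forall z, 0 <= F z) -> 0 <= fmean F.
Proof. by move=> F0; apply: sumr_ge0 => z _; rewrite mulr_ge0. Qed.

Lemma normr_fmean F : `|fmean F| <= fmean (fun z => `|F z|).
Proof.
apply: (le_trans (ler_norm_sum _ _ _)); apply: ler_sum => z _.
by rewrite normrM (ger0_norm (q0 z)).
Qed.

Lemma fmean_chebyshev F (c : R) : 0 < c ->
  fmean (fun z => (c < `|F z|)%R%:R) <= fmean (fun z => F z ^+ 2) / c ^+ 2.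
Proof.
move=> c0; rewrite ler_pdivlMr ?exprn_gt0// mulrC -fmeanZ; apply: fmean_le => z.
case: ltP => h; last by rewrite mulr0 sqr_ge0.
rewrite mulr1 -(real_normK (num_real (F z))) lerXn2r ?nnegrE//.
  exact: ltW.
exact: ltW.
Qed.

(* From [2 |x| <= e + x^2 / e]. *)
Lemma fmean_norm_le F (e : R) : 0 < e ->
  fmean (fun z => `|F z|) <= e / 2 + fmean (fun z => F z ^+ 2) / (2 * e).
Proof.
move=> e0; rewrite -(fmean_cst (e / 2)) -[_ / (2 * e)]mulrC -fmeanZ -fmeanD.
apply: fmean_le => z.
rewrite -[in leRHS](real_normK (num_real (F z))); set y := `|F z|.
have -> : e / 2 + (2 * e)^-1 * y ^+ 2 = y + (e - y) ^+ 2 / (2 * e).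
  by field; rewrite gt_eqF.
by rewrite lerDl divr_ge0 ?sqr_ge0// mulr_ge0// ltW.
Qed.

End finite_mean.

(** * From centered test functions to distribution functions *)

Section weak_limit.
Context (R : realType) (s : R).
Hypothesis s0 : 0 < s.
Local Notation mu := (@lebesgue_measure R).
Local Notation phi := (normal_pdf 0 s).

(** The class for which the Stein equation is solved. A single nonnegative bump of positive Gaussian
    mass is not in it; a combination of two with cancelling means is. *)
Definition centered_test_function (h : R -> R) : Prop :=
  [/\ exists L : R, forall x y, `|h x - h y| <= L * `|x - y|,
      exists A : R, forall x, A <= `|x| -> h x = 0 &
      gauss_int s h = 0].

Context (J : nat -> finType) (q : forall n, J n -> R) (W : forall n, J n -> R).
Hypothesis q0 : forall n z, 0 <= @q n z.
Hypothesis q1 : forall n, \sum_z @q n z = 1.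
Variable C : R.
Hypothesis WC : \forall n \near \oo, fmean (@q n) (fun z => W z ^+ 2) <= C.
Hypothesis Wh : forall h, centered_test_function h ->
  fmean (@q n) (fun z => h (W z)) @[n --> \oo] --> (0 : R).

Local Notation EW n h := (fmean (@q n) (fun z => h (@W n z))).

(** Weighting each trapezoid by the Gaussian integral of the other cancels the Gaussian mean. In the
    limit the two expectations are thus in the ratio of the two integrals. *)
Lemma trapezoid_proportion (a b K a' b' K' : R) : 0 < K -> 0 < K' ->
  gauss_int s (trapezoid a' b' K') * EW n (trapezoid a b K) -
  gauss_int s (trapezoid a b K) * EW n (trapezoid a' b' K') @[n --> \oo] --> (0 : R).
Proof.
move=> K0 K'0.
set I' := gauss_int s (trapezoid a' b' K'); set I := gauss_int _ _.
pose h x := I' * trapezoid a b K x - I * trapezoid a' b' K' x.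
have -> : (fun n => I' * EW n (trapezoid a b K) - I * EW n (trapezoid a' b' K')) =
    (fun n => EW n h).
  by apply/funext => n; rewrite /h fmeanB !fmeanZ.
have ct (u v k : R) : 0 < k -> continuous (trapezoid u v k).
  move=> k0; apply: (@lipschitz_continuous _ _ k) => x y.
  by apply: trapezoid_lipschitz; exact: ltW.
have t01 (u v k x : R) : 0 <= trapezoid u v k x <= 1.
  by rewrite trapezoid_ge0 trapezoid_le1.
apply: Wh; split.
- exists (`|I'| * K + `|I| * K') => x y.
  rewrite /h opprD addrACA -opprD -!mulrBr mulrDl.
  rewrite (le_trans (ler_normB _ _))// !normrM -!mulrA.
  by rewrite lerD// ler_wpM2l// trapezoid_lipschitz// ltW.
- exists (`|a| + `|b| + K^-1 + (`|a'| + `|b'| + K'^-1)) => x hx.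
  have Ki : 0 < K^-1 by rewrite invr_gt0.
  have Ki' : 0 < K'^-1 by rewrite invr_gt0.
  rewrite /h !trapezoid_support ?mulr0 ?subr0//; apply: le_trans hx.
    by rewrite lerDr !addr_ge0// ltW.
  by rewrite lerDl !addr_ge0// ltW.
- have i1 := integrable_mul_normal_pdf s0 (ct a b K K0) (t01 a b K).
  have i2 := integrable_mul_normal_pdf s0 (ct a' b' K' K'0) (t01 a' b' K').
  transitivity (\int[mu]_x (I' * (trapezoid a b K x * phi x) -
      I * (trapezoid a' b' K' x * phi x)))%R.
    by apply: eq_Rintegral => x _; rewrite /h; ring.
  rewrite RintegralB//.
  + by rewrite !RintegralZl// -/(gauss_int _ _) -/I -/(gauss_int _ _) -/I' mulrC subrr.
  + rewrite (_ : EFin \o _ = (fun x => I'%:E * (trapezoid a b K x * phi x)%:E)%E).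
      exact: integrableZl.
    by apply/funext => x /=; rewrite EFinM.
  + rewrite (_ : EFin \o _ = (fun x => I%:E * (trapezoid a' b' K' x * phi x)%:E)%E).
      exact: integrableZl.
    by apply/funext => x /=; rewrite EFinM.
Qed.

(** The indicator of ]-oo, x] is enclosed, up to tails, between trapezoids ending at x - del and at
    x. Each is compared with a wide trapezoid whose expectation and Gaussian integral are both
    nearly 1. *)
Lemma cdf_convergence (x : R) :
  {for x, continuous (fun y : R => normal_mass s `]-oo, y]%classic)} ->
  fmean (@q n) (fun z => (W z <= x)%R%:R) @[n --> \oo] -->
  normal_mass s `]-oo, x]%classic.
Proof.
move=> cx; set Phi := fun y : R => normal_mass s `]-oo, y]%classic.
have ct (u v k : R) : 0 < k -> continuous (trapezoid u v k).
  move=> k0; apply: (@lipschitz_continuous _ _ k) => y y'.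
  by apply: trapezoid_lipschitz; exact: ltW.
have t01 (u v k y : R) : 0 <= trapezoid u v k y <= 1.
  by rewrite trapezoid_ge0 trapezoid_le1.
apply/cvgrPdist_le => e' e'0.
(* Each side loses 4 e: below, 2 e on the Gaussian side and 2 e in the comparison; above, e, 2 e and
   a tail of e. *)
pose e := e' / 5; have e0 : 0 < e by rewrite divr_gt0.
have /cvgrPdist_le/(_ e e0) := cx.
rewrite -/Phi => /nbhs_ballP[d /= d0 hd].
pose del := d / 2; have del0 : 0 < del by rewrite divr_gt0.
have deld : del < d by rewrite /del; lra.
have hP : `|Phi x - Phi (x + del)| <= e.
  by apply: hd; rewrite /ball/= opprD addrA subrr add0r normrN gtr0_norm.
have hM : `|Phi x - Phi (x - del)| <= e.
  by apply: hd; rewrite /ball/= opprB addrC subrK gtr0_norm.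
have [A1 A10 hA1] := normal_mass_itv s e0.
(* From A >= 1 comes A <= A^2, so that C / e <= A yields the Chebyshev bound C / A^2 <= e. *)
pose A := Num.max A1 (Num.max 1 (C / e)).
have A0 : 0 < A by rewrite lt_max A10.
have hA : 1 - e <= normal_mass s `[- A, A]%classic by apply: hA1; rewrite le_max lexx.
have CA : C / A ^+ 2 <= e.
  have h1 : 1 <= A by rewrite !le_max lexx !orbT.
  have h2 : C / e <= A by rewrite !le_max lexx !orbT.
  rewrite ler_pdivrMr ?exprn_gt0//; rewrite ler_pdivrMr// in h2.
  by apply: (le_trans h2); rewrite mulrC ler_pM2l// ler_eXnr// ltW.
have A1' : 0 < del^-1 by rewrite invr_gt0.
set k := del^-1 in A1' *.
(* The trapezoid on [-A, A] stands in for the constant 1, which lacks compact support. *)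
set I2 := gauss_int s (trapezoid (- A) A 1).
have I2le : I2 <= 1.
  apply: (le_trans _ (normal_mass_le1 s (measurableT))).
  by apply: gauss_int_le => //; [exact: ct|move=> y /(_ I)].
have I2ge : 1 - e <= I2.
  apply: (le_trans hA); apply: gauss_int_ge => //; first exact: ct.
  by move=> y; rewrite /= in_itv/= => ?; apply: trapezoid_eq1.
set I1 := gauss_int s (trapezoid (- A) (x - del) k).
set I3 := gauss_int s (trapezoid (- A) x k).
have massN : normal_mass s `]-oo, (- A)%R[%classic <= e.
  have : normal_mass s `]-oo, (- A)%R[%classic + normal_mass s `[- A, A]%classic <= 1.
    apply: normal_mass_disjoint; try exact: measurable_itv.
    apply/seteqP; split => // y []; rewrite /= !in_itv/= => yA /andP[Ay _].
    by have := lt_le_trans yA Ay; rewrite ltxx.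
  by lra.
have I1ge : Phi x - 2 * e <= I1.
  have : normal_mass s `[- A, x - del]%classic <= I1.
    apply: gauss_int_ge => //; first exact: ct.
    by move=> y; rewrite /= in_itv/= => ?; apply: trapezoid_eq1 => //; exact: ltW.
  have : Phi (x - del) <= normal_mass s `]-oo, (- A)%R[%classic +
      normal_mass s `[- A, x - del]%classic.
    apply: normal_mass_cover; try exact: measurable_itv.
    move=> y; rewrite /= !in_itv/= => yx.
    by have [yA|Ay] := ltP y (- A);
      [left|right; apply/andP].
  by move: hM; rewrite ler_norml => /andP[_]; lra.
have I3le : I3 <= Phi x + e.
  have : I3 <= Phi (x + del).
    apply: gauss_int_le => //; first exact: ct.
    move=> y; rewrite /= in_itv/= => /negP; rewrite -ltNge => xy.
    by apply: trapezoid_eq0r; rewrite -(mulVf (lt0r_neq0 del0)) ler_pM2l//; lra.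
  by move: hP; rewrite ler_norml => /andP[]; lra.
have I01 (h : R -> R) : continuous h -> (forall y, 0 <= h y <= 1) ->
    0 <= gauss_int s h <= 1.
  move=> ch h01; apply/andP; split.
    have <- : normal_mass s set0 = 0 by rewrite /normal_mass measure0.
    exact: gauss_int_ge.
  apply: (le_trans _ (normal_mass_le1 s (measurableT))).
  by apply: gauss_int_le => // y /(_ I).
have /andP[I10 I11] : 0 <= I1 <= 1 by apply: I01 => //; exact: ct.
have /andP[I30 _] : 0 <= I3 <= 1 by apply: I01 => //; exact: ct.
have [tr1 tr2] := (trapezoid_proportion (- A) (x - del) (- A) A A1' ltr01,
  trapezoid_proportion (- A) x (- A) A A1' ltr01).
have /cvgrPdist_le/(_ e e0) {}tr1 := tr1; have /cvgrPdist_le/(_ e e0) {}tr2 := tr2.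
near=> n.
have h1 : `|0 - (I2 * EW n (trapezoid (- A) (x - del) k) -
    I1 * EW n (trapezoid (- A) A 1))| <= e by near: n.
have h3 : `|0 - (I2 * EW n (trapezoid (- A) x k) -
    I3 * EW n (trapezoid (- A) A 1))| <= e by near: n.
have Wn : fmean (@q n) (fun z => W z ^+ 2) <= C by near: n.
set E1 := EW n (trapezoid (- A) (x - del) k) in h1.
set E2 := EW n (trapezoid (- A) A 1) in h1 h3.
set E3 := EW n (trapezoid (- A) x k) in h3.
have E01 (h : R -> R) : (forall y, 0 <= h y <= 1) -> 0 <= EW n h <= 1.
  move=> h01; apply/andP; split.
    by apply: fmean_ge0 => // z; case/andP: (h01 (W z)).
  by rewrite -[leRHS](fmean_cst (q1 n)); apply: fmean_le => // z; case/andP: (h01 (W z)).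
have /andP[E10 E11] : 0 <= E1 <= 1 by apply: E01.
have /andP[E20 E21] : 0 <= E2 <= 1 by apply: E01.
have /andP[E30 E31] : 0 <= E3 <= 1 by apply: E01.
set tl := fmean (@q n) (fun z => (A < `|W z|)%R%:R).
have tail : tl <= e.
  apply: (le_trans (fmean_chebyshev (@q0 n) _ A0)).
  by apply: le_trans CA; rewrite ler_pM2r// invr_gt0 exprn_gt0.
have outside y : ~~ (A < `|y|) -> - A <= y <= A by rewrite -leNgt ler_norml.
have E2ge : 1 - e <= E2.
  suff : 1 <= E2 + tl by lra.
  rewrite -(fmean_cst (q1 n) 1) -fmeanD; apply: fmean_le => // z.
  have /andP[? ?] := t01 (- A) A 1 (W z).
  by case: (boolP (A < _)) => [_|/outside h]; rewrite ?lerDr// trapezoid_eq1// addr0.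
set P := fmean (@q n) (fun z => (W z <= x)%R%:R).
have PE1 : E1 <= P.
  apply: fmean_le => // z; have /andP[? ?] := t01 (- A) (x - del) k (W z).
  case: (leP (W z) x) => // xW; rewrite trapezoid_eq0r//.
  by rewrite -(mulVf (lt0r_neq0 del0)) ler_pM2l//; lra.
have PE3 : P <= E3 + tl.
  rewrite -fmeanD; apply: fmean_le => // z; have /andP[? ?] := t01 (- A) x k (W z).
  case: (boolP (A < _)) => [_|/outside /andP[AW _]].
    by case: (leP (W z) x) => _ /=; lra.
  case: (leP (W z) x) => [Wx|_] /=; last by rewrite addr0.
  by rewrite trapezoid_eq1 ?AW ?addr0// ltW.
move: h1 h3; rewrite !sub0r !normrN !ler_norml => /andP[h1 _] /andP[_ h3].
(* I2 E1 is within e of I1 E2; replacing I2 by 1 only helps, and replacing E2 by 1 costs e I1 <=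
   e. *)
have lo : I1 - 2 * e <= E1.
  have p1 : 0 <= E1 * (1 - I2) by rewrite mulr_ge0// subr_ge0.
  have p2 : 0 <= I1 * (E2 - (1 - e)) by rewrite mulr_ge0// subr_ge0.
  have p3 : 0 <= e * (1 - I1) by rewrite mulr_ge0 ?subr_ge0// ltW.
  by lra.
have up : E3 <= I3 + 2 * e.
  have p1 : 0 <= E3 * (I2 - (1 - e)) by rewrite mulr_ge0// subr_ge0.
  have p2 : 0 <= I3 * (1 - E2) by rewrite mulr_ge0// subr_ge0.
  have p3 : 0 <= e * (1 - E3) by rewrite mulr_ge0 ?subr_ge0// ltW.
  by lra.
have ee : e' = 5 * e by rewrite /e; field.
by rewrite ee -/(Phi x); apply/andP; split; lra.
Unshelve. all: end_near.
Qed.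

End weak_limit.

(** * Exchangeable indicators *)

Section exchangeable_indicators.
Context (R : realType) (m n : nat) (q : {ffun 'I_m -> bool} -> R).
Hypothesis nm : (n <= m)%N.
Hypothesis q0 : forall z, 0 <= q z.
Hypothesis q1 : \sum_z q z = 1.
Hypothesis qperm : forall s F,
  fmean q F = fmean q (fun z => F (perm_ffun s z)).
Implicit Types z : {ffun 'I_m -> bool}.
Local Notation E := (fmean q).

Definition total z : R := \sum_(i < m) (z i)%:R.

Definition partial z : R := \sum_(i < m | (i < n)%N) (z i)%:R.

Lemma partial_ge0 z : 0 <= partial z.
Proof. exact: sumr_ge0. Qed.

Lemma card_prefix : \sum_(i < m | (i < n)%N) 1 = n%:R :> R.
Proof.
rewrite -(big_ord_widen _ (fun=> 1 : R) nm) sumr_const card_ord.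
by rewrite -[RHS]mulr_natr mul1r.
Qed.

Lemma partial_le z : partial z <= n%:R.
Proof. by rewrite -card_prefix; apply: ler_sum => i _; case: (z i). Qed.

Lemma total_partial z :
  total z - partial z = \sum_(j < m | ~~ (j < n)%N) (z j)%:R.
Proof. by rewrite /total (bigID (fun i : 'I_m => (i < n)%N))/= addrC addrK. Qed.

Lemma partial_le_total z : partial z <= total z.
Proof. by rewrite -subr_ge0 total_partial sumr_ge0. Qed.

Lemma total_perm s z : total (perm_ffun s z) = total z.
Proof.
rewrite /total [RHS](reindex_inj (@perm_inj _ s))/=.
by apply: eq_bigr => i _; rewrite ffunE.
Qed.

Lemma partial_tperm (i j : 'I_m) z : (i < n)%N -> ~~ (j < n)%N ->
  partial (perm_ffun (tperm i j) z) = partial z - (z i)%:R + (z j)%:R.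
Proof.
move=> i_n j_n; rewrite /partial (bigD1 i)//= [in RHS](bigD1 i)//=.
rewrite ffunE tpermL [in RHS](addrC (z i)%:R) addrK addrC; congr (_ + _).
apply: eq_bigr => l /andP[l_n li]; rewrite ffunE tpermD// 1?eq_sym//.
by apply: contraNneq j_n => <-.
Qed.

(** Exchanging i and j preserves the law and the total, and turns z_i = 0, z_j = 1 with partial sum
    S into z_i = 1, z_j = 0 with partial sum S + 1. *)
Lemma swap_identity (g : R -> R -> R) (i j : 'I_m) : (i < n)%N -> ~~ (j < n)%N ->
  E (fun z => (1 - (z i)%:R) * (z j)%:R * g (partial z + 1) (total z)) =
  E (fun z => (z i)%:R * (1 - (z j)%:R) * g (partial z) (total z)).
Proof.
move=> i_n j_n; rewrite [RHS](qperm (tperm i j)); apply: eq_fmean => z.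
rewrite partial_tperm// total_perm !ffunE tpermL tpermR.
by case: (z i); case: (z j);
  rewrite /= ?mulr1n ?mulr0n ?subrr ?subr0 ?mul0r ?mulr0 ?mul0r ?mul1r ?addr0.
Qed.

(** Summed over i < n <= j, the weights of the swap identity are (n - S)(M - S) on the left and S (m
    - n - M + S) on the right; their difference is m S - n M. *)
Lemma stein_identity (g : R -> R -> R) :
  E (fun z => (n%:R - partial z) * (total z - partial z) *
    (g (partial z + 1) (total z) - g (partial z) (total z))) =
  E (fun z => (m%:R * partial z - n%:R * total z) * g (partial z) (total z)).
Proof.
pose c (b : bool) : R := b%:R.
have h : E (fun z => (n%:R - partial z) * (total z - partial z) *
      g (partial z + 1) (total z)) =
    E (fun z => partial z * (m%:R - n%:R - (total z - partial z)) *
      g (partial z) (total z)).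
  transitivity (\sum_(i < m | (i < n)%N) \sum_(j < m | ~~ (j < n)%N)
      E (fun z => (1 - c (z i)) * c (z j) * g (partial z + 1) (total z))).
    rewrite /fmean; under [RHS]eq_bigr do rewrite exchange_big/=.
    rewrite [RHS]exchange_big/=; apply: eq_bigr => z _.
    under [RHS]eq_bigr do rewrite -mulr_sumr -mulr_suml -mulr_sumr.
    rewrite -mulr_sumr -!mulr_suml sumrB card_prefix -/(partial z).
    by rewrite total_partial.
  transitivity (\sum_(i < m | (i < n)%N) \sum_(j < m | ~~ (j < n)%N)
      E (fun z => c (z i) * (1 - c (z j)) * g (partial z) (total z))).
    by apply: eq_bigr => i i_n; apply: eq_bigr => j j_n; exact: swap_identity.
  rewrite /fmean; under eq_bigr do rewrite exchange_big/=.
  rewrite exchange_big/=; apply: eq_bigr => z _.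
  under eq_bigr do rewrite -mulr_sumr -mulr_suml -mulr_sumr.
  rewrite -mulr_sumr -!mulr_suml sumrB -total_partial -/(partial z).
  have -> : \sum_(j < m | ~~ (j < n)%N) 1 = m%:R - n%:R :> R.
    have <- : \sum_(i < m) 1 = m%:R :> R by rewrite sumr_const card_ord.
    by rewrite -card_prefix [X in _ = X - _](bigID (fun i : 'I_m => (i < n)%N))/=
      [X in _ = X - _]addrC addrK.
  by [].
under eq_fmean do rewrite mulrBr.
rewrite fmeanB h -fmeanB; apply: eq_fmean => z; ring.
Qed.

End exchangeable_indicators.

(** * The Stein estimate for the centered partial sum *)

Section stein_estimate.
Context (R : realType) (m n : nat) (q : {ffun 'I_m -> bool} -> R) (p : R).
Hypothesis n0 : (0 < n)%N.
Hypothesis nm : (n <= m)%N.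
Hypothesis q0 : forall z, 0 <= q z.
Hypothesis q1 : \sum_z q z = 1.
Hypothesis qperm : forall s F,
  fmean q F = fmean q (fun z => F (perm_ffun s z)).
Hypothesis qp : forall i, fmean q (fun z => (z i)%:R) = p.
Hypothesis p0 : 0 < p.
Hypothesis p1 : p < 1.
Implicit Types z : {ffun 'I_m -> bool}.
Local Notation E := (fmean q).
Local Notation S := (@partial R m n).
Local Notation M := (@total R m).

Definition scale : R := Num.sqrt (n%:R * (p * (1 - p))).

(** S is centered by its share n M / m of the total rather than by its mean n p: this is the
    centering that exchanges produce. *)
Definition centered_partial z : R := (m%:R * S z - n%:R * M z) / (m%:R * scale).
Local Notation W := centered_partial.

Let nR : 0 < n%:R :> R. Proof. by rewrite ltr0n. Qed.
Let mR : 0 < m%:R :> R. Proof. by rewrite ltr0n (leq_trans n0). Qed.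
Let p1' : 0 < 1 - p. Proof. by rewrite subr_gt0. Qed.

Lemma scale_sqr : scale ^+ 2 = n%:R * (p * (1 - p)).
Proof. by rewrite sqr_sqrtr// !mulr_ge0// ltW. Qed.

Lemma scale_gt0 : 0 < scale.
Proof. by rewrite sqrtr_gt0 !mulr_gt0. Qed.

(** The random coefficient that takes the place of the variance in the Stein equation; it equals 1 -
    n / m when M = m p and S = n p. *)
Definition dispersion z : R :=
  (n%:R - S z) * (M z - S z) / (m%:R * scale ^+ 2).
Local Notation D := dispersion.

Lemma mean_total : E M = m%:R * p.
Proof.
rewrite /total fmean_sum; under eq_bigr do rewrite qp.
by rewrite sumr_const card_ord mulr_natl.
Qed.

Lemma mean_partial : E S = n%:R * p.
Proof.
rewrite /fmean /partial; under eq_bigr do rewrite mulr_sumr.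
rewrite exchange_big/=; under eq_bigr do rewrite -/(fmean q _) qp.
rewrite -(big_ord_widen _ (fun=> p) nm) sumr_const card_ord.
by rewrite mulr_natl.
Qed.

Lemma normalized_stein_identity (f : R -> R) :
  E (fun z => W z * f (W z)) =
  E (fun z => D z * (scale * (f (W z + scale^-1) - f (W z)))).
Proof.
have sc := scale_gt0.
pose g a b := f ((m%:R * a - n%:R * b) / (m%:R * scale)).
have h := stein_identity nm qperm g.
transitivity ((m%:R * scale)^-1 *
    E (fun z => (m%:R * S z - n%:R * M z) * g (S z) (M z))).
  by rewrite -fmeanZ; apply: eq_fmean => z; rewrite /W mulrAC mulrC.
rewrite -h -fmeanZ; apply: eq_fmean => z; rewrite /g /D.
have -> : (m%:R * (S z + 1) - n%:R * M z) / (m%:R * scale) = W z + scale^-1.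
  by rewrite /W; field; rewrite !gt_eqF.
by rewrite -/(W z); field; rewrite !gt_eqF.
Qed.

Lemma dispersion_ge0 z : 0 <= D z.
Proof.
rewrite /D divr_ge0//; last by rewrite mulr_ge0 ?sqr_ge0// ltW.
by rewrite mulr_ge0// subr_ge0 ?partial_le// partial_le_total.
Qed.

(** Use (n - S)(M - S) <= n M and the mean of M. *)
Lemma mean_dispersion_le : E D <= (1 - p)^-1.
Proof.
have sc := scale_gt0.
apply: (@le_trans _ _ (E (fun z => (m%:R * p * (1 - p))^-1 * M z))).
  apply: fmean_le => // z.
  rewrite /D scale_sqr.
  have -> : (m%:R * p * (1 - p))^-1 * M z =
      (n%:R * M z) / (m%:R * (n%:R * (p * (1 - p)))).
    by field; rewrite !gt_eqF.
  rewrite ler_pM2r ?invr_gt0 ?mulr_gt0//.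
  apply: ler_pM; rewrite ?subr_ge0 ?partial_le ?partial_le_total//.
    by rewrite gerBl partial_ge0.
  by rewrite gerBl partial_ge0.
rewrite fmeanZ mean_total le_eqVlt; apply/orP; left; apply/eqP.
by field; rewrite !gt_eqF.
Qed.

(** For the identity function the difference quotient in the Stein identity is 1, so the mean of W^2
    equals that of [dispersion]. *)
Lemma mean_centered_partial_sqr : E (fun z => W z ^+ 2) <= (1 - p)^-1.
Proof.
apply: le_trans mean_dispersion_le.
rewrite le_eqVlt; apply/orP; left; apply/eqP.
transitivity (E (fun z => W z * id (W z))) => //.
rewrite (normalized_stein_identity id); apply: eq_fmean => z.
rewrite addrAC subrr add0r mulfV ?mulr1//.
by rewrite gt_eqF// scale_gt0.
Qed.

Definition total_error : R := E (fun z => `|M z / (m%:R * p) - 1|).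

Local Notation rho := (1 - n%:R / m%:R : R).

Lemma mean_norm_centered : E (fun z => `|W z|) <= (1 - p)^-1.
Proof.
apply: (le_trans (fmean_norm_le q0 q1 _ ltr01)).
apply: (@le_trans _ _ (1 / 2 + (1 - p)^-1 / (2 * 1))).
  by rewrite lerD2l ler_pM2r ?invr_gt0// mean_centered_partial_sqr.
have : 1 <= (1 - p)^-1 by rewrite invf_ge1// gerBl ltW.
by rewrite mulr1; lra.
Qed.

(** From M - S = rho M - scale W, the error splits into that of M / (m p), a multiple of W, and p -
    S / n. The last is bounded crudely by p + S / n, of mean 2 p, which suffices since p tends to
    0. *)
Lemma mean_dispersion_error :
  E (fun z => `|D z - rho|) <=
  (1 - p)^-1 * (total_error + scale / (m%:R * p) * (1 - p)^-1 + 2 * p).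
Proof.
have sc := scale_gt0.
have rho01 : 0 <= rho <= 1.
  by rewrite subr_ge0 gerBl ler_pdivrMr// mul1r ler_nat nm divr_ge0.
have /andP[r0 r1] := rho01.
have mp : 0 < m%:R * p by rewrite mulr_gt0.
apply: (@le_trans _ _ (E (fun z => (1 - p)^-1 *
  (`|M z / (m%:R * p) - 1| + (scale / (m%:R * p) * `|W z| + (n%:R^-1 * S z + p)))))).
  apply: fmean_le => // z.
  rewrite -(ler_pM2l p1') mulrA mulfV ?gt_eqF// mul1r.
  rewrite -[X in X * `|_|](ger0_norm (ltW p1')) -normrM.
  have -> : (1 - p) * (D z - rho) =
     (1 - S z / n%:R) * ((M z / (m%:R * p) - 1) * rho - scale / (m%:R * p) * W z)
     + (p * rho - S z / n%:R * rho).
    rewrite /D scale_sqr /W; field.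
    by rewrite !gt_eqF.
  have S0 : 0 <= S z / n%:R by rewrite divr_ge0 ?partial_ge0.
  have S1 : S z / n%:R <= 1 by rewrite ler_pdivrMr// mul1r partial_le.
  rewrite (le_trans (ler_normD _ _))// [X in _ <= X]addrA lerD//.
    rewrite normrM (le_trans (ler_piMl _ _))//.
      by rewrite ger0_norm ?subr_ge0// gerBl.
    rewrite (le_trans (ler_normB _ _))// lerD//.
      by rewrite normrM ler_piMr// ger0_norm.
    by rewrite normrM ger0_norm// divr_ge0// ltW.
  have h1 : `|S z / n%:R * rho| <= n%:R^-1 * S z.
    by rewrite (ger0_norm (mulr_ge0 S0 r0)) [leRHS]mulrC ler_piMr.
  have h2 : `|p * rho| <= p.
    by rewrite (ger0_norm (mulr_ge0 (ltW p0) r0)) ler_piMr// ltW.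
  by apply: (le_trans (ler_normB _ _)); rewrite addrC lerD.
rewrite fmeanZ ler_pM2l ?invr_gt0// !fmeanD -/total_error !fmeanZ mean_partial.
rewrite fmean_cst// mulrA mulVf ?gt_eqF// mul1r.
rewrite -addrA lerD2l lerD//; last by rewrite mulr2n mulrDl mul1r.
by rewrite ler_pM2l ?divr_gt0// mean_norm_centered.
Qed.

(** The difference quotient is f' at a point within 1 / scale of W. Replacing that point by W costs
    K / scale per unit of [dispersion]; replacing [dispersion] by rho costs K times its error. *)
Lemma stein_estimate (f f' : R -> R) (K : R) :
  (forall x, is_derive x (1 : R) f (f' x)) -> (forall x, `|f' x| <= K) ->
  (forall x y, `|f' x - f' y| <= K * `|x - y|) ->
  `|E (fun z => rho * f' (W z) - W z * f (W z))| <=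
  K * (E (fun z => `|D z - rho|) + scale^-1 * (1 - p)^-1).
Proof.
move=> df f'K f'L; have sc := scale_gt0; have K0 : 0 <= K by apply: le_trans (f'K 0).
rewrite fmeanB normalized_stein_identity -fmeanB.
apply: (le_trans (normr_fmean q0 _)).
apply: (@le_trans _ _ (E (fun z => K * (`|D z - rho| + scale^-1 * D z)))).
  apply: fmean_le => // z.
  have sci : 0 < scale^-1 by rewrite invr_gt0.
  have Wle : W z <= W z + scale^-1 by rewrite lerDl ltW.
  have [c /andP[c1 c2] ->] := is_derive_mean_value df Wle.
  have -> : rho * f' (W z) - D z * (scale * (f' c * (W z + scale^-1 - W z))) =
      (rho - D z) * f' (W z) + D z * (f' (W z) - f' c).
    by field; rewrite !gt_eqF.
  rewrite (le_trans (ler_normD _ _))// [leRHS]mulrDr lerD//.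
    by rewrite normrM distrC mulrC ler_wpM2r.
  rewrite normrM (ger0_norm (dispersion_ge0 z)).
  have -> : K * (scale^-1 * D z) = D z * (K * scale^-1) by ring.
  rewrite ler_wpM2l ?dispersion_ge0// (le_trans (f'L _ _))//.
  by rewrite ler_wpM2l// ler_norml; apply/andP; split; lra.
rewrite fmeanZ fmeanD fmeanZ ler_wpM2l// lerD2l ler_pM2l ?invr_gt0//.
exact: mean_dispersion_le.
Qed.

End stein_estimate.

(** * Asymptotics *)

Section expected_maxima.
Context (R : realType).
Implicit Types (k m n : nat).

Definition harmonic_sum m : R := \sum_(i < m) i.+1%:R^-1.

Lemma harmonic_sum_recr m : harmonic_sum m.+1 = harmonic_sum m + m.+1%:R^-1.
Proof. by rewrite /harmonic_sum big_ord_recr. Qed.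

Lemma harmonic_sum_ge0 m : 0 <= harmonic_sum m.
Proof. by apply: sumr_ge0 => i _; rewrite invr_ge0. Qed.

Lemma harmonic_sum_le m n : (m <= n)%N -> harmonic_sum m <= harmonic_sum n.
Proof.
move=> /subnK <-; elim: (n - m)%N => // d IH.
by rewrite addSn harmonic_sum_recr (le_trans IH)// lerDl invr_ge0.
Qed.

Lemma harmonic_sum_ge1 m : 1 <= harmonic_sum m.+1.
Proof.
apply: le_trans (harmonic_sum_le (ltn0Sn m)).
by rewrite harmonic_sum_recr /harmonic_sum big_ord0 add0r invr1.
Qed.

Lemma harmonic_sum_le_nat m : harmonic_sum m <= m%:R.
Proof.
elim: m => [|m IH]; first by rewrite /harmonic_sum big_ord0.
by rewrite harmonic_sum_recr -[leRHS]natr1 lerD// invf_le1// ler1n.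
Qed.

Lemma ln_le_harmonic_sum m : ln m.+1%:R <= harmonic_sum m.
Proof.
elim: m => [|m IH]; first by rewrite ln1 harmonic_sum_ge0.
have e : m.+2%:R = m.+1%:R * (1 + m.+1%:R^-1) :> R.
  by rewrite mulrDr mulr1 mulfV// natr1.
rewrite e lnM ?posrE ?ltr0n// ?ltr_wpDr ?invr_ge0// harmonic_sum_recr lerD//.
by apply: le_ln1Dx; rewrite (lt_le_trans (ltrN10 R)) ?invr_ge0.
Qed.

Lemma harmonic_sum_le_ln m : harmonic_sum m.+1 <= 1 + ln m.+1%:R.
Proof.
elim: m => [|m IH].
  by rewrite harmonic_sum_recr /harmonic_sum big_ord0 add0r invr1 ln1 addr0.
rewrite harmonic_sum_recr; apply: (le_trans (lerD IH (lexx _))).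
rewrite -addrA lerD2l -lerBrDr.
have e : m.+1%:R = m.+2%:R * (1 + - m.+2%:R^-1) :> R.
  by rewrite mulrDr mulr1 mulrN mulfV// -[m.+2%:R]natr1 addrK.
have lt1 : m.+2%:R^-1 < 1 :> R by rewrite invf_lt1// ltr1n.
rewrite e lnM ?posrE ?ltr0n ?subr_gt0// lerD2l; apply: le_ln1Dx.
by rewrite ltrN2.
Qed.

Lemma harmonic_sum_cvgy : harmonic_sum m @[m --> \oo] --> +oo.
Proof.
have := @dvg_harmonic R.
have <- : harmonic_sum = series harmonic.
  by apply/funext => m; rewrite /harmonic_sum /series/= big_mkord.
move=> dH; apply: nondecreasing_dvgn_lt => //.
by move=> m n; exact: harmonic_sum_le.
Qed.

(* The expected number of maxima among [m.+1] points of the [k]-cube. *)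
Definition mean_maxima k m : R := m.+1%:R * moment k m 1.

(** Probabilistic reading: the point with the (i + 1)-th largest value of one coordinate is a
    maximum when, in the other coordinates, it is a maximum among the i + 1 highest points. *)
Lemma mean_maxima_recl k m :
  mean_maxima k.+1 m = \sum_(i < m.+1) mean_maxima k i / i.+1%:R.
Proof.
rewrite /mean_maxima momentS mulrA mulfV// mul1r; apply: eq_bigr => i _.
by rewrite mulrAC mulfV// mul1r.
Qed.

Lemma mean_maxima1 m : mean_maxima 1 m = 1.
Proof.
rewrite mean_maxima_recl big_ord_recl/= /mean_maxima/= subrr expr0 mul1r divr1.
by rewrite big1 ?addr0// => i _; rewrite expr0n mulr0 mul0r.
Qed.

Lemma mean_maxima_ge0 k m : 0 <= mean_maxima k m.
Proof. by rewrite mulr_ge0// moment_ge0// ler01 lexx. Qed.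

Lemma mean_maxima_leS k m : mean_maxima k.+1 m <= mean_maxima k.+1 m.+1.
Proof.
rewrite !mean_maxima_recl [leRHS]big_ord_recr/= lerDl.
by rewrite divr_ge0// mean_maxima_ge0.
Qed.

Lemma mean_maxima_le k m : mean_maxima k.+1 m <= harmonic_sum m.+1 ^+ k.
Proof.
elim: k m => [|k IH] m; first by rewrite mean_maxima1 expr0.
rewrite mean_maxima_recl exprS /harmonic_sum mulr_suml; apply: ler_sum => i _.
rewrite mulrC ler_wpM2l ?invr_ge0// (le_trans (IH i))//.
by rewrite lerXn2r ?nnegrE ?harmonic_sum_ge0// harmonic_sum_le.
Qed.

(** The mean value bound for a power, applied below to consecutive harmonic sums. *)
Lemma exprn_diff_le n (x y : R) : 0 <= y -> y <= x ->
  x ^+ n.+1 - y ^+ n.+1 <= n.+1%:R * (x - y) * x ^+ n.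
Proof.
move=> y0 yx; have x0 := le_trans y0 yx.
elim: n => [|n IH]; first by rewrite !expr1 expr0 mulr1 mul1r.
have -> : x ^+ n.+2 - y ^+ n.+2 =
    x * (x ^+ n.+1 - y ^+ n.+1) + (x - y) * y ^+ n.+1.
  by rewrite (exprS x n.+1) (exprS y n.+1); ring.
have -> : n.+2%:R * (x - y) * x ^+ n.+1 =
    x * (n.+1%:R * (x - y) * x ^+ n) + (x - y) * x ^+ n.+1.
  by rewrite (exprS x n) -[n.+2%:R]natr1; ring.
by rewrite lerD ?ler_wpM2l ?subr_ge0// lerXn2r.
Qed.

(** A discrete form of integrating x^k: each increment of H^(k+1) / (k + 1)! is at most the
    corresponding term of the recursion, and k! accumulates. *)
Lemma mean_maxima_ge k m : harmonic_sum m.+1 ^+ k / k`!%:R <= mean_maxima k.+1 m.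
Proof.
elim: k m => [|k IH] m; first by rewrite mean_maxima1 expr0 fact0 divr1.
have : harmonic_sum m.+1 ^+ k.+1 / k.+1`!%:R <=
    \sum_(i < m.+1) (harmonic_sum i.+1 ^+ k / k`!%:R) / i.+1%:R.
  elim: m => [|m IHm].
    rewrite big_ord_recl big_ord0 addr0 harmonic_sum_recr /harmonic_sum big_ord0.
    rewrite add0r invr1 !expr1n.
    rewrite !mul1r mulr1.
    by rewrite lef_pV2 ?posrE ?ltr0n ?fact_gt0// ler_nat factS leq_pmull.
  rewrite big_ord_recr/=; apply: le_trans (lerD IHm (lexx _)).
  rewrite -lerBlDl -mulrBl.
  have := exprn_diff_le k (harmonic_sum_ge0 m.+1) (harmonic_sum_le (leqnSn m.+1)).
  rewrite {2}harmonic_sum_recr addrAC subrr add0r => h.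
  have kf : 0 < (k.+1)`!%:R :> R by rewrite ltr0n fact_gt0.
  rewrite ler_pdivrMr// (le_trans h)// factS natrM.
  have kf' : k`!%:R != 0 :> R by rewrite pnatr_eq0 -lt0n fact_gt0.
  have b0 : m.+2%:R != 0 :> R by rewrite pnatr_eq0.
  move: kf' b0; move: (k.+1%:R : R) (k`!%:R : R) (m.+2%:R : R) => a b c b0 c0.
  by rewrite le_eqVlt; apply/orP; left; apply/eqP; field; rewrite c0 b0.
move=> /le_trans; apply; rewrite mean_maxima_recl; apply: ler_sum => i _.
by rewrite ler_wpM2r ?invr_ge0// IH.
Qed.

(** At t = 1 each further dimension takes the Cesaro means of the preceding sequence, starting from
    1 / (m + 1) in dimension 1. *)
Lemma moment_cvg0 k : moment k.+1 m (1 : R) @[m --> \oo] --> (0 : R).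
Proof.
elim: k => [|k IH].
  have -> : (fun m => moment 1 m (1 : R)) = harmonic.
    apply/funext => m; have := mean_maxima1 m; rewrite /mean_maxima => h.
    by apply: (@mulfI _ m.+1%:R); rewrite ?h ?mulfV// pnatr_eq0.
  exact: cvg_harmonic.
have := cesaro IH; apply: cvg_trans; apply: near_eq_cvg.
apply: nearW => m; rewrite momentS /arithmetic_mean /series/= big_mkord.
by [].
Qed.

End expected_maxima.

(** * Mean-square error of the number of maxima *)

Section total_second_moment.
Context (R : realType) (m : nat) (q : {ffun 'I_m -> bool} -> R) (p r : R).
Hypothesis q0 : forall z, 0 <= q z.
Hypothesis q1 : \sum_z q z = 1.
Hypothesis qp : forall i, fmean q (fun z => (z i)%:R) = p.
Hypothesis qr : forall i j, i != j -> fmean q (fun z => (z i)%:R * (z j)%:R) <= r.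
Local Notation E := (fmean q).

Lemma mean_total_sqr_le :
  E (fun z => total R z ^+ 2) <= m%:R * p + m%:R * m.-1%:R * r.
Proof.
have -> : E (fun z => total R z ^+ 2) =
    \sum_(i < m) \sum_(j < m) E (fun z => (z i)%:R * (z j)%:R).
  transitivity (E (fun z => \sum_(i < m) \sum_(j < m) ((z i)%:R * (z j)%:R))).
    apply: eq_fmean => z; rewrite expr2 /total mulr_suml; apply: eq_bigr => i _.
    by rewrite mulr_sumr.
  by rewrite fmean_sum; apply: eq_bigr => i _; rewrite fmean_sum.
have -> : m%:R * p + m%:R * m.-1%:R * r = \sum_(i < m) (p + m.-1%:R * r).
  by rewrite sumr_const card_ord -[RHS]mulr_natl mulrDr mulrA.
apply: ler_sum => i _; rewrite (bigD1 i)//= lerD//.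
  rewrite -(qp i) le_eqVlt; apply/orP; left; apply/eqP.
  by apply: eq_fmean => z; rewrite -natrM mulnb andbb.
apply: (@le_trans _ _ (\sum_(j < m | j != i) r)).
  by apply: ler_sum => j ji; apply: qr; rewrite eq_sym.
rewrite sumr_const mulr_natl (_ : #|_| = m.-1)//.
transitivity #|predC1 i|; last by rewrite cardC1 card_ord.
by apply: eq_card => j; rewrite !inE.
Qed.

Definition total_sqr_error : R :=
  E (fun z => (total R z / (m%:R * p) - 1) ^+ 2).

Lemma total_sqr_errorE : 0 < m%:R * p ->
  total_sqr_error = E (fun z => total R z ^+ 2) / (m%:R * p) ^+ 2 - 1.
Proof.
move=> a0; rewrite /total_sqr_error.
transitivity (E (fun z => ((m%:R * p) ^+ 2)^-1 * total R z ^+ 2 +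
    ((- 2 / (m%:R * p)) * total R z + 1))).
  by apply: eq_fmean => z; field; move: (lt0r_neq0 a0); rewrite mulf_eq0 negb_or andbC.
rewrite !fmeanD !fmeanZ (mean_total qp) fmean_cst// mulrC.
by rewrite divfK ?gt_eqF//; ring.
Qed.

Lemma total_sqr_error_le : 0 < m%:R * p ->
  total_sqr_error <= (m%:R * p + m%:R * m.-1%:R * r) / (m%:R * p) ^+ 2 - 1.
Proof.
move=> a0; rewrite total_sqr_errorE// lerD2r ler_pM2r ?mean_total_sqr_le//.
by rewrite invr_gt0 exprn_gt0.
Qed.

Lemma total_error_le (e : R) : 0 < e ->
  total_error q p <= e / 2 + total_sqr_error / (2 * e).
Proof. by move=> e0; exact: fmean_norm_le. Qed.

End total_second_moment.

Section maxima_total_error.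
Context (R : realType).

Definition maxima_sqr_error k m : R :=
  total_sqr_error (@maxima_prob R k m) (p_max R k m).

(** The mean number of maxima is 1 and two points are never both maxima, so the second moment is at
    most 1 as well. *)
Lemma maxima_sqr_error_dim1 m : (0 < m)%N -> maxima_sqr_error 1 m <= 0.
Proof.
case: m => // m _.
have p1 : m.+1%:R * p_max R 1 m.+1 = 1.
  by rewrite p_maxE -/(mean_maxima R 1 m) mean_maxima1.
apply: (le_trans (total_sqr_error_le (r := 0) _ _ _ _)).
- exact: sum_maxima_prob.
- by move=> i; rewrite p_maxE; exact: maxima_prob_maximum.
- case: m p1 => [_ i j|m _ i j ij]; first by rewrite !ord1 eqxx.
  by rewrite /fmean maxima_prob_pair_dim1.
- by rewrite p1.
- by rewrite p1 expr1n mulr0 addr0 divr1 subrr.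
Qed.

(** The leading parts of the pair bound cancel against the square of the mean. What remains is
    controlled by the ratio of the mean numbers of maxima in dimensions k - 1 and k, at most (k -
    1)! / H. *)
Lemma maxima_sqr_error_le k m : (1 < k)%N -> (1 < m)%N ->
  maxima_sqr_error k m <= 27 * (k.-1)`!%:R / harmonic_sum R m.
Proof.
case: k => [|[|k]]// _; case: m => [|[|N]]// _.
have a0 : 0 < mean_maxima R k.+2 N.+1.
  apply: lt_le_trans (mean_maxima_ge R k.+1 N.+1).
  rewrite divr_gt0 ?ltr0n ?fact_gt0// exprn_gt0//.
  exact: lt_le_trans (harmonic_sum_ge1 R N.+1).
have pE : N.+2%:R * p_max R k.+2 N.+2 = mean_maxima R k.+2 N.+1.
  by rewrite p_maxE.
apply: (le_trans (total_sqr_error_le _ _ _ _)).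
- exact: sum_maxima_prob.
- by move=> i; rewrite p_maxE; exact: maxima_prob_maximum.
- by move=> i j ij; exact: (maxima_prob_pair_le R _ ij).
- by rewrite pE.
rewrite pE -[N.+2.-1]/(N.+1) -[k.+2.-1]/(k.+1).
have HN := harmonic_sum_ge1 R N.+1; have Hp := lt_le_trans ltr01 HN.
have HN2 := harmonic_sum_le_nat R N.+2.
(* A pair leaves [N] of the [N.+2] points, so its bound has moments of index [N]; monotonicity in
   the number of points brings them to index [N.+1]. *)
have a'a := mean_maxima_leS R k.+1 N; have b'b := mean_maxima_leS R k N.
have bH := mean_maxima_le R k N.+1; have aH := mean_maxima_ge R k.+1 N.+1.
have b'0 := mean_maxima_ge0 R k.+1 N; have a'0 := mean_maxima_ge0 R k.+2 N.
have eA : moment k.+2 N 1 = mean_maxima R k.+2 N / N.+1%:R :> R.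
  by rewrite /mean_maxima mulrAC mulfV// mul1r.
have eB : moment k.+1 N 1 = mean_maxima R k.+1 N / N.+1%:R :> R.
  by rewrite /mean_maxima mulrAC mulfV// mul1r.
rewrite eA eB.
move: (mean_maxima R k.+2 N) (mean_maxima R k.+1 N) (mean_maxima R k.+2 N.+1)
  (mean_maxima R k.+1 N.+1) a'a b'b bH aH b'0 a'0 a0 {eA eB pE} =>
  a' b' a b a'a b'b bH aH b'0 a'0 a0.
have c1 : 1 <= (k.+1)`!%:R :> R by rewrite ler1n fact_gt0.
move: (harmonic_sum R N.+2) ((k.+1)`!%:R : R) HN Hp HN2 bH aH c1 => h c h1 h0 hN bH aH c1.
have c0 := lt_le_trans ltr01 c1.
(* u bounds both 1 / a and b / a, because a >= h^(k+1) / c and b <= h^k. *)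
pose u := c / h.
have u0 : 0 < u by rewrite divr_gt0.
have hua : h ^+ k <= u * a.
  rewrite /u mulrAC ler_pdivlMr// -exprSr mulrC -ler_pdivrMr//.
have ua : 1 <= u * a by apply: le_trans hua; exact: exprn_ege1.
have b'ua : b' <= u * a by apply: (le_trans b'b); exact: le_trans hua.
have x1 : 1 <= N.+1%:R :> R by rewrite ler1n.
rewrite -[N.+2%:R]natr1 in hN *.
move: (N.+1%:R : R) x1 hN => x x1 hN; have x0 := lt_le_trans ltr01 x1.
pose v := x^-1.
have v0 : 0 < v by rewrite invr_gt0.
have v1 : v <= 1 by rewrite invf_le1.
(* From h <= x + 1 <= 2 x and c >= 1. *)
have v2 : v <= 2 * u.
  rewrite /v /u mulrA ler_pdivlMr// mulrC ler_pdivrMr//.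
  have : 0 <= (c - 1) * x by rewrite mulr_ge0 ?subr_ge0// ltW.
  by lra.
have -> : (a + (x + 1) * x * ((a' / x) ^+ 2 + 12 * (b' / x * (a' / x)))) / a ^+ 2 - 1 =
   (a + (1 + v) * (a' ^+ 2 + 12 * (b' * a'))) / a ^+ 2 - 1.
  by rewrite /v; field; rewrite !gt_eqF.
rewrite -mulrA -/u.
apply: (@le_trans _ _ ((u * a * a + (1 + v) * (a ^+ 2 + 12 * (u * a * a))) / a ^+ 2 - 1)).
  rewrite lerD2r ler_pM2r ?invr_gt0 ?exprn_gt0// lerD//.
    by rewrite ler_peMl// ltW.
  apply: (ler_wpM2l (addr_ge0 ler01 (ltW v0))); rewrite lerD//.
    by rewrite lerXn2r ?nnegrE// ltW.
  by rewrite ler_wpM2l// ler_pM.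
have -> : (u * a * a + (1 + v) * (a ^+ 2 + 12 * (u * a * a))) / a ^+ 2 - 1 =
  u + v + 12 * u + 12 * (u * v).
  by field; rewrite gt_eqF.
have uv : u * v <= u by rewrite ler_piMr// ltW.
(* With v <= 2 u and u v <= u, the constant is 1 + 2 + 12 + 12 = 27. *)
by lra.
Qed.

End maxima_total_error.

(** * Limits along the rows *)

Section asymptotics.
Context (R : realType) (k : nat) (k1 : (1 < k)%N).
Context (m : nat -> nat).
Hypothesis nm : \forall n \near \oo, (0 < n <= m n)%N.
Local Notation p n := (p_max R k (m n)).
Local Notation q n := (@maxima_prob R k (m n)).

Lemma row_size_cvgy : m n @[n --> \oo] --> \oo.
Proof.
apply/cvgnyPge => A; near=> n.
have /andP[_ h] : (0 < n <= m n)%N by near: n.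
by apply: leq_trans h; near: n; exact: nbhs_infty_ge.
Unshelve. all: by end_near. Qed.

Lemma p_max_cvg0 : p n @[n --> \oo] --> (0 : R).
Proof.
have h : p_max R k j @[j --> \oo] --> (0 : R).
  rewrite -(cvg_shiftS (fun j => p_max R k j)).
  under eq_fun do rewrite p_maxE.
  by case: k k1 => [|k']// _; exact: moment_cvg0.
exact: (cvg_comp _ _ row_size_cvgy h).
Qed.

Lemma harmonic_sum_row_cvgy : harmonic_sum R (m n) @[n --> \oo] --> +oo.
Proof.
by apply: (cvg_comp m (harmonic_sum R));
  [exact: row_size_cvgy|exact: harmonic_sum_cvgy].
Qed.

Lemma p_max_gt0 j : (0 < j)%N -> 0 < p_max R k j.
Proof.
case: j => // j _; rewrite p_maxE; case: k k1 => [|k']// _.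
have : 0 < mean_maxima R k'.+1 j.
  apply: lt_le_trans (mean_maxima_ge R k' j).
  rewrite divr_gt0 ?ltr0n ?fact_gt0// exprn_gt0//.
  exact: lt_le_trans (harmonic_sum_ge1 R j).
by rewrite /mean_maxima pmulr_rgt0.
Qed.

Lemma total_error_cvg0 : total_error (q n) (p n) @[n --> \oo] --> (0 : R).
Proof.
apply/cvgr0Pnorm_le => e e0; near=> n.
have /andP[n0 n_m] : (0 < n <= m n)%N by near: n.
have m2 : (1 < m n)%N.
  by near: n; move/cvgnyPge : row_size_cvgy; apply.
have te0 : 0 <= total_error (q n) (p n).
  by apply: fmean_ge0 => // z; exact: maxima_prob_ge0.
rewrite ger0_norm//.
apply: (le_trans (total_error_le _ _ _ e0)).
- exact: maxima_prob_ge0.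
- exact: sum_maxima_prob.
rewrite -/(maxima_sqr_error R k (m n)).
have Hbig : 27 * (k.-1)`!%:R / e ^+ 2 <= harmonic_sum R (m n).
  by near: n; move/cvgryPge : harmonic_sum_row_cvgy; apply.
have c0 : 0 < 27 * (k.-1)`!%:R :> R by rewrite mulr_gt0// ltr0n fact_gt0.
have H0 : 0 < harmonic_sum R (m n)
  by apply: lt_le_trans Hbig; rewrite divr_gt0// ?exprn_gt0.
have V : maxima_sqr_error R k (m n) <= e ^+ 2.
  apply: (le_trans (maxima_sqr_error_le R k1 m2)).
  by rewrite ler_pdivrMr// [leRHS]mulrC -ler_pdivrMr// ?exprn_gt0.
have : maxima_sqr_error R k (m n) / (2 * e) <= e / 2.
  rewrite ler_pdivrMr ?mulr_gt0//; apply: (le_trans V).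
  by rewrite le_eqVlt; apply/orP; left; apply/eqP; field.
by lra.
Unshelve. all: by end_near. Qed.

End asymptotics.

(** * The central limit theorem and its stability under small perturbations *)

Section central_limit.
Context (R : realType) (k : nat) (k1 : (1 < k)%N).
Context (m : nat -> nat) (s : R) (s0 : 0 < s).
Hypothesis nm : \forall n \near \oo, (0 < n <= m n)%N.
Local Notation p n := (p_max R k (m n)).
Local Notation q n := (@maxima_prob R k (m n)).
Hypothesis np_cvgy : n%:R * p n @[n --> \oo] --> +oo.
Hypothesis ratio_cvg : 1 - n%:R / (m n)%:R @[n --> \oo] --> s ^+ 2.
Local Notation tau n := (scale n (p n)).
Local Notation W n := (@centered_partial R (m n) n (p n)).

Let regime : \forall n \near \oo,
  [/\ (0 < n)%N, (n <= m n)%N, 0 < p n & p n <= 1 / 2].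
Proof.
have half : (0 : R) < 1 / 2 by lra.
have p2 : \forall n \near \oo, p n <= 1 / 2.
  exact: (cvgr_le _ (p_max_cvg0 k1 nm) _ half).
near=> n.
have /andP[n0 n_m] : (0 < n <= m n)%N by near: n.
split => //; first exact/p_max_gt0/(leq_trans n0).
by near: n.
Unshelve. all: by end_near. Qed.

Let fmean_perm n s' F :
  fmean (q n) F = fmean (q n) (fun z => F (perm_ffun s' z)).
Proof. exact: maxima_prob_reindex. Qed.

Let fmean_one n : (0 < m n)%N ->
  forall i : 'I_(m n), fmean (q n) (fun z => (z i)%:R) = p n.
Proof.
move=> m0 i; case: (m n) m0 i => // j _ i.
by rewrite p_maxE; exact: maxima_prob_maximum.
Qed.

Let inv_le2 (x : R) : x <= 1 / 2 -> (1 - x)^-1 <= 2.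
Proof.
move=> x2; have x1 : 0 < 1 - x by lra.
by rewrite -div1r ler_pdivrMr//; lra.
Qed.

Lemma scale_cvgy : tau n @[n --> \oo] --> +oo.
Proof.
apply/cvgryPge => A; near=> n.
have [n0 n_m p0 p2] : [/\ (0 < n)%N, (n <= m n)%N, 0 < p n & p n <= 1 / 2].
  by near: n.
have h : 2 * A ^+ 2 <= n%:R * p n by near: n; move/cvgryPge : np_cvgy; apply.
rewrite (le_trans (ler_norm A))// -sqrtr_sqr /scale ler_wsqrtr//.
rewrite mulrA; have := mulr_ge0 (ler0n R n) (ltW p0); nra.
Unshelve. all: by end_near. Qed.

Lemma inv_scale_cvg0 : (tau n)^-1 @[n --> \oo] --> (0 : R).
Proof.
apply/gtr0_cvgV0; last exact: scale_cvgy.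
near=> n.
have [n0 n_m p0 p2] : [/\ (0 < n)%N, (n <= m n)%N, 0 < p n & p n <= 1 / 2].
  by near: n.
by apply: scale_gt0 => //; lra.
Unshelve. all: by end_near. Qed.


Lemma mean_centered_partial_sqr_near :
  \forall n \near \oo, fmean (q n) (fun z => W n z ^+ 2) <= 2.
Proof.
near=> n.
have [n0 n_m p0 p2] : [/\ (0 < n)%N, (n <= m n)%N, 0 < p n & p n <= 1 / 2].
  by near: n.
apply: le_trans (inv_le2 p2).
apply: mean_centered_partial_sqr => //.
- exact: maxima_prob_ge0.
- by apply: fmean_one; exact: leq_trans n_m.
- by lra.
Unshelve. all: by end_near. Qed.

(** With f the Stein solution, h(W) = (s^2 - rho) f'(W) + (rho f'(W) - W f(W)): the first term
    vanishes with the ratio n / m, the second by the Stein estimate. *)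
Lemma stein_limit (h : R -> R) : centered_test_function s h ->
  fmean (q n) (fun z => h (W n z)) @[n --> \oo] --> (0 : R).
Proof.
move=> [[L hL] [A hA] inth].
have [f [f' [K [df fE f'K f'L]]]] := stein_solution s0 hL hA inth.
have K0 : 0 <= K by apply: le_trans (f'K 0).
pose bnd n : R := K * `|s ^+ 2 - (1 - n%:R / (m n)%:R)| +
  K * (2 * total_error (q n) (p n) + 10 * (tau n)^-1 + 4 * p n).
have bnd0 : bnd n @[n --> \oo] --> (0 : R).
  have -> : (0 : R) = K * `|s ^+ 2 - s ^+ 2| + K * (2 * 0 + 10 * 0 + 4 * 0).
    by rewrite subrr normr0; ring.
  apply: cvgD; apply: cvgMr.
    by apply: cvg_norm; apply: cvgB; [exact: cvg_cst|exact: ratio_cvg].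
  apply: cvgD; first apply: cvgD; apply: cvgMr.
  - exact: total_error_cvg0.
  - exact: inv_scale_cvg0.
  - exact: p_max_cvg0.
apply: norm_cvg0; apply: (squeeze_cvgr _ (cvg_cst (0 : R)) bnd0).
near=> n; rewrite normr_ge0 /=.
have [n0 n_m p0 p2] : [/\ (0 < n)%N, (n <= m n)%N, 0 < p n & p n <= 1 / 2].
  by near: n.
have p1 : p n < 1 by lra.
have m0 : (0 < m n)%N by exact: leq_trans n_m.
have sc := scale_gt0 n0 p0 p1.
have q0 := @maxima_prob_ge0 R k (m n); have q1 := sum_maxima_prob R k (m n).
have qm := fmean_one m0; have qs := @fmean_perm n.
set rho : R := 1 - n%:R / (m n)%:R.
have est := stein_estimate n0 n_m q0 qs qm p0 p1 df f'K f'L.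
have err := mean_dispersion_error n0 n_m q0 q1 qs qm p0 p1.
have i2 := inv_le2 p2.
have i0 : 0 < (1 - p n)^-1 by rewrite invr_gt0; lra.
have ti0 : 0 < (tau n)^-1 by rewrite invr_gt0.
have te0 : 0 <= total_error (q n) (p n) by apply: fmean_ge0.
(* Because the square of the scale, n p (1 - p), is at most m p. *)
have tmp : tau n / ((m n)%:R * p n) <= (tau n)^-1.
  have mp : 0 < (m n)%:R * p n by rewrite mulr_gt0// ltr0n.
  rewrite ler_pdivrMr// ler_pdivlMl// -expr2 scale_sqr//.
  apply: (@le_trans _ _ (n%:R * p n)).
    by rewrite ler_wpM2l// ler_piMr ?ltW//; lra.
  by rewrite (ler_wpM2r (ltW p0))// ler_nat.
have tmp0 : 0 <= tau n / ((m n)%:R * p n).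
  exact: (divr_ge0 (ltW sc) (mulr_ge0 (ler0n R _) (ltW p0))).
have -> : fmean (q n) (fun z => h (W n z)) =
    (s ^+ 2 - rho) * fmean (q n) (fun z => f' (W n z)) +
    fmean (q n) (fun z => rho * f' (W n z) - W n z * f (W n z)).
  rewrite -fmeanZ -fmeanD; apply: eq_fmean => z.
  by rewrite -[LHS]fE; ring.
rewrite (le_trans (ler_normD _ _))// lerD//.
  rewrite normrM mulrC ler_wpM2r// (le_trans (normr_fmean q0 _))//.
  by rewrite -[leRHS](fmean_cst q1); apply: fmean_le.
apply: (le_trans est); rewrite ler_wpM2l//.
set te := total_error _ _ in err te0 *; set P := p n in p0 p1 p2 i2 i0 err tmp *.
set ii := (1 - P)^-1 in i2 i0 err *; set ti := (tau n)^-1 in ti0 tmp *.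
set x := tau n / _ in tmp tmp0 err.
have e1 : x * ii <= ti * 2 by rewrite ler_pM// ltW.
have e2 : ii * (te + x * ii + 2 * P) <= 2 * (te + ti * 2 + 2 * P).
  have xi0 : 0 <= x * ii := mulr_ge0 tmp0 (ltW i0).
  by apply: ler_pM => //; [exact: ltW|lra|lra].
have e3 : ti * ii <= ti * 2 by rewrite ler_wpM2l// ltW.
by have := le_trans err e2; lra.
Unshelve. all: by end_near. Qed.

End central_limit.

Section perturbed_limit.
Context (R : realType) (k : nat) (k1 : (1 < k)%N).
Context (m : nat -> nat) (s : R) (s0 : 0 < s).
Hypothesis nm : \forall n \near \oo, (0 < n <= m n)%N.
Local Notation p n := (p_max R k (m n)).
Local Notation q n := (@maxima_prob R k (m n)).
Hypothesis np_cvgy : n%:R * p n @[n --> \oo] --> +oo.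
Hypothesis ratio_cvg : 1 - n%:R / (m n)%:R @[n --> \oo] --> s ^+ 2.
Local Notation W n := (@centered_partial R (m n) n (p n)).

Variable Delta : forall n, {ffun 'I_(m n) -> bool} -> R.
Hypothesis Delta_cvg0 :
  fmean (q n) (fun z => @Delta n z ^+ 2) @[n --> \oo] --> (0 : R).

Let q0 n := @maxima_prob_ge0 R k (m n).
Let q1 n := sum_maxima_prob R k (m n).

Let Delta_norm_cvg0 :
  fmean (q n) (fun z => `|@Delta n z|) @[n --> \oo] --> (0 : R).
Proof.
apply/cvgr0Pnorm_le => e e0; have e20 : 0 < e ^+ 2 by exact: exprn_gt0.
have De : \forall n \near \oo, fmean (q n) (fun z => @Delta n z ^+ 2) <= e ^+ 2.
  exact: (cvgr_le _ Delta_cvg0 _ e20).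
near=> n.
rewrite ger0_norm; last by apply: (fmean_ge0 (@q0 n)).
apply: (le_trans (fmean_norm_le (@q0 n) (@q1 n) (@Delta n) e0)).
have : fmean (q n) (fun z => @Delta n z ^+ 2) <= e ^+ 2.
  by near: n.
set V := fmean _ _ => V2.
have : V / (2 * e) <= e / 2.
  rewrite ler_pdivrMr ?mulr_gt0//; apply: (le_trans V2).
  by rewrite le_eqVlt; apply/orP; left; apply/eqP; field.
by lra.
Unshelve. all: by end_near. Qed.

(** Stability at the level of test functions: for an L-Lipschitz h the perturbation changes the mean
    by at most |L| times the mean of |Delta|. *)
Lemma perturbed_limit (x : R) :
  {for x, continuous (fun y : R => normal_mass s `]-oo, y]%classic)} ->
  fmean (q n) (fun z => (W n z + @Delta n z <= x)%R%:R) @[n --> \oo] -->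
  normal_mass s `]-oo, x]%classic.
Proof.
move=> cx.
(* The bound 6 is 2 * 2 + 2 * 1, from (W + Delta)^2 <= 2 W^2 + 2 Delta^2. *)
apply: (@cdf_convergence R s s0 (fun n => {ffun 'I_(m n) -> bool})
  (fun n => q n) (fun n z => W n z + @Delta n z) q0 q1 6) => //.
- have W2 := mean_centered_partial_sqr_near R k1 nm.
  have De : \forall n \near \oo, fmean (q n) (fun z => @Delta n z ^+ 2) <= 1.
    exact: (cvgr_le _ Delta_cvg0 _ (@ltr01 R)).
  near=> n.
  have W2n : fmean (q n) (fun z => W n z ^+ 2) <= 2 by near: n.
  have D1 : fmean (q n) (fun z => @Delta n z ^+ 2) <= 1.
    by near: n.
  apply: (@le_trans _ _ (fmean (q n)
      (fun z => 2 * W n z ^+ 2 + 2 * @Delta n z ^+ 2))).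
    apply: fmean_le => // z.
    by have := sqr_ge0 (W n z - @Delta n z); nra.
  by rewrite fmeanD !fmeanZ; lra.
- move=> h hh; have := stein_limit k1 s0 nm np_cvgy ratio_cvg hh => Wh.
  case: hh => [[L hL] _ _].
  have bnd0 : `|fmean (q n) (fun z => h (W n z))| +
      `|L| * fmean (q n) (fun z => `|@Delta n z|) @[n --> \oo] --> (0 : R).
    have -> : (0 : R) = `|0 : R| + `|L| * 0 by rewrite normr0 mulr0 addr0.
    by apply: cvgD; [exact: cvg_norm|apply: cvgMr].
  apply: norm_cvg0; apply: (squeeze_cvgr _ (cvg_cst (0 : R)) bnd0).
  near=> n; rewrite normr_ge0 /=.
  have -> : fmean (q n) (fun z => h (W n z + @Delta n z)) =
      fmean (q n) (fun z => h (W n z)) +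
      fmean (q n) (fun z => h (W n z + @Delta n z) - h (W n z)).
    by rewrite -fmeanD; apply: eq_fmean => z; rewrite addrCA subrr addr0.
  rewrite (le_trans (ler_normD _ _))// lerD2l (le_trans (normr_fmean (@q0 n) _))//.
  rewrite -fmeanZ; apply: fmean_le => // z; rewrite (le_trans (hL _ _))//.
  by rewrite addrAC subrr add0r ler_wpM2r// ler_norm.
Unshelve. all: by end_near. Qed.

(** The formula for [Y n] is asked for large n, where the normalizations are nonzero and n <= m n;
    the event then depends on the pattern of maxima alone. *)
Lemma perturbed_cvg_in_distribution d (T : measurableType d)
    (P : probability T R) (X : nat -> nat -> {RV P >-> k.-tuple R})
    (Y : nat -> T -> R) :
  iid_uniform_array m X ->
  (\forall n \near \oo, forall w, Y n w =
    W n (row_maxima m X n w) + @Delta n (row_maxima m X n w)) ->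
  cvg_in_distribution P Y (normal_prob 0 s).
Proof.
move=> iidX YE x cx.
have eN : (normal_mass s `]-oo, x]%classic)%:E = normal_prob 0 s `]-oo, x]%classic.
  by rewrite /normal_mass fineK// (fin_num_measure (normal_prob 0 s)).
suff : P [set w | Y n w <= x] @[n --> \oo] --> (normal_mass s `]-oo, x]%classic)%:E.
  by rewrite eN.
have PE : \forall n \near \oo, P [set w | Y n w <= x] =
    (fmean (q n) (fun z => (W n z + @Delta n z <= x)%R%:R))%:E.
  near=> n.
  have /andP[n0 _] : (0 < n <= m n)%N by near: n.
  have YEn w : Y n w = W n (row_maxima m X n w) + @Delta n (row_maxima m X n w).
    by move: w; near: n.
  rewrite -(row_maxima_event iidX n0 (fun z => W n z + @Delta n z <= x)).
  by congr (P _); apply/seteqP; split => w /=; rewrite YEn.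
apply: cvg_EFin; first by near=> n; rewrite (near PE n)//.
apply: cvg_trans (perturbed_limit cx); apply: near_eq_cvg.
by near=> n; rewrite /= (near PE n).
Unshelve. all: by end_near. Qed.

End perturbed_limit.

(** * Row sizes for the third part *)

Section intermediate_sequence.
Context (R : realType) (k : nat).
Implicit Types n : nat.

(* In dimension [k.+2], any ratio [m n / n] that is much larger than
   [harmonic_sum ^ k] and much smaller than [harmonic_sum ^ k.+1] works;
   [root_harmonic n ^ (2 k + 1)] is of order [harmonic_sum ^ (k + 1 / 2)]. *)
Definition root_harmonic n : nat := Num.truncn (Num.sqrt (harmonic_sum R n)).

Definition row_ratio n : nat := (root_harmonic n ^ k.*2.+1)%N.

Definition row_size n : nat := (n * row_ratio n)%N.

Lemma harmonic_sum_le_1ln n : (0 < n)%N -> harmonic_sum R n <= 1 + ln n%:R.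
Proof. by case: n => // n _; exact: harmonic_sum_le_ln. Qed.

Lemma root_harmonic_sqr_le n : (root_harmonic n)%:R ^+ 2 <= harmonic_sum R n.
Proof.
rewrite -[leRHS]sqr_sqrtr ?harmonic_sum_ge0// lerXn2r ?nnegrE ?sqrtr_ge0//.
by rewrite truncn_le sqrtr_ge0.
Qed.

Lemma root_harmonic_gt0 n : (0 < n)%N -> (0 < root_harmonic n)%N.
Proof.
case: n => // n _; rewrite truncn_gt0 -sqrtr1 ler_wsqrtr// harmonic_sum_ge1//.
Qed.

Lemma harmonic_sum_le_root_harmonic n : (0 < n)%N ->
  harmonic_sum R n <= 4 * (root_harmonic n)%:R ^+ 2.
Proof.
move=> n0; have j1 : 1 <= (root_harmonic n)%:R :> R by rewrite ler1n root_harmonic_gt0.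
apply: (@le_trans _ _ (((root_harmonic n).+1)%:R ^+ 2)).
  rewrite -[leLHS]sqr_sqrtr ?harmonic_sum_ge0// lerXn2r ?nnegrE ?sqrtr_ge0//.
  exact/ltW/truncnS_gt.
by rewrite -natr1; nra.
Qed.

Lemma root_harmonic_cvgy : (root_harmonic n)%:R @[n --> \oo] --> (+oo : set_system R).
Proof.
apply/cvgryPge => A; near=> n.
have : (`|A| + 1) ^+ 2 <= harmonic_sum R n.
  by near: n; move/cvgryPge : (@harmonic_sum_cvgy R); apply.
move=> h; have : `|A| + 1 <= Num.sqrt (harmonic_sum R n).
  by rewrite -[leLHS]ger0_norm ?addr_ge0// -sqrtr_sqr ler_wsqrtr.
have := truncnS_gt (Num.sqrt (harmonic_sum R n)); rewrite -/(root_harmonic n) -natr1.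
by have := ler_norm A; lra.
Unshelve. all: by end_near. Qed.

Lemma inv_root_harmonic_cvg0 (C : R) : C / (root_harmonic n)%:R @[n --> \oo] --> (0 : R).
Proof.
rewrite -(mulr0 C); apply: cvgMr.
apply/gtr0_cvgV0; last exact: root_harmonic_cvgy.
by near=> n; rewrite ltr0n root_harmonic_gt0//; near: n; exact: nbhs_infty_gt.
Unshelve. all: by end_near. Qed.

Lemma row_ratio_gt0 n : (0 < n)%N -> (0 < row_ratio n)%N.
Proof. by move=> n0; rewrite expn_gt0 root_harmonic_gt0. Qed.

Lemma row_size_gt0 n : (0 < n)%N -> (0 < row_size n)%N.
Proof. by move=> n0; rewrite muln_gt0 n0 row_ratio_gt0. Qed.

Lemma row_size_ge n : (0 < n)%N -> (n <= row_size n)%N.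
Proof. by move=> n0; rewrite leq_pmulr// row_ratio_gt0. Qed.

Lemma row_ratioE n : (row_ratio n)%:R = (root_harmonic n)%:R ^+ k.*2.+1 :> R.
Proof. by rewrite natrX. Qed.

Lemma row_ratio_ge_root_harmonic n : (0 < n)%N ->
  (root_harmonic n)%:R <= (row_ratio n)%:R :> R.
Proof.
by move=> n0; rewrite row_ratioE exprS ler_peMr// exprn_ege1// ler1n root_harmonic_gt0.
Qed.

(** Passing from n to [row_size n] costs a constant factor: 2 k + 6 collects 1, then 4 for ln n, and
    2 k + 1 for the logarithm of the ratio, by ln j <= j <= j^2. *)
Lemma harmonic_sum_row_size_le n : (0 < n)%N ->
  harmonic_sum R (row_size n) <= (k.*2 + 6)%:R * (root_harmonic n)%:R ^+ 2.
Proof.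
move=> n0; have j0 := root_harmonic_gt0 n0; have c0 := row_ratio_gt0 n0.
have j1 : 1 <= (root_harmonic n)%:R :> R by rewrite ler1n.
have lnn : ln n%:R <= harmonic_sum R n :> R.
  case: n n0 {j0 c0 j1} => // n _.
  by apply: (le_trans (ln_le_harmonic_sum R n)); exact: harmonic_sum_le.
have lnc : ln (row_ratio n)%:R <= k.*2.+1%:R * (root_harmonic n)%:R :> R.
  rewrite row_ratioE lnXn ?ltr0n// -[leLHS]mulr_natl ler_wpM2l// ltW// ln_sublinear//.
  by rewrite ltr0n.
have : harmonic_sum R (row_size n) <= 1 + ln (row_size n)%:R.
  exact/harmonic_sum_le_1ln/row_size_gt0.
rewrite /row_size natrM lnM ?posrE ?ltr0n// => h.
have Hj := harmonic_sum_le_root_harmonic n0.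
have : k.*2.+1%:R * (root_harmonic n)%:R <= k.*2.+1%:R * (root_harmonic n)%:R ^+ 2 :> R.
  by rewrite ler_wpM2l// expr2 ler_peMr.
have : 1 <= (root_harmonic n)%:R ^+ 2 :> R by exact: exprn_ege1.
rewrite natrD -[k.*2.+1%:R]natr1; lra.
Qed.

Lemma ratio_row_size_cvg0 : (n%:R / (row_size n)%:R : R) @[n --> \oo] --> (0 : R).
Proof.
apply: (squeeze_cvgr _ (cvg_cst (0 : R)) (inv_root_harmonic_cvg0 1)).
near=> n; have n0 : (0 < n)%N by near: n; exact: nbhs_infty_gt.
apply/andP; split; first by rewrite divr_ge0.
rewrite /row_size natrM invfM mulrA mulfV ?pnatr_eq0 -?lt0n//.
rewrite !mul1r lef_pV2 ?posrE ?ltr0n ?root_harmonic_gt0 ?row_ratio_gt0//.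
exact: row_ratio_ge_root_harmonic.
Unshelve. all: by end_near. Qed.

(** With j the root, the ratio times j is j^(2k+2), at most H^(k+2); and H <= 2 ln n as soon as H >=
    2. *)
Lemma row_size_log_cvg0 :
  (row_size n)%:R / (n%:R * ln (n%:R : R) ^+ k.+2) @[n --> \oo] --> (0 : R).
Proof.
apply: (squeeze_cvgr _ (cvg_cst (0 : R)) (inv_root_harmonic_cvg0 (2 ^+ k.+2))).
near=> n; have n0 : (0 < n)%N by near: n; exact: nbhs_infty_gt.
have H2 : 2 <= harmonic_sum R n by near: n; move/cvgryPge : (@harmonic_sum_cvgy R); apply.
have j0 : 0 < (root_harmonic n)%:R :> R by rewrite ltr0n root_harmonic_gt0.
have j1 : 1 <= (root_harmonic n)%:R :> R by rewrite ler1n root_harmonic_gt0.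
have lnH : harmonic_sum R n <= 2 * ln n%:R.
  by have := harmonic_sum_le_1ln n0; lra.
have ln0 : 0 < ln n%:R :> R by lra.
have lk0 : 0 < ln n%:R ^+ k.+2 :> R by exact: exprn_gt0.
have nn0 : n%:R != 0 :> R by rewrite pnatr_eq0 -lt0n.
apply/andP; split; first by rewrite divr_ge0// mulr_ge0// ltW.
rewrite /row_size natrM invfM mulrACA mulfV// mul1r.
rewrite ler_pdivrMr// [leRHS]mulrAC ler_pdivlMr//.
apply: (@le_trans _ _ (((root_harmonic n)%:R ^+ 2) ^+ k.+2)).
  rewrite row_ratioE -exprSr -exprM ler_weXn2l//.
  by rewrite mul2n !doubleS; do 2 apply: leqW.
by rewrite -exprMn lerXn2r ?nnegrE ?exprn_ge0// ?(le_trans (root_harmonic_sqr_le n))// mulr_ge0// ltW.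
Unshelve. all: by end_near. Qed.

Local Notation p n := (p_max R k.+2 (row_size n)).

Lemma mean_row_size n : (0 < n)%N -> exists2 j, row_size n = j.+1 &
  n%:R * p n = mean_maxima R k.+2 j / (row_ratio n)%:R.
Proof.
move=> n0; have := row_size_gt0 n0; have c0 := row_ratio_gt0 n0.
have e : (row_size n)%:R = n%:R * (row_ratio n)%:R :> R by rewrite /row_size natrM.
case E : (row_size n) => [|j]// _; exists j => //.
rewrite p_maxE /mean_maxima -E e.
by rewrite mulrAC mulfK// pnatr_eq0 -lt0n.
Qed.

(** The mean number of maxima is at least j^(2k+2) / (k + 1)!, one power of j more than the ratio:
    this is the upper constraint on the row size. *)
Lemma np_row_size_cvgy : n%:R * p n @[n --> \oo] --> +oo.
Proof.
apply/cvgryPge => A; near=> n.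
have n0 : (0 < n)%N by near: n; exact: nbhs_infty_gt.
have hA : A * (k.+1)`!%:R <= (root_harmonic n)%:R.
  by near: n; move/cvgryPge : root_harmonic_cvgy; apply.
have [j mj ->] := mean_row_size n0.
have j0 : 0 < (root_harmonic n)%:R :> R by rewrite ltr0n root_harmonic_gt0.
have c0 : 0 < (row_ratio n)%:R :> R by rewrite ltr0n row_ratio_gt0.
rewrite ler_pdivlMr//; apply: le_trans (mean_maxima_ge R k.+1 j).
rewrite ler_pdivlMr ?ltr0n ?fact_gt0// -mj.
have jH : (root_harmonic n)%:R ^+ 2 <= harmonic_sum R (row_size n).
  by rewrite (le_trans (root_harmonic_sqr_le n))// harmonic_sum_le// row_size_ge.
apply: (@le_trans _ _ (((root_harmonic n)%:R ^+ 2) ^+ k.+1)); last first.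
  by rewrite lerXn2r ?nnegrE ?exprn_ge0 ?harmonic_sum_ge0// ltW.
rewrite mulrAC -exprM mulnC muln2 doubleS exprS -row_ratioE ler_wpM2r// ltW//.
Unshelve. all: by end_near. Qed.

(** The product is at most a constant times H^k / j^(2k+1), of order 1 / j: this is the lower
    constraint on the row size. The maximum with 0 supplies the sign for the squeeze. *)
Lemma np_error_row_size_cvg0 :
  n%:R * p n * Num.max 0 (maxima_sqr_error R k.+2 (row_size n)) @[n --> \oo] --> (0 : R).
Proof.
pose C : R := 27 * (k.+1)`!%:R * (k.*2 + 6)%:R ^+ k.
apply: (squeeze_cvgr _ (cvg_cst (0 : R)) (inv_root_harmonic_cvg0 C)).
near=> n.
have n0 : (0 < n)%N by near: n; exact: nbhs_infty_gt.
have n1 : (1 < n)%N by near: n; exact: nbhs_infty_gt.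
have j0 : 0 < (root_harmonic n)%:R :> R by rewrite ltr0n root_harmonic_gt0.
have c0 : 0 < (row_ratio n)%:R :> R by rewrite ltr0n row_ratio_gt0.
have m1 : (1 < row_size n)%N by exact: leq_trans (row_size_ge n0).
have V := maxima_sqr_error_le R (isT : (1 < k.+2)%N) m1.
have [j mj ->] := mean_row_size n0.
have H0 : 0 < harmonic_sum R (row_size n)
  by rewrite mj; exact: lt_le_trans (harmonic_sum_ge1 R j).
have f0 : 0 < (k.+1)`!%:R :> R by rewrite ltr0n fact_gt0.
have a0 := mean_maxima_ge0 R k.+2 j; have aH := mean_maxima_le R k.+1 j.
have V0 : 0 <= Num.max 0 (maxima_sqr_error R k.+2 (row_size n)) by rewrite le_max lexx.
have ac0 : 0 <= mean_maxima R k.+2 j / (row_ratio n)%:R by rewrite divr_ge0.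
apply/andP; split; first exact: mulr_ge0.
apply: (@le_trans _ _ (harmonic_sum R (row_size n) ^+ k.+1 / (row_ratio n)%:R *
    (27 * (k.+1)`!%:R / harmonic_sum R (row_size n)))).
  apply: ler_pM => //; first by rewrite ler_pM2r ?invr_gt0// mj.
  by rewrite ge_max V andbT divr_ge0// ?mulr_ge0// ltW.
have -> : harmonic_sum R (row_size n) ^+ k.+1 / (row_ratio n)%:R *
    (27 * (k.+1)`!%:R / harmonic_sum R (row_size n)) =
    27 * (k.+1)`!%:R * harmonic_sum R (row_size n) ^+ k / (row_ratio n)%:R.
  by rewrite exprS; field; rewrite !gt_eqF.
rewrite ler_pdivrMr// [leRHS]mulrAC ler_pdivlMr// /C -!mulrA !ler_wpM2l//.
rewrite row_ratioE exprS; apply: (@le_trans _ _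
    (((k.*2 + 6)%:R * (root_harmonic n)%:R ^+ 2) ^+ k * (root_harmonic n)%:R)).
  rewrite ler_wpM2r// lerXn2r ?nnegrE ?mulr_ge0 ?harmonic_sum_ge0 ?exprn_ge0//.
  exact: harmonic_sum_row_size_le.
rewrite exprMn -exprM mul2n -mulrA (mulrC (_ ^+ k.*2)).
by [].
Unshelve. all: by end_near. Qed.

End intermediate_sequence.

(** * Mean-square convergence and the two normal limits *)

Section theorem_parts.
Context (R : realType) (k : nat).
Context d (T : measurableType d) (P : probability T R).
Implicit Types (m : nat -> nat) (X : nat -> nat -> {RV P >-> k.-tuple R}).

Lemma maxima_sqr_error_cvg0 : (0 < k)%N ->
  maxima_sqr_error R k n @[n --> \oo] --> (0 : R).
Proof.
have V0 n : 0 <= maxima_sqr_error R k n.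
  by apply: fmean_ge0 => z; [exact: maxima_prob_ge0|exact: sqr_ge0].
move=> k0; apply/cvgr0Pnorm_le => e e0; near=> n.
rewrite ger0_norm//.
have n1 : (1 < n)%N by near: n; exact: nbhs_infty_gt.
have [k1|k1] := ltnP 1 k; last first.
  have -> : k = 1%N by apply/eqP; rewrite eqn_leq k1.
  by rewrite (le_trans (maxima_sqr_error_dim1 R (ltnW n1)))// ltW.
apply: (le_trans (maxima_sqr_error_le R k1 n1)).
have Hn : 27 * (k.-1)`!%:R / e <= harmonic_sum R n.
  by near: n; move/cvgryPge : (@harmonic_sum_cvgy R); apply.
have c0 : 0 < 27 * (k.-1)`!%:R :> R by rewrite mulr_gt0// ltr0n fact_gt0.
have H0 : 0 < harmonic_sum R n by apply: lt_le_trans Hn; rewrite divr_gt0.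
by rewrite ler_pdivrMr// [leRHS]mulrC -ler_pdivrMr.
Unshelve. all: by end_near. Qed.

Lemma sum_Z_total m X n w : (0 < n)%N -> iid_uniform_array m X ->
  \sum_(i < m n) Z m X n i w = total R (row_maxima m X n w).
Proof. by move=> n0 iidX; apply: eq_bigr => i _; rewrite Z_row_maxima. Qed.

(** For n > 0 the L2 distance to 1 is exactly the square root of [maxima_sqr_error R k n]. *)
Lemma maxima_L2_limit m X : (0 < k)%N -> (forall n, (0 < n)%N -> m n = n) ->
  iid_uniform_array m X ->
  cvg_in_L2 P
    (fun n w => (n%:R * p_max R k n)^-1 * \sum_(i < n) Z m X n i w) (fun=> 1).
Proof.
move=> k0 mE iidX; rewrite /cvg_in_L2.
have NE : \forall n \near \oo,
    'N[P]_2%:E[(fun w => ((n%:R * p_max R k n)^-1 * \sum_(i < n) Z m X n i w - 1)%:E)]%E =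
    (Num.sqrt (maxima_sqr_error R k n))%:E.
  near=> n.
  have n0 : (0 < n)%N by near: n; exact: nbhs_infty_gt.
  have mnE : m n = n by exact: mE.
  rewrite unlock.
  have -> : maxima_sqr_error R k n = maxima_sqr_error R k (m n) by rewrite mnE.
  have V0 : 0 <= maxima_sqr_error R k (m n).
    by apply: fmean_ge0 => z; [exact: maxima_prob_ge0|exact: sqr_ge0].
  rewrite (_ : (\int[P]_w _)%E = (maxima_sqr_error R k (m n))%:E).
    by rewrite poweR_EFin powR12_sqrt.
  pose F (z : {ffun 'I_(m n) -> bool}) :=
    (total R z / ((m n)%:R * p_max R k (m n)) - 1) ^+ 2.
  transitivity (\int[P]_w (F (row_maxima m X n w))%:E)%E; last first.
    by rewrite (row_maxima_integral iidX n0)// => z; exact: sqr_ge0.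
  apply: eq_integral => w _.
  rewrite abse_EFin poweR_EFin; congr EFin.
  rewrite powR_mulrn// real_normK ?num_real// /F -sum_Z_total//.
  by rewrite mnE mulrC.
apply: cvg_EFin; first by near=> n; rewrite (near NE n).
apply: (@cvg_trans _ (Num.sqrt (maxima_sqr_error R k n) @[n --> \oo])).
  by apply: near_eq_cvg; near=> n; rewrite /= (near NE n).
apply/cvgr0Pnorm_le => e e0; have e20 : 0 < e ^+ 2 by exact: exprn_gt0.
have Ve : \forall n \near \oo, maxima_sqr_error R k n <= e ^+ 2.
  exact: (cvgr_le _ (maxima_sqr_error_cvg0 k0) _ e20).
near=> n; rewrite ger0_norm ?sqrtr_ge0// -[leRHS](ger0_norm (ltW e0)) -sqrtr_sqr.
by rewrite ler_wsqrtr//; near: n.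
Unshelve. all: by end_near. Qed.

Lemma sum_U m X n (r : nat) w : (0 < n)%N -> (r <= m n)%N ->
  iid_uniform_array m X ->
  \sum_(i < r) U m X n i w =
  (partial R r (row_maxima m X n w) - r%:R * p_max R k (m n)) /
  Num.sqrt (p_max R k (m n) * (1 - p_max R k (m n))).
Proof.
move=> n0 rm iidX; rewrite -mulr_suml sumrB sumr_const card_ord [in RHS]mulr_natl.
congr ((_ - _) / _).
rewrite (big_ord_widen _ (fun i => Z m X n i w) rm); apply: eq_bigr => i _.
by rewrite Z_row_maxima.
Qed.

Lemma partial_total (r : nat) (z : {ffun 'I_r -> bool}) : partial R r z = total R z.
Proof. by apply: eq_bigl => i; rewrite ltn_ord. Qed.

Lemma mp_cvgy : (1 < k)%N -> n%:R * p_max R k n @[n --> \oo] --> +oo.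
Proof.
case: k => [|[|k']]// _.
have lower n : (0 < n)%N -> harmonic_sum R n / (k'.+1)`!%:R <= n%:R * p_max R k'.+2 n.
  case: n => // n _; rewrite p_maxE; apply: le_trans (mean_maxima_ge R k'.+1 n).
  rewrite ler_pM2r ?invr_gt0 ?ltr0n ?fact_gt0//.
  by rewrite exprS ler_peMr ?harmonic_sum_ge0// exprn_ege1// harmonic_sum_ge1.
apply/cvgryPge => A; near=> n.
have n0 : (0 < n)%N by near: n; exact: nbhs_infty_gt.
have hA : A * (k'.+1)`!%:R <= harmonic_sum R n.
  by near: n; move/cvgryPge : (@harmonic_sum_cvgy R); apply.
by apply: le_trans (lower n n0); rewrite ler_pdivlMr// ltr0n fact_gt0.
Unshelve. all: by end_near. Qed.

(** The centerings by p cancel in the difference of the two averages, so for large n the statistic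
    is W itself, with zero perturbation. Moreover n p = (n / m)(m p) diverges because n / m stays
    away from 0. *)
Lemma subsample_limit m X (gamma : R) : (1 < k)%N ->
  (forall n, (0 < n)%N -> (0 < m n)%N) -> iid_uniform_array m X ->
  0 < gamma < 1 -> n%:R / (m n)%:R @[n --> \oo] --> gamma ->
  cvg_in_distribution P
    (fun n w => Num.sqrt n%:R *
       (n%:R^-1 * \sum_(i < n) U m X n i w
        - (m n)%:R^-1 * \sum_(i < m n) U m X n i w))
    (normal_prob 0 (Num.sqrt (1 - gamma))).
Proof.
move=> k1 m0 iidX /andP[g0 g1] ratio.
have s0 : 0 < Num.sqrt (1 - gamma) by rewrite sqrtr_gt0 subr_gt0.
have le1 : \forall n \near \oo, n%:R / (m n)%:R <= (1 : R).
  exact: (cvgr_le _ ratio _ g1).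
have nm : \forall n \near \oo, (0 < n <= m n)%N.
  near=> n.
  have n0 : (0 < n)%N by near: n; exact: nbhs_infty_gt.
  have h : n%:R / (m n)%:R <= (1 : R) by near: n.
  by rewrite n0/=; move: h; rewrite ler_pdivrMr ?ltr0n ?m0// mul1r ler_nat.
have np_cvgy : n%:R * p_max R k (m n) @[n --> \oo] --> +oo.
  have ge2 : \forall n \near \oo, gamma / 2 <= n%:R / (m n)%:R.
    by apply: (cvgr_ge _ ratio); lra.
  have mpy : (m n)%:R * p_max R k (m n) @[n --> \oo] --> +oo.
    apply: (cvg_comp m (fun j => j%:R * p_max R k j)); last exact: mp_cvgy.
    exact: row_size_cvgy nm.
  apply/cvgryPge => A; near=> n.
  have n0 : (0 < n)%N by near: n; exact: nbhs_infty_gt.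
  have h2 : gamma / 2 <= n%:R / (m n)%:R by near: n.
  have hA : 2 * `|A| / gamma <= (m n)%:R * p_max R k (m n).
    by near: n; move/cvgryPge : mpy; apply.
  have mn0 : (m n)%:R != 0 :> R by rewrite pnatr_eq0 -lt0n m0.
  rewrite (le_trans (ler_norm A))//.
  have -> : n%:R * p_max R k (m n) =
      n%:R / (m n)%:R * ((m n)%:R * p_max R k (m n)).
    by rewrite mulrA divfK.
  have -> : `|A| = gamma / 2 * (2 * `|A| / gamma) by field; rewrite gt_eqF.
  by apply: ler_pM => //; rewrite divr_ge0// ?mulr_ge0// ltW.
have ratio_cvg : 1 - n%:R / (m n)%:R @[n --> \oo] --> Num.sqrt (1 - gamma) ^+ 2.
  rewrite sqr_sqrtr ?subr_ge0 ?ltW//.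
  by apply: cvgB => //; exact: cvg_cst.
apply: (perturbed_cvg_in_distribution k1 s0 nm np_cvgy ratio_cvg
  (Delta := fun n _ => 0) _ iidX).
  rewrite (_ : (fun n => _) = cst 0); first exact: cvg_cst.
  by apply/funext => n; rewrite /fmean big1// => z _; rewrite expr0n mulr0.
have pm := p_max_cvg0 k1 nm (R := R).
have p1 : \forall n \near \oo, p_max R k (m n) < 1.
  exact: (cvgr_lt _ pm _ ltr01).
near=> n.
have /andP[n0 n_m] : (0 < n <= m n)%N by near: n.
have p1n : p_max R k (m n) < 1 by near: n.
move=> w; rewrite addr0.
have p0n : 0 < p_max R k (m n) by rewrite p_max_gt0// m0.
rewrite !sum_U// partial_total /centered_partial /scale.
set sg := Num.sqrt (p_max R k (m n) * (1 - p_max R k (m n))).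
rewrite [Num.sqrt (n%:R * _)]sqrtrM// -/sg.
have sg0 : 0 < sg by rewrite sqrtr_gt0 mulr_gt0 ?subr_gt0.
have sn0 : 0 < Num.sqrt n%:R :> R by rewrite sqrtr_gt0 ltr0n.
have nE : n%:R = Num.sqrt n%:R ^+ 2 :> R by rewrite sqr_sqrtr.
have m0n : 0 < (m n)%:R :> R by rewrite ltr0n m0.
set r := Num.sqrt n%:R in sn0 nE *.
by clearbody r; rewrite nE; field; rewrite !gt_eqF.
Unshelve. all: by end_near. Qed.

Lemma intermediate_limit X : (1 < k)%N -> iid_uniform_array (row_size R k.-2) X ->
  cvg_in_distribution P
    (fun n w => (Num.sqrt n%:R)^-1 * \sum_(i < n) U (row_size R k.-2) X n i w)
    (normal_prob 0 1).
Proof.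
move=> k1 iidX; set m := row_size R k.-2.
(* The row sizes are indexed so that dimension [k.+2] uses parameter [k]. *)
have kE : k = k.-2.+2 by case: k k1 => [|[|]].
have nm : \forall n \near \oo, (0 < n <= m n)%N.
  near=> n; have n0 : (0 < n)%N by near: n; exact: nbhs_infty_gt.
  by rewrite n0 row_size_ge.
have np_cvgy : n%:R * p_max R k (m n) @[n --> \oo] --> +oo.
  by have := @np_row_size_cvgy R k.-2; rewrite -kE.
have ratio_cvg : 1 - n%:R / (m n)%:R @[n --> \oo] --> (1 : R) ^+ 2.
  rewrite expr1n -[X in _ --> X]subr0.
  by apply: cvgB; [exact: cvg_cst|exact: ratio_row_size_cvg0].
have pm := p_max_cvg0 k1 nm (R := R).
have half : (0 : R) < 1 / 2 by lra.
have p2 : \forall n \near \oo, p_max R k (m n) <= 1 / 2.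
  exact: (cvgr_le _ pm _ half).
(* Written through the relative error of the total, so that its second moment is n p / (1 - p) times
   [maxima_sqr_error]. *)
pose Delta n (z : {ffun 'I_(m n) -> bool}) : R :=
  n%:R * p_max R k (m n) / scale n (p_max R k (m n)) *
  (total R z / ((m n)%:R * p_max R k (m n)) - 1).
have DeltaE : \forall n \near \oo,
    fmean (@maxima_prob R k (m n)) (fun z => Delta n z ^+ 2) <=
    2 * (n%:R * p_max R k (m n) * Num.max 0 (maxima_sqr_error R k (m n))).
  near=> n.
  have n0 : (0 < n)%N by near: n; exact: nbhs_infty_gt.
  have p2n : p_max R k (m n) <= 1 / 2 by near: n.
  have p0n : 0 < p_max R k (m n) by rewrite p_max_gt0// row_size_gt0.
  under eq_fmean do rewrite exprMn.
  rewrite fmeanZ expr_div_n scale_sqr//; last by lra.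
  rewrite -/(total_sqr_error _ _) -/(maxima_sqr_error R k (m n)).
  set V := maxima_sqr_error _ _ _; set p := p_max R k (m n) in p0n p2n *.
  have nR : 0 < n%:R :> R by rewrite ltr0n.
  have p1' : 0 < 1 - p by lra.
  have -> : (n%:R * p) ^+ 2 / (n%:R * (p * (1 - p))) * V = (1 - p)^-1 * (n%:R * p * V).
    by field; rewrite !gt_eqF.
  have np0 : 0 < n%:R * p by rewrite mulr_gt0.
  have i2 : (1 - p)^-1 <= 2 by rewrite -div1r ler_pdivrMr//; lra.
  apply: (@le_trans _ _ ((1 - p)^-1 * (n%:R * p * Num.max 0 V))).
    by rewrite ler_pM2l ?invr_gt0// ler_pM2l// le_max lexx orbT.
  by rewrite ler_wpM2r// mulr_ge0 ?(ltW np0)// le_max lexx.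
have Delta_cvg0 : fmean (@maxima_prob R k (m n)) (fun z => Delta n z ^+ 2)
    @[n --> \oo] --> (0 : R).
  have b0 : 2 * (n%:R * p_max R k (m n) * Num.max 0 (maxima_sqr_error R k (m n)))
      @[n --> \oo] --> (0 : R).
    rewrite -[X in _ --> X](mulr0 2); apply: cvgMr.
    by have := @np_error_row_size_cvg0 R k.-2; rewrite -kE.
  apply: (squeeze_cvgr _ (cvg_cst (0 : R)) b0).
  near=> n; rewrite (near DeltaE n)// andbT.
  by apply: fmean_ge0 => z; [exact: maxima_prob_ge0|exact: sqr_ge0].
apply: (perturbed_cvg_in_distribution k1 (@ltr01 R) nm np_cvgy ratio_cvg
  (Delta := Delta) Delta_cvg0 iidX).
near=> n.
have n0 : (0 < n)%N by near: n; exact: nbhs_infty_gt.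
have p2n : p_max R k (m n) <= 1 / 2 by near: n.
move=> w; have m0 := row_size_gt0 R k.-2 n0.
have p0n : 0 < p_max R k (m n) by rewrite p_max_gt0.
rewrite sum_U ?row_size_ge// /Delta /centered_partial /scale -/m.
set sg := Num.sqrt (p_max R k (m n) * (1 - p_max R k (m n))).
rewrite [Num.sqrt (n%:R * _)]sqrtrM// -/sg.
have sg0 : 0 < sg by rewrite sqrtr_gt0 mulr_gt0//; lra.
have sn0 : 0 < Num.sqrt n%:R :> R by rewrite sqrtr_gt0 ltr0n.
have nE : n%:R = Num.sqrt n%:R ^+ 2 :> R by rewrite sqr_sqrtr.
have m0n : 0 < (m n)%:R :> R by rewrite ltr0n.
set r := Num.sqrt n%:R in sn0 nE *.
by clearbody r; rewrite nE; field; rewrite !gt_eqF.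
Unshelve. all: by end_near. Qed.

End theorem_parts.

Theorem theorem4 (R : realType) (k : nat) (hk : (1 <= k)%N) :
  (forall (d : measure_display) (T : measurableType d) (P : probability T R)
      (m : nat -> nat) (X : nat -> nat -> {RV P >-> k.-tuple R}),
    (forall n, (0 < n)%N -> m n = n) ->
    iid_uniform_array m X ->
    cvg_in_L2 P
      (fun n w => (n%:R * p_max R k n)^-1 * \sum_(i < n) Z m X n i w)
      (fun=> 1))
  /\
  ((1 < k)%N ->
   forall (d : measure_display) (T : measurableType d) (P : probability T R)
      (m : nat -> nat) (X : nat -> nat -> {RV P >-> k.-tuple R}) (gamma : R),
    (forall n, (0 < n)%N -> (0 < m n)%N) ->
    iid_uniform_array m X ->
    0 < gamma < 1 ->
    n%:R / (m n)%:R @[n --> \oo] --> gamma ->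
    cvg_in_distribution P
      (fun n w => Num.sqrt n%:R *
         (n%:R^-1 * \sum_(i < n) U m X n i w
          - (m n)%:R^-1 * \sum_(i < m n) U m X n i w))
      (normal_prob 0 (Num.sqrt (1 - gamma))))
  /\
  ((1 < k)%N ->
   exists m : nat -> nat,
    [/\ forall n, (0 < n)%N -> (0 < m n)%N,
        (n%:R / (m n)%:R : R) @[n --> \oo] --> (0 : R),
        (m n)%:R / (n%:R * ln (n%:R : R) ^+ k) @[n --> \oo] --> (0 : R)
      & forall (d : measure_display) (T : measurableType d)
          (P : probability T R) (X : nat -> nat -> {RV P >-> k.-tuple R}),
        iid_uniform_array m X ->
        cvg_in_distribution P
          (fun n w => (Num.sqrt n%:R)^-1 * \sum_(i < n) U m X n i w)
          (normal_prob 0 1)]).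
Proof.
split; [|split].
- by move=> d T P m X mE iidX; exact: maxima_L2_limit.
- by move=> k1 d T P m X gamma m0 iidX g01 ratio; exact: subsample_limit iidX g01 ratio.
(* The witness is fixed by [R] and [k], before any probability space or array is given. *)
move=> k1; exists (row_size R k.-2); split.
- by move=> n; exact: row_size_gt0.
- exact: ratio_row_size_cvg0.
- by have := @row_size_log_cvg0 R k.-2; case: k hk k1 => [|[|]].
- by move=> d T P X iidX; exact: intermediate_limit.
Qed.
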